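(* Let $k$ be a field, set $Q=k[[x,y,z]]$ and $\mathfrak q=(x,y,z)$. Let $I\subseteq\mathfrak q^2$ be a homogeneous ideal such that $R=Q/I$ is compressed artinian of type $2$. Assume that $I=I_1\cap I_2$ for homogeneous ideals $I_1,I_2\subseteq\mathfrak q^2$ such that $Q/I_1$ and $Q/I_2$ are compressed (artinian) Gorenstein rings. Let $\chi^{s_1}+\chi^s$ be the socle polynomial of $R$ with $s_1\le s$, and assume that $s$ is odd and $s\ge5$. Set $$N(s)=\frac{s-2+\sqrt{4s+13}}{2}.$$ There are inequalities $\frac{s+1}{2}\le s_1\le s$ and $\frac{s+1}{2}<N(s)<s$, and the following assertions hold. (a) If $s_1<N(s)$, then $R$ is of class $\mathbf G(r)$ (for some $r\ge1$). (b) If $N(s)\le s_1$, then $R$ is of class $\mathbf H(0,0)$, i.e. Golod.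
   Context: Homogeneous ideals of the power series ring $Q$ are ideals generated by homogeneous polynomials (standard grading). For an artinian local ring $(R,\mathfrak m,k)$: the socle is $\operatorname{Soc}R=(0:_R\mathfrak m)$; the type of $R$ is $\operatorname{rank}_k\operatorname{Soc}R$; the socle degree is the integer $s$ with $\mathfrak m^s\ne 0=\mathfrak m^{s+1}$; the socle polynomial is $\sum_{i=0}^s\operatorname{rank}_k\!\left(\frac{\mathfrak m^i\cap\operatorname{Soc}R}{\mathfrak m^{i+1}\cap\operatorname{Soc}R}\right)\chi^i$; the Hilbert function is $h_R(i)=\operatorname{rank}_k(\mathfrak m^i/\mathfrak m^{i+1})$. Put $h_Q(i)=\binom{i+2}{2}$ for $i\ge0$ and $h_Q(i)=0$ for $i<0$. Compressed: an artinian Gorenstein quotient $S$ of $Q$ (by an ideal in $\mathfrak q^2$) of socle degree $\sigma$ is compressed if $h_S(i)=\min\{h_Q(i),h_Q(\sigma-i)\}$ for all $i\ge0$. An artinian quotient $R$ of $Q$ (by an ideal in $\mathfrak q^2$) of type $2$ with socle polynomial $\chi^{c}+\chi^{s}$, $c\le s$, is compressed if $h_R(i)=\min\{h_Q(i),h_Q(c-i)+h_Q(s-i)\}$ for all $i\ge 0$. Classes: let $A=\operatorname{Tor}^Q_*(R,k)$ with its graded-commutative $k$-algebra structure (equivalently, the Koszul homology algebra of $R$). For $R=Q/I$ artinian of type $2$, with $I\subseteq\mathfrak q^2$ minimally generated by $m$ elements, $A_1,A_2,A_3$ have ranks $m$, $m+1$, $2$. $R$ is of class $\mathbf G(r)$,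 $r\ge1$, if there are bases $e_1,\dots,e_m$ of $A_1$, $f_1,\dots,f_{m+1}$ of $A_2$, $g_1,g_2$ of $A_3$ such that $e_if_i=g_1$ for $1\le i\le r$ and all products of basis elements not determined by these and graded commutativity are zero. $R$ is of class $\mathbf H(0,0)$ if all products in $A_{\ge1}$ are zero; the rings of this class are precisely the Golod rings. *)

(* Defs.v *)
From HB Require Import structures.
From mathcomp Require Import all_boot all_order all_algebra.
From mathcomp Require Import boolp classical_sets reals.
From mathcomp Require Import mpoly.

Set Implicit Arguments.
Unset Strict Implicit.
Unset Printing Implicit Defensive.

Import GRing.Theory.
Local Open Scope ring_scope.
Local Open Scope quotient_scope.
Local Open Scope classical_set_scope.

(* Formal power series in n commuting variables over R, given by their
   coefficient functions, with the convolution product.  The ring laws are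
   transported from {mpoly R[n]}: a coefficient of a product depends only on
   truncations of the factors. *)

Definition powser (n : nat) (R : comNzRingType) : Type := 'X_{1..n} -> R.

HB.instance Definition _ n R := gen_eqMixin (powser n R).
HB.instance Definition _ n R := gen_choiceMixin (powser n R).

Section PowSerRing.
Variables (n : nat) (R : comNzRingType).
Implicit Types (f g h : powser n R) (m : 'X_{1..n}) (c : R).

Definition ps_zero : powser n R := fun=> 0.
Definition ps_opp f : powser n R := fun m => - f m.
Definition ps_add f g : powser n R := fun m => f m + g m.
Definition ps_one : powser n R := fun m => (m == 0%MM)%:R.
Definition ps_mul f g : powser n R := fun m =>
  \sum_(k : 'X_{1..n < (mdeg m).+1, (mdeg m).+1} | m == (k.1 + k.2)%MM)
    f k.1 * g k.2.
Definition ps_scale c f : powser n R := fun m => c * f m.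

Definition ps_trunc d f : {mpoly R[n]} :=
  \sum_(m : 'X_{1..n < d}) f m *: 'X_[m].

Lemma ps_truncE d f m : (mdeg m < d)%N -> (ps_trunc d f)@_m = f m.
Proof. exact: mcoeff_mpoly. Qed.

Lemma ps_mulE d f g m (p q : {mpoly R[n]}) : (mdeg m < d)%N ->
    (forall l, (mdeg l < d)%N -> p@_l = f l) ->
    (forall l, (mdeg l < d)%N -> q@_l = g l) ->
  ps_mul f g m = (p * q)@_m.
Proof.
move=> md pf qg; rewrite mcoeffM; apply: eq_bigr => k _.
by rewrite pf ?qg //; apply: leq_trans (bmdeg _) md.
Qed.

Lemma ps_addA : associative ps_add.
Proof. by move=> f g h; apply/funext => m; rewrite /ps_add addrA. Qed.

Lemma ps_addC : commutative ps_add.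
Proof. by move=> f g; apply/funext => m; rewrite /ps_add addrC. Qed.

Lemma ps_add0 : left_id ps_zero ps_add.
Proof. by move=> f; apply/funext => m; rewrite /ps_add add0r. Qed.

Lemma ps_addN : left_inverse ps_zero ps_opp ps_add.
Proof. by move=> f; apply/funext => m; rewrite /ps_add addNr. Qed.

Lemma ps_mulA : associative ps_mul.
Proof.
move=> f g h; apply/funext => m; set d := (mdeg m).+1.
have tr := @ps_truncE d.
have trM p q l : (mdeg l < d)%N -> (ps_trunc d p * ps_trunc d q)@_l = ps_mul p q l.
  by move=> ld; rewrite (ps_mulE ld (tr p) (tr q)).
rewrite (ps_mulE (ltnSn _) (tr f) (trM g h)) mulrA.
by rewrite (ps_mulE (ltnSn _) (trM f g) (tr h)).
Qed.

Lemma ps_mulC : commutative ps_mul.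
Proof.
move=> f g; apply/funext => m; have tr := @ps_truncE (mdeg m).+1.
rewrite (ps_mulE (ltnSn _) (tr f) (tr g)) mulrC.
by rewrite (ps_mulE (ltnSn _) (tr g) (tr f)).
Qed.

Lemma ps_mul1 : left_id ps_one ps_mul.
Proof.
move=> f; apply/funext => m; have tr := @ps_truncE (mdeg m).+1.
by rewrite (ps_mulE (ltnSn _) (p := 1) _ (tr f)) ?mul1r ?tr // => l; rewrite mcoeff1.
Qed.

Lemma ps_mulDl : left_distributive ps_mul ps_add.
Proof.
move=> f g h; apply/funext => m; rewrite /ps_add /ps_mul -big_split.
by apply: eq_bigr => k _; rewrite mulrDl.
Qed.

Lemma ps_one_neq0 : ps_one != ps_zero.
Proof.
by apply/eqP => /(congr1 (@^~ 0%MM)) /eqP; rewrite /ps_one eqxx oner_eq0.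
Qed.

HB.instance Definition _ := GRing.isZmodule.Build (powser n R)
  ps_addA ps_addC ps_add0 ps_addN.
HB.instance Definition _ := GRing.Zmodule_isComNzRing.Build (powser n R)
  ps_mulA ps_mulC ps_mul1 ps_mulDl ps_one_neq0.

Lemma ps_scaleA a b f : ps_scale a (ps_scale b f) = ps_scale (a * b) f.
Proof. by apply/funext => m; rewrite /ps_scale mulrA. Qed.

Lemma ps_scale1 : left_id 1 ps_scale.
Proof. by move=> f; apply/funext => m; rewrite /ps_scale mul1r. Qed.

Lemma ps_scaleDr : right_distributive ps_scale +%R.
Proof. by move=> a f g; apply/funext => m; rewrite /ps_scale mulrDr. Qed.

Lemma ps_scaleDl f : {morph ps_scale^~ f : a b / a + b}.
Proof. by move=> a b; apply/funext => m; rewrite /ps_scale mulrDl. Qed.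

HB.instance Definition _ := GRing.Zmodule_isLmodule.Build R (powser n R)
  ps_scaleA ps_scale1 ps_scaleDr ps_scaleDl.

Lemma ps_scaleAl c f g : c *: (f * g) = (c *: f) * g.
Proof.
by apply/funext => m; rewrite [LHS]mulr_sumr; apply: eq_bigr => k _; rewrite mulrA.
Qed.

HB.instance Definition _ := GRing.Lmodule_isLalgebra.Build R (powser n R) ps_scaleAl.
HB.instance Definition _ := GRing.Lalgebra_isComAlgebra.Build R (powser n R).

Definition ps_of_mpoly (p : {mpoly R[n]}) : powser n R := fun m => p@_m.
Definition ps_var (i : 'I_n) : powser n R := ps_of_mpoly 'X_i.

End PowSerRing.

(* The quotient of an algebra by an ideal is an algebra. *)
Section QuotAlgebra.
Variables (k : comNzRingType) (n : nat) (I : idealr (powser n k)).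
Implicit Types (a b : k) (u v : {ideal_quot I}).

Definition quot_scale a u : {ideal_quot I} := \pi_({ideal_quot I}) a%:A * u.

Lemma quot_scaleA a b u : quot_scale a (quot_scale b u) = quot_scale (a * b) u.
Proof. by rewrite /quot_scale mulrA -rmorphM -scalerAl mul1r scalerA. Qed.

Lemma quot_scale1 : left_id 1 quot_scale.
Proof. by move=> u; rewrite /quot_scale scale1r rmorph1 mul1r. Qed.

Lemma quot_scaleDr : right_distributive quot_scale +%R.
Proof. by move=> a u v; rewrite /quot_scale mulrDr. Qed.

Lemma quot_scaleDl u : {morph quot_scale^~ u : a b / a + b}.
Proof. by move=> a b; rewrite /quot_scale scalerDl rmorphD mulrDl. Qed.

HB.instance Definition _ := GRing.Zmodule_isLmodule.Build k {ideal_quot I}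
  quot_scaleA quot_scale1 quot_scaleDr quot_scaleDl.

Lemma quot_scaleAl a u v : a *: (u * v) = (a *: u) * v.
Proof. exact: mulrA. Qed.

HB.instance Definition _ :=
  GRing.Lmodule_isLalgebra.Build k {ideal_quot I} quot_scaleAl.
HB.instance Definition _ :=
  GRing.Lalgebra_isComAlgebra.Build k {ideal_quot I}.

End QuotAlgebra.

Section Ideals.
Variable A : comNzRingType.
Implicit Types (S J : set A).

Definition ideal_gen S : set A :=
  [set a | exists l (r g : 'I_l -> A),
     (forall j, S (g j)) /\ a = \sum_j r j * g j].

Definition ideal_pow J (i : nat) : set A :=
  ideal_gen [set a | exists g : 'I_i -> A,
     (forall j, J (g j)) /\ a = \prod_j g j].

Definition is_ideal J : Prop :=
  [/\ J 0, forall a b, J a -> J b -> J (a + b) & forall a b, J b -> J (a * b)].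

Definition artinian : Prop :=
  forall J : nat -> set A, (forall i, is_ideal (J i)) ->
    (forall i, J i.+1 `<=` J i) ->
  exists i0, forall i, (i0 <= i)%N -> J i = J i0.

End Ideals.

Section Rank.
Variables (k : fieldType) (V : lmodType k).
Implicit Types U W : set V.

(* The classes of b_0, ..., b_(l-1) form a k-basis of U / W, for subspaces
   W of U. *)
Definition basis_mod U W l (b : 'I_l -> V) : Prop :=
  (forall j, U (b j)) /\
  (forall u, U u -> exists! c : 'rV[k]_l, W (u - \sum_j c 0 j *: b j)).

Definition has_rank U W (l : nat) : Prop :=
  exists b : 'I_l -> V, basis_mod U W b.

End Rank.

(* In what follows (A, (t)) is a local k-algebra with residue field k whose
   maximal ideal is generated by the sequence t. *)
Section LocalAlgebra.
Variables (k : fieldType) (A : comAlgType k) (n : nat) (t : 'I_n -> A).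

Definition maxideal : set A := ideal_gen (range t).

Definition socle : set A := [set a | forall x, maxideal x -> x * a = 0].

Definition has_type (l : nat) : Prop := has_rank socle [set 0] l.

Definition socle_degree (s : nat) : Prop :=
  ideal_pow maxideal s <> [set 0] /\ ideal_pow maxideal s.+1 = [set 0].

Definition socle_polynomial (p : {poly nat}) : Prop :=
  exists s, [/\ socle_degree s, (size p <= s.+1)%N &
    forall i, (i <= s)%N ->
      has_rank (ideal_pow maxideal i `&` socle)
               (ideal_pow maxideal i.+1 `&` socle) (p`_i)%R].

Definition hilbert_value (i h : nat) : Prop :=
  has_rank (ideal_pow maxideal i) (ideal_pow maxideal i.+1) h.

(* For an artinian local ring: Gorenstein = type one. *)
Definition artinian_gorenstein : Prop := artinian A /\ has_type 1.

(* The Koszul complex on t: u : {ffun {set 'I_n} -> A} stands for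
   \sum_S u_S e_S, where e_S is the exterior product of the e_i, i in S, in
   increasing order.  The differential maps e_i to t_i. *)

Local Notation K := {ffun {set 'I_n} -> A}.

Definition koszul_mul (u v : K) : K :=
  [ffun S : {set 'I_n} => \sum_(T : {set 'I_n} | T \subset S)
     (-1) ^+ #|[pred p : 'I_n * 'I_n |
                 [&& p.1 \in T, p.2 \in S :\: T & (p.2 < p.1)%N]]|
       * u T * v (S :\: T)].

Definition koszul_d (u : K) : K :=
  [ffun S : {set 'I_n} => \sum_(i | i \notin S)
     (-1) ^+ #|[pred j in S | (j < i)%N]| * t i * u (i |: S)].

Definition koszul_deg (p : nat) : set K :=
  [set u | forall S : {set 'I_n}, #|S| != p -> u S = 0].

Definition koszul_cycle (p : nat) : set K :=
  [set u | koszul_deg p u /\ koszul_d u = 0].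

Definition koszul_boundary (p : nat) : set K :=
  [set u | exists2 w, koszul_deg p.+1 w & u = koszul_d w].

(* The classes of the u_j form a basis of the p-th Koszul homology. *)
Definition koszul_basis (p l : nat) (u : 'I_l -> K) : Prop :=
  basis_mod (koszul_cycle p) (koszul_boundary p) u.

(* Products of basis elements in degrees not listed vanish by graded
   commutativity or, for n = 3, because their degree exceeds 3. *)
Definition class_G (r : nat) : Prop :=
  exists m (e : 'I_m -> K) (f : 'I_m.+1 -> K) (g : 'I_2 -> K),
    [/\ koszul_basis 1 e, koszul_basis 2 f, koszul_basis 3 g, (r <= m)%N &
      (forall i j, koszul_boundary 2 (koszul_mul (e i) (e j))) /\
      (forall i j, koszul_boundary 3 (koszul_mul (e i) (f j)
         - (if (i == j :> nat) && (i < r)%N then g 0 else 0)))].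

Definition class_H00 : Prop :=
  forall p q u v, (0 < p)%N -> (0 < q)%N ->
    koszul_cycle p u -> koszul_cycle q v ->
  koszul_boundary (p + q) (koszul_mul u v).

End LocalAlgebra.

Section Quotients.
Variable k : fieldType.
Local Notation Q := (powser 3 k).
Implicit Type I : idealr Q.

Definition homogeneous_ideal I : Prop :=
  exists S : set {mpoly k[3]},
    (forall p, S p -> exists d : nat, p \is d.-homog) /\
    [set` I] = ideal_gen [set ps_of_mpoly p | p in S].

Definition qideal : set Q := maxideal (@ps_var 3 k).

Definition in_qsquare I : Prop := [set` I] `<=` ideal_pow qideal 2.

Definition quot_vars I (i : 'I_3) : {ideal_quot I} :=
  \pi_({ideal_quot I}) (ps_var k i).

Definition hQ (i : int) : nat := if i is Posz j then 'C(j + 2, 2) else 0%N.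

Definition compressed_gorenstein I : Prop :=
  [/\ in_qsquare I, artinian_gorenstein (quot_vars I) &
    exists2 sigma : nat, socle_degree (quot_vars I) sigma &
      forall i : nat, hilbert_value (quot_vars I) i
        (minn (hQ i%:Z) (hQ (sigma%:Z - i%:Z)))].

Definition compressed_type2 I (c s : nat) : Prop :=
  [/\ in_qsquare I,
      artinian {ideal_quot I} /\ has_type (quot_vars I) 2, (c <= s)%N,
      socle_polynomial (quot_vars I) ('X^c + 'X^s) &
      forall i : nat, hilbert_value (quot_vars I) i
        (minn (hQ i%:Z) (hQ (c%:Z - i%:Z) + hQ (s%:Z - i%:Z))%N)].

End Quotients.

Definition Nbound (F : realType) (s : nat) : F :=
  (s%:R - 2 + Num.sqrt (4 * s%:R + 13)) / 2.

(* Main.v *)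
(* Let s = 2t + 1, let q be the ideal of the variables, and let Q/I2 be the
   factor of socle degree s.  Comparing Hilbert functions gives I <= q^(t+1),
   t < s1, and, with a = s1 - t - 1, that I has no element of order t + 1 exactly
   when 'C(a + 2, 2) >= t + 2, which is the condition N(s) <= s1.
   In that case every Koszul cycle of positive degree is homologous to one with
   coefficients in q^(t+1), and q^(2t+2) <= I kills all the products.
   Otherwise homogeneity forces Q/I1 to have socle degree s1, and counting
   lengths gives q^(t+1) <= I1 + I2.  Let phi be the functional that defines I2
   by duality.  Every functional on Q/q^(t+1) has the form phi (p * _), where
   p can be taken in q^(t+1), hence, modulo I2, in I1.  If f in I has nonzero coefficient f_m at a
   monomial m of degree t + 1, write f = sum_i x_i u_i and choose v_i in I1
   with phi (v_i * u) = (x_i u)_m for all u; then v is a 2-cycle, u is a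
   1-cycle, and phi (sum_i u_i v_i) = f_m, so that their product is not zero.
   The same duality shows that cycles of degree two with coefficients in
   q^(2t) and in q^(s1+1) are boundaries, which kills the products of 1-cycles.
   Products of 1-cycles and 2-cycles lie in the line m^s of R, and Gaussian
   elimination on this bilinear form puts the bases in the required shape. *)
From HB Require Import structures.
Require Import Defs.
From mathcomp Require Import all_boot all_order all_algebra.
From mathcomp Require Import boolp classical_sets reals.
From mathcomp Require Import mpoly.
From mathcomp Require Import zify ring lra.

Set Implicit Arguments.
Unset Strict Implicit.
Unset Printing Implicit Defensive.

Import Order.TTheory GRing.Theory Num.Theory.
Local Open Scope ring_scope.
Local Open Scope quotient_scope.
Local Open Scope classical_set_scope.

(** * Ranks of quotients of vector spaces *)

(** The threshold comes from one degree. In degree [t + 1] the ring [Q] has [t + 2] more monomials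
    than in degree [t], while the socle in degree [s1] adds at most ['C(a + 2, 2)] to the Hilbert
    function of [R]; the missing forms lie in [I]. Cycles can be moved to high order because the
    Koszul complex of [Q] is exact in degrees one and two and its differential is linear: if [I] has
    order [n + 1], a cycle over [Q/I] is a cycle over [Q] up to order [n + 1], hence a boundary up
    to order [n]. In three variables the differentials are the dot product, the cross product and
    the scaling with the vector of variables, and the products are cross and dot products, so all
    boundary formulas are triple product identities. The obstacle is that below the threshold
    products only reach order [2 t], one short of the top degree. Duality and gaps in the socle
    supply what is missing, except for [s = 5], [s1 = 4], where the leading forms of degree [t + 1]
    in [I] are multiples of a single one. Lengths are measured in truncations of [Q], since all
    ideals involved contain a power of the maximal ideal. *)

Section RankTheory.
Variable k : fieldType.

Definition subspace (V : lmodType k) (U : set V) : Prop :=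
  U 0 /\ forall a u v, U u -> U v -> U (a *: u + v).

Section Subspace.
Variables (V : lmodType k) (U : set V).
Hypothesis sU : subspace U.

Lemma subspace0 : U 0. Proof. by case: sU. Qed.

Lemma subspaceP a u v : U u -> U v -> U (a *: u + v).
Proof. by case: sU => _; apply. Qed.

Lemma subspaceD u v : U u -> U v -> U (u + v).
Proof. by move=> Uu Uv; rewrite -[u]scale1r; apply: subspaceP. Qed.

Lemma subspaceZ a u : U u -> U (a *: u).
Proof. by move=> Uu; rewrite -[_ *: _]addr0; apply: subspaceP => //; apply: subspace0. Qed.

Lemma subspaceN u : U u -> U (- u).
Proof. by rewrite -scaleN1r; apply: subspaceZ. Qed.

Lemma subspaceB u v : U u -> U v -> U (u - v).
Proof. by move=> Uu Uv; apply/subspaceD/subspaceN. Qed.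

Lemma subspace_sum l (f : 'I_l -> V) : (forall i, U (f i)) -> U (\sum_i f i).
Proof.
by move=> Uf; elim/big_ind: _ => //; [apply: subspace0 | apply: subspaceD].
Qed.

Lemma subspace_comb l (c : 'I_l -> k) (f : 'I_l -> V) :
  (forall i, U (f i)) -> U (\sum_i c i *: f i).
Proof. by move=> Uf; apply: subspace_sum => i; apply: subspaceZ. Qed.

End Subspace.

Lemma subspace_set0 (V : lmodType k) : subspace [set 0 : V].
Proof. by split=> // a u v -> ->; rewrite scaler0 addr0. Qed.

Lemma subspace_setT (V : lmodType k) : subspace [set: V].
Proof. by []. Qed.

Lemma subspaceI (V : lmodType k) (U W : set V) :
  subspace U -> subspace W -> subspace (U `&` W).
Proof.
move=> sU sW; split=> [|a u v [Uu Wu] [Uv Wv]].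
  by split; apply: subspace0.
by split; apply: subspaceP.
Qed.

Definition add_set (V : lmodType k) (U W : set V) : set V :=
  [set v | exists a b, [/\ U a, W b & v = a + b]].

Lemma add_setl (V : lmodType k) (U W : set V) : subspace W -> U `<=` add_set U W.
Proof. by move=> sW u Uu; exists u, 0; split; rewrite ?addr0 //; apply: subspace0. Qed.

Lemma add_setr (V : lmodType k) (U W : set V) : subspace U -> W `<=` add_set U W.
Proof. by move=> sU w Ww; exists 0, w; split; rewrite ?add0r //; apply: subspace0. Qed.

Lemma subspace_add (V : lmodType k) (U W : set V) : subspace U -> subspace W ->
  subspace (add_set U W).
Proof.
move=> sU sW; split; first by exists 0, 0; rewrite addr0; split=> //; apply: subspace0.
move=> c _ _ [a [b [Ua Wb ->]]] [a' [b' [Ua' Wb' ->]]].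
exists (c *: a + a'), (c *: b + b'); split; try exact: subspaceP.
by rewrite scalerDr addrACA.
Qed.

Lemma subspace_preim (V W : lmodType k) (f : {linear V -> W}) (U : set W) :
  subspace U -> subspace (f @^-1` U).
Proof.
move=> sU; split; first by rewrite /preimage /= linear0; apply: subspace0.
by move=> a u v Uu Uv; rewrite /preimage /= linearP; apply: subspaceP.
Qed.

Lemma subspace_image (V W : lmodType k) (f : {linear V -> W}) (U : set V) :
  subspace U -> subspace (f @` U).
Proof.
move=> sU; split; first by exists 0; rewrite ?linear0 //; apply: subspace0.
move=> a _ _ [u Uu <-] [v Uv <-]; exists (a *: u + v); first exact: subspaceP.
by rewrite linearP.
Qed.

(** A subspace of maximal dimension inside [P] is all of [P]: adjoining a vector of [P] that it
    misses would increase the dimension. *)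
Lemma vspace_of_ex (E : vectType k) (P : set E) : subspace P ->
  exists W : {vspace E}, forall v, v \in W <-> P v.
Proof.
move=> sP; pose has d := `[<exists W : {vspace E}, \dim W = d /\ forall v, v \in W -> P v>].
have has0 : exists d, has d.
  exists 0%N; apply/asboolP; exists 0%VS; rewrite dimv0; split=> // v.
  by rewrite memv0 => /eqP ->; apply: subspace0.
have bnd d : has d -> (d <= \dim {:E})%N.
  by move=> /asboolP[W [<- _]]; apply: dimvS; apply: subvf.
case: (ex_maxnP has0 bnd) => d /asboolP[W [dW WP]] dmax.
exists W => v; split=> [/WP//|Pv]; apply: contrapT => /negP vW.
have /dmax : has (\dim (W + <[v]>)%VS).
  apply/asboolP; exists (W + <[v]>)%VS; split=> // _ /memv_addP[w wW [_ /vlineP[a ->]] ->].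
  by apply: subspaceD => //; [apply: WP | apply: subspaceZ].
rewrite -dW leqNgt => /negP; apply.
have /leqifP := dimv_leqif_sup (addvSl W <[v]>).
case: ifP => // /subvP /(_ v) vWP; case/negP: vW; apply: vWP.
by rewrite (subvP (addvSr W <[v]>%VS)) ?memv_line.
Qed.

Definition vspace_of (E : vectType k) (P : set E) : {vspace E} :=
  xget 0%VS [set W : {vspace E} | forall v, v \in W <-> P v].

Lemma vspace_ofP (E : vectType k) (P : set E) v :
  subspace P -> v \in vspace_of P <-> P v.
Proof.
move=> /vspace_of_ex[W WP].
by apply: (xgetPex (0%VS : {vspace E}) (P := [set W : {vspace E} | forall v, v \in W <-> P v])); exists W.
Qed.

Section Bases.
Variables (V : lmodType k) (U W : set V).
Hypotheses (sU : subspace U) (sW : subspace W).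

Lemma basis_mod_free l (b : 'I_l -> V) (c : 'rV[k]_l) :
  basis_mod U W b -> W (\sum_j c 0 j *: b j) -> c = 0.
Proof.
case=> Ub /(_ 0 (subspace0 sU))[c0 [_ c0P]] Wc.
have <- : c0 = c.
  by apply: c0P; rewrite sub0r; apply: subspaceN.
apply/c0P; rewrite big1 ?subr0 => [|j _]; last by rewrite mxE scale0r.
exact: subspace0.
Qed.

Lemma basis_mod_intro l (b : 'I_l -> V) :
  (forall j, U (b j)) ->
  (forall c : 'rV[k]_l, W (\sum_j c 0 j *: b j) -> c = 0) ->
  (forall u, U u -> exists c : 'rV[k]_l, W (u - \sum_j c 0 j *: b j)) ->
  basis_mod U W b.
Proof.
move=> Ub bfree bgen; split=> // u /bgen[c Wc]; exists c; split=> // c' Wc'.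
apply/eqP; rewrite -subr_eq0; apply/eqP/bfree.
suff -> : \sum_j (c - c') 0 j *: b j =
    (u - \sum_j c' 0 j *: b j) - (u - \sum_j c 0 j *: b j) by apply: subspaceB.
rewrite opprB [RHS]addrC addrA subrK -sumrB.
by apply: eq_bigr => i _; rewrite !mxE scalerBl.
Qed.

End Bases.

(** Ranks in an arbitrary module become differences of dimensions in [E]. It suffices that [rho] is
    onto [U] modulo [W]: its kernel lies in both preimages and cancels. *)
Lemma rank_dim (E : vectType k) (V : lmodType k) (rho : {linear E -> V})
    (U W : set V) l :
  subspace U -> subspace W -> W `<=` U ->
  (forall u, U u -> exists e, W (u - rho e)) ->
  has_rank U W l <->
  \dim (vspace_of (rho @^-1` U)) = (l + \dim (vspace_of (rho @^-1` W)))%N.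
Proof.
move=> sU sW WU Urho; have sU' := subspace_preim rho sU.
have sW' := subspace_preim rho sW.
set vU := vspace_of (rho @^-1` U); set vW := vspace_of (rho @^-1` W).
have vUP v : v \in vU <-> U (rho v) := vspace_ofP v sU'.
have vWP v : v \in vW <-> W (rho v) := vspace_ofP v sW'.
have vWU : (vW <= vU)%VS by apply/subvP => v /vWP /WU /vUP.
split=> [[b bP]|dUW].
  have [Ub bex] := bP.
  have /choice[beta betaP] j : exists e, W (b j - rho e) := Urho _ (Ub j).
  pose X := [tuple beta j | j < l].
  have XE (j : 'I_l) : X`_j = beta j by rewrite -tnth_nth tnth_mktuple.
  have rX (c : 'I_l -> k) : W (\sum_j c j *: b j - rho (\sum_j c j *: X`_j)).
    rewrite linear_sum -sumrB; apply: subspace_sum => // j.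
    by rewrite linearZ XE /= -scalerBr; apply: subspaceZ.
  have WX (c : 'I_l -> k) : W (rho (\sum_j c j *: X`_j)) -> forall j, c j = 0.
    move=> /(subspaceD sW (rX c)); rewrite subrK => Wc j.
    have /rowP/(_ j) : \row_j c j = 0; last by rewrite !mxE.
    apply: (basis_mod_free sU sW bP); congr W: Wc.
    by apply: eq_bigr => i _; rewrite mxE.
  have fX : free X.
    by apply/freeP => c cX; apply: WX; rewrite cX linear0; apply: subspace0.
  have dX : \dim <<X>> = l by rewrite (eqnP fX) size_tuple.
  have capX : (<<X>> :&: vW = 0)%VS.
    apply/eqP; rewrite -subv0; apply/subvP => v; rewrite memv_cap memv0 => /andP[vX /vWP].
    rewrite (coord_span vX) => /WX c0.
    by rewrite big1 // => i _; rewrite c0 scale0r.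
  have -> : vU = (<<X>> + vW)%VS.
    apply/eqP; rewrite eqEsubv subv_add vWU andbT; apply/andP; split.
      apply/subvP => v /vUP/bex[c [Wc _]].
      rewrite -[v](subrK (\sum_j c 0 j *: X`_j)) addrC memv_add //.
        by apply: rpred_sum => j _; apply/rpredZ/memv_span/mem_nth; rewrite size_tuple.
      apply/vWP; rewrite linearB /= -[X in W X](subrKA (\sum_j c 0 j *: b j)).
      exact: subspaceD.
    apply/span_subvP => _ /tnthP[j ->]; rewrite tnth_mktuple; apply/vUP.
    by rewrite -[rho _](subKr (b j)); apply: subspaceB => //; apply: WU.
  by rewrite dimv_disjoint_sum // dX.
(* Conversely, [rho] sends a basis of a complement of [vW] in [vU] to a basis of [U] modulo [W]. *)
pose C := (vU :\: vW)%VS.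
have dC : \dim C = l.
  have := dimv_cap_compl vU vW; rewrite dUW (capv_idPr vWU) addnC => /addIn.
  by [].
have CU v : v \in C -> v \in vU by apply/subvP/diffvSl.
exists (fun j : 'I_l => rho (vbasis C)`_j); apply: basis_mod_intro => //.
- by move=> j; apply/vUP/CU/vbasis_mem/mem_nth; rewrite size_tuple dC.
- move=> c Wc; apply/rowP => j; rewrite mxE.
  have : \sum_(i < l) c 0 i *: (vbasis C)`_i = 0.
    apply/eqP; rewrite -memv0 -(capv_diff vU vW) memv_cap; apply/andP; split.
      apply: rpred_sum => i _; apply/rpredZ/vbasis_mem/mem_nth.
      by rewrite size_tuple dC.
    by apply/vWP; rewrite linear_sum; congr W: Wc; apply: eq_bigr => i _; rewrite linearZ.
  move: c {Wc} j; rewrite -dC => c j.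
  by have /freeP fC := basis_free (vbasisP C) => /(fC (fun i => c 0 i))/(_ j) ->.
- move=> u Uu; have [e eu] := Urho _ Uu.
  have : e \in (C + vW)%VS.
    rewrite addv_diff (addv_idPl vWU); apply/vUP.
    by rewrite -[rho e](subKr u); apply: subspaceB => //; apply: WU.
  case/memv_addP => c cC [w wW ecw].
  suff [a aP] : exists a : 'rV[k]_l, c = \sum_j a 0 j *: (vbasis C)`_j.
    exists a; have /vWP Ww := wW.
    suff -> : u - \sum_j a 0 j *: rho (vbasis C)`_j = (u - rho e) + rho w.
      exact: subspaceD.
    rewrite ecw linearD aP opprD addrA subrK (linear_sum rho); congr (_ - _).
    by apply: eq_bigr => i _; rewrite linearZ.
  move: (coord_vbasis cC) => -> {cC ecw}; rewrite -dC.
  by exists (\row_j coord (vbasis C) j c); apply: eq_bigr => i _; rewrite mxE.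
Qed.

End RankTheory.

Section RankCalculus.
Variable k : fieldType.

Lemma rank0_iso (V : lmodType k) (U : set V) a : subspace U ->
  has_rank U [set 0] a ->
  exists rho : {linear 'rV[k]_a -> V}, injective rho /\ range rho = U.
Proof.
move=> sU [b bP]; have [Ub bex] := bP.
pose f (c : 'rV[k]_a) := \sum_j c 0 j *: b j.
have lf : linear f.
  move=> x u v; rewrite /f scaler_sumr -big_split; apply: eq_bigr => j _ /=.
  by rewrite !mxE scalerDl scalerA.
pose rho : {linear 'rV[k]_a -> V} := HB.pack f (GRing.isLinear.Build k 'rV[k]_a V _ f lf).
exists rho; split.
  move=> u v /= /eqP; rewrite -subr_eq0 => /eqP uv; apply/eqP; rewrite -subr_eq0.
  apply/eqP/(basis_mod_free sU (subspace_set0 V) bP).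
  by change (rho (u - v) = 0); rewrite linearB.
apply/seteqP; split=> [_ [c _ <-]|u /bex[c [uc _]]]; first exact: subspace_comb.
by exists c => //; apply/eqP; rewrite eq_sym -subr_eq0; apply/eqP.
Qed.

(** The coordinates of one basis in the other form a matrix with independent rows, so it has at
    least as many columns as rows; exchanging the bases gives equality. *)
Lemma rank_uniq (V : lmodType k) (U W : set V) a b :
  subspace U -> subspace W -> W `<=` U ->
  has_rank U W a -> has_rank U W b -> a = b.
Proof.
move=> sU sW WU hUa.
have [beta bP] := hUa; have [Ub bex] := bP.
suff H (m n : nat) (x : 'I_m -> V) (y : 'I_n -> V) :
    basis_mod U W x -> basis_mod U W y -> (m <= n)%N.
  by move=> [c cP]; apply/eqP; rewrite eqn_leq (H _ _ _ _ bP cP) (H _ _ _ _ cP bP).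
move=> xP yP; have [Ux _] := xP; have [Uy yex] := yP.
have /choice[C CP] i : exists c : 'rV_n, W (x i - \sum_j c 0 j *: y j).
  by have [c [Wc _]] := yex _ (Ux i); exists c.
pose M : 'M[k]_(m, n) := \matrix_i C i.
suff /eqP <- : row_free M by exact: rank_leq_col.
rewrite -kermx_eq0; apply/eqP/row_matrixP => i; rewrite row0.
set c := row i _.
have cM : c *m M = 0 by rewrite /c -row_mul mulmx_ker row0.
apply: (basis_mod_free sU sW xP).
have -> : \sum_j c 0 j *: x j = \sum_j c 0 j *: (x j - \sum_l M j l *: y l).
  have -> : \sum_j c 0 j *: (x j - \sum_l M j l *: y l) =
      \sum_j c 0 j *: x j - \sum_l (c *m M) 0 l *: y l; last first.
    by rewrite cM [X in _ - X]big1 ?subr0 // => l _; rewrite mxE scale0r.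
  under eq_bigr => j _ do rewrite scalerBr; rewrite sumrB; congr (_ - _).
  under eq_bigr => j _ do rewrite scaler_sumr; rewrite exchange_big.
  apply: eq_bigr => l _; rewrite mxE scaler_suml; apply: eq_bigr => j _.
  by rewrite scalerA.
apply: subspace_comb => // j; have := CP j; congr W; congr (_ - _).
by apply: eq_bigr => l _; rewrite mxE.
Qed.

Section FiniteRank.
Variables (V : lmodType k) (U W : set V) (a : nat).
Hypotheses (sU : subspace U) (sW : subspace W) (WU : W `<=` U).
Hypothesis Ua : has_rank U [set 0] a.

Lemma rank_sub : exists l b, [/\ has_rank W [set 0] b, has_rank U W l & a = (l + b)%N].
Proof.
have [rho [rhoI rhoU]] := rank0_iso sU Ua.
have s0 := subspace_set0 V.
have v0 : vspace_of (rho @^-1` [set 0]) = 0%VS.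
  apply/eqP; rewrite -subv0; apply/subvP => v.
  move/(vspace_ofP _ (subspace_preim rho s0)); rewrite memv0 => h.
  by apply/eqP/rhoI; rewrite linear0.
have vT : vspace_of (rho @^-1` U) = fullv.
  apply/eqP; rewrite eqEsubv subvf; apply/subvP => v _.
  by apply/(vspace_ofP _ (subspace_preim rho sU)); rewrite -rhoU; exists v.
have z0 (X : set V) : subspace X -> [set 0] `<=` X.
  by move=> sX _ ->; apply: subspace0.
have UR u : U u -> exists e, W (u - rho e).
  by rewrite -{1}rhoU => -[e _ <-]; exists e; rewrite subrr; apply: subspace0.
have WR u : W u -> exists e, [set 0] (u - rho e).
  by move=> /WU; rewrite -{1}rhoU => -[e _ <-]; exists e; rewrite subrr.
pose b := \dim (vspace_of (rho @^-1` W)).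
pose l := (a - b)%N.
have dF : \dim {: 'rV[k]_a} = a by rewrite dimvf /dim /= mul1n.
have ab : a = (l + b)%N.
  by rewrite subnK // -[X in (_ <= X)%N]dF dimvS ?subvf.
exists l, b; split=> //.
  by apply/(rank_dim _ sW s0 (z0 _ sW) WR); rewrite v0 dimv0 addn0.
by apply/(rank_dim _ sU sW WU UR); rewrite vT dF.
Qed.

End FiniteRank.

Lemma rank_image (V V' : lmodType k) (f : {linear V -> V'}) (U : set V) a b :
  subspace U -> has_rank U [set 0] a -> has_rank (U `&` f @^-1` [set 0]) [set 0] b ->
  exists2 l, a = (l + b)%N & has_rank (f @` U) [set 0] l.
Proof.
move=> sU Ua Kb.
have [rho [rhoI rhoU]] := rank0_iso sU Ua.
pose g : {linear 'rV[k]_a -> V'} := f \o rho.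
have s0 := subspace_set0 V; have s0' := subspace_set0 V'.
have sK : subspace (U `&` f @^-1` [set 0]) := subspaceI sU (subspace_preim f s0').
have sI := subspace_image f sU.
have dF : \dim {: 'rV[k]_a} = a by rewrite dimvf /dim /= mul1n.
have vT : vspace_of (g @^-1` (f @` U)) = fullv.
  apply/eqP; rewrite eqEsubv subvf; apply/subvP => v _.
  by apply/(vspace_ofP _ (subspace_preim g sI)); exists (rho v) => //; rewrite -rhoU; exists v.
have v0 : vspace_of (rho @^-1` [set 0]) = 0%VS.
  apply/eqP; rewrite -subv0; apply/subvP => v.
  move/(vspace_ofP _ (subspace_preim rho s0)); rewrite memv0 => h.
  by apply/eqP/rhoI; rewrite linear0.
have dK : \dim (vspace_of (g @^-1` [set 0])) = b.
  have -> : vspace_of (g @^-1` [set 0]) = vspace_of (rho @^-1` (U `&` f @^-1` [set 0])).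
    apply/vspaceP => v; apply/idP/idP.
      move/(vspace_ofP _ (subspace_preim g s0')) => h.
      by apply/(vspace_ofP _ (subspace_preim rho sK)); split=> //; rewrite -rhoU; exists v.
    move/(vspace_ofP _ (subspace_preim rho sK)) => [_ h].
    exact/(vspace_ofP _ (subspace_preim g s0')).
  have K0 : [set 0] `<=` U `&` f @^-1` [set 0] by move=> _ ->; apply: subspace0.
  have KR u : (U `&` f @^-1` [set 0]) u -> exists e, [set 0] (u - rho e).
    by rewrite -{1}rhoU => -[[e _ <-] _]; exists e; rewrite subrr.
  by have/(rank_dim _ sK s0 K0 KR) := Kb; rewrite v0 dimv0 addn0.
have ba : (b <= a)%N by rewrite -dK -[X in (_ <= X)%N]dF dimvS ?subvf.
exists (a - b)%N; first by rewrite subnK.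
have I0 : [set 0] `<=` f @` U by move=> _ ->; apply: subspace0.
have IR v : (f @` U) v -> exists e, [set 0] (v - g e).
  by rewrite -rhoU => -[_ [e _ <-] <-]; exists e; rewrite subrr.
by apply/(rank_dim _ sI s0' I0 IR); rewrite vT dF dK subnK.
Qed.

Lemma rank_prod (V V' : lmodType k) a b :
  has_rank [set: V] [set 0] a -> has_rank [set: V'] [set 0] b ->
  has_rank [set: V * V'] [set 0] (a + b)%N.
Proof.
move=> /(rank0_iso (@subspace_setT _ V))[f [fI fT]].
move=> /(rank0_iso (@subspace_setT _ V'))[g [gI gT]].
pose h (x : 'rV[k]_a * 'rV[k]_b) := (f x.1, g x.2).
have lh : linear h by move=> c [u u'] [v v']; rewrite /h /= !linearP.
pose rho : {linear _ -> _} := HB.pack h (GRing.isLinear.Build k _ _ _ h lh).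
have s0 := subspace_set0 (V * V')%type; have sT := subspace_setT (V * V')%type.
have RR w : [set: V * V'] w -> exists e, [set 0] (w - rho e).
  case: w => u v _.
  have [u' _ <-] : range f u by rewrite fT.
  have [v' _ <-] : range g v by rewrite gT.
  by exists (u', v'); rewrite subrr.
have T0 : [set 0 : V * V'] `<=` setT by [].
apply/(rank_dim _ sT s0 T0 RR).
have -> : vspace_of (rho @^-1` setT) = fullv.
  apply/eqP; rewrite eqEsubv subvf; apply/subvP => v _.
  exact/(vspace_ofP _ (subspace_preim rho sT)).
have -> : vspace_of (rho @^-1` [set 0]) = 0%VS.
  apply/eqP; rewrite -subv0; apply/subvP => -[u v].
  move/(vspace_ofP _ (subspace_preim rho s0)) => -[fu gv]; rewrite memv0.
  by apply/eqP; congr (_, _); [apply: fI | apply: gI]; rewrite linear0.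
by rewrite dimv0 addn0 dimvf /dim /= /dim /= !mul1n.
Qed.

Lemma basis_mod_change (V : lmodType k) (U W : set V) l (b : 'I_l -> V) (P : 'M[k]_l) :
  subspace U -> subspace W -> P \in unitmx -> basis_mod U W b ->
  basis_mod U W (fun i => \sum_j P i j *: b j).
Proof.
move=> sU sW uP bP; have [Ub bex] := bP.
have E (c : 'rV_l) : \sum_i c 0 i *: (\sum_j P i j *: b j) = \sum_j (c *m P) 0 j *: b j.
  under eq_bigr => i _ do rewrite scaler_sumr; rewrite exchange_big.
  apply: eq_bigr => j _; rewrite mxE scaler_suml; apply: eq_bigr => i _.
  by rewrite scalerA.
apply: basis_mod_intro => // [i|c|u /bex[c [Wc _]]]; first exact: subspace_comb.
  rewrite E => /(basis_mod_free sU sW bP) cP0.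
  by rewrite -[c](mulmxK uP) cP0 mul0mx.
by exists (c *m invmx P); rewrite E mulmxKV.
Qed.

(** The rank normal form exhibits [c] as a nonzero scalar times the first row of the invertible
    matrix [row_ebase c]. *)
Lemma unitmx_row0 n (c : 'rV[k]_n.+1) : c != 0 ->
  exists2 P : 'M[k]_n.+1, P \in unitmx & row 0 P = c.
Proof.
move=> c0; pose a := (col_ebase c) 0 0.
have a0 : a != 0.
  have := col_ebase_unit c; rewrite unitmxE [col_ebase c]mx11_scalar det_scalar1.
  by rewrite unitfE.
have rc : \rank c = 1%N by rewrite rank_rV c0.
exists (a *: row_ebase c).
  by rewrite unitmxZ ?unitfE // row_ebase_unit.
rewrite -[RHS]mulmx_ebase rc [col_ebase c]mx11_scalar -/a mul_scalar_mx -scalemxAl.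
rewrite linearZ /= rowE; congr (_ *: (_ *m _)).
by apply/rowP => j; rewrite !mxE eqxx /= andbT eq_sym -(inj_eq val_inj).
Qed.

Lemma basis_mod_first (V : lmodType k) (U : set V) l (g : V) :
  subspace U -> U g -> g <> 0 -> has_rank U [set 0] l.+1 ->
  exists2 b : 'I_l.+1 -> V, basis_mod U [set 0] b & b 0 = g.
Proof.
move=> sU Ug g0 [b bP]; have [_ /(_ _ Ug)[c [/= gc _]]] := bP.
have [|P uP rP] := @unitmx_row0 _ c.
  apply/eqP => c0; apply: g0; move: gc; rewrite c0 big1 ?subr0 // => i _.
  by rewrite mxE scale0r.
exists (fun i => \sum_j P i j *: b j).
  by apply: basis_mod_change => //; apply: subspace_set0.
apply/eqP; rewrite eq_sym -subr_eq0; apply/eqP; rewrite -[RHS]gc.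
by congr (_ - _); apply: eq_bigr => j _; rewrite -rP mxE.
Qed.

Lemma rank1_proportional (V : lmodType k) (U W : set V) (f w : V) :
  subspace W -> has_rank U W 1 -> U f -> ~ W f -> U w -> exists c : k, W (w - c *: f).
Proof.
move=> sW [b [_ bex]] Uf Wf Uw.
have low v : U v -> exists c : k, W (v - c *: b 0).
  by move=> /bex[c [h _]]; exists (c 0 0); rewrite big_ord1 in h.
have [c fc] := low _ Uf; have [e we] := low _ Uw.
have c0 : c != 0.
  by apply/eqP => c0; apply: Wf; move: fc; rewrite c0 scale0r subr0.
exists (e / c); have -> : w - (e / c) *: f = (w - e *: b 0) - (e / c) *: (f - c *: b 0).
  by rewrite scalerBr scalerA divfK // opprB addrA subrK.
by apply: subspaceB => //; apply: subspaceZ.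
Qed.

End RankCalculus.

(** * Power series and their orders *)

Section PowserCoefficients.
Variables (n : nat) (k : comNzRingType).
Local Notation Q := (powser n k).
Implicit Types (f g : Q) (m l : 'X_{1..n}) (i : 'I_n).

Lemma psDE f g m : (f + g) m = f m + g m. Proof. by []. Qed.
Lemma psNE f m : (- f) m = - f m. Proof. by []. Qed.
Lemma psBE f g m : (f - g) m = f m - g m. Proof. by []. Qed.
Lemma psZE (c : k) f m : (c *: f) m = c * f m. Proof. by []. Qed.

Lemma ps_sumE (J : Type) (r : seq J) (P : pred J) (F : J -> Q) m :
  (\sum_(j <- r | P j) F j) m = \sum_(j <- r | P j) F j m.
Proof. exact: (big_morph (fun f : Q => f m)). Qed.

Definition ps_mon l : Q := ps_of_mpoly 'X_[l].

Lemma ps_monE l m : ps_mon l m = (l == m)%:R.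
Proof. exact: mcoeffX. Qed.

Lemma ps_mon_mulE l f m :
  (ps_mon l * f) m = if (l <= m)%MM then f (m - l)%MM else 0.
Proof.
case: ifPn => [lm|lm].
  rewrite -[LHS]/(ps_mul _ _ _).
  have -> := @ps_mulE _ _ (mdeg m).+1 (ps_mon l) f m 'X_[l] (ps_trunc (mdeg m).+1 f).
  - have mE : m = (l + (m - l))%MM by rewrite addmC submK.
    by rewrite mulrC [X in _@_X]mE mcoeffMX ps_truncE // ltnS mdegB.
  - by [].
  - by [].
  - by move=> *; apply: ps_truncE.
rewrite -[LHS]/(ps_mul _ _ _) /ps_mul big1 // => -[a b] /= /eqP mab.
rewrite ps_monE; case: eqP => [la|]; last by rewrite mul0r.
by case/negP: lm; rewrite la [X in (_ <= X)%MM]mab lem_addr.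
Qed.

Lemma lem_mnm1 i m : (U_(i) <= m)%MM = (0 < m i)%N.
Proof.
apply/mnm_lepP/idP => [/(_ i)|m0 j]; first by rewrite mnm1E eqxx.
by rewrite mnm1E; case: eqP => // <-.
Qed.

Lemma ps_var_mulE i f m :
  (ps_var k i * f) m = if (0 < m i)%N then f (m - U_(i))%MM else 0.
Proof. by rewrite -lem_mnm1 -ps_mon_mulE. Qed.

Definition ps_order d : set Q := [set f | forall m, (mdeg m < d)%N -> f m = 0].

Lemma ps_orderW d e f : (e <= d)%N -> ps_order d f -> ps_order e f.
Proof. by move=> ed fd m me; apply: fd; apply: leq_trans me ed. Qed.

Lemma ps_orderM d e f g : ps_order d f -> ps_order e g -> ps_order (d + e) (f * g).
Proof.
move=> fd ge m md; rewrite -[LHS]/(ps_mul _ _ _) /ps_mul big1 // => -[a b] /= /eqP mab.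
have := congr1 mdeg mab; rewrite mdegD => mE.
have [ad|da] := ltnP (mdeg a) d; first by rewrite fd ?mul0r.
rewrite (ge (bmnm b)) ?mulr0 //; lia.
Qed.

Lemma ps_orderMl d f g : ps_order d g -> ps_order d (f * g).
Proof. by move=> ?; rewrite -[d]add0n; apply: ps_orderM. Qed.

Lemma ps_order_var i : ps_order 1 (ps_var k i).
Proof.
move=> m; rewrite ltnS leqn0 mdeg_eq0 => /eqP ->.
by rewrite -[LHS]/('X_[U_(i)]@_0%MM) mcoeffX mnm1_eq0.
Qed.

Lemma ps_order_mon l : ps_order (mdeg l) (ps_mon l).
Proof. by move=> m; rewrite ps_monE; case: eqP => // ->; rewrite ltnn. Qed.

Lemma ps_orderD d f g : ps_order d f -> ps_order d g -> ps_order d (f + g).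
Proof. by move=> fd gd m md; rewrite psDE fd ?gd ?addr0. Qed.

Lemma ps_orderN d f : ps_order d f -> ps_order d (- f).
Proof. by move=> fd m md; rewrite psNE fd ?oppr0. Qed.

Lemma ps_orderB d f g : ps_order d f -> ps_order d g -> ps_order d (f - g).
Proof. by move=> fd gd; apply/ps_orderD/ps_orderN. Qed.

Lemma ps_orderZ d c f : ps_order d f -> ps_order d (c *: f).
Proof. by move=> fd m md; rewrite psZE fd ?mulr0. Qed.

Definition ps_low d f : Q := fun m => if (mdeg m < d)%N then f m else 0.

Lemma ps_lowK d f : ps_order d (f - ps_low d f).
Proof. by move=> m md; rewrite psBE /ps_low md subrr. Qed.

Lemma ps_low_order d f : ps_order d f -> ps_low d f = 0.
Proof. by move=> fd; apply/funext => m; rewrite /ps_low; case: ifP => // /fd. Qed.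

Lemma ps_lowD d f g : ps_low d (f + g) = ps_low d f + ps_low d g.
Proof.
by apply/funext => m; rewrite psDE /ps_low; case: ifP; rewrite ?psDE ?addr0.
Qed.

Lemma ps_lowB d f g : ps_low d (f - g) = ps_low d f - ps_low d g.
Proof.
by apply/funext => m; rewrite psBE /ps_low; case: ifP; rewrite ?psBE ?subr0.
Qed.

Lemma ps_low_var d i f : ps_low d.+1 (ps_var k i * f) = ps_var k i * ps_low d f.
Proof.
apply/funext => m; rewrite /ps_low !ps_var_mulE; case: (ltnP 0 (m i)) => [mi|_].
  have /submK mE : (U_(i) <= m)%MM by rewrite lem_mnm1.
  by rewrite -{1}mE mdegD mdeg1 addn1 ltnS.
by rewrite if_same.
Qed.

Lemma ps_low_sum d f : ps_low d f = \sum_(m : 'X_{1..n < d}) f m *: ps_mon m.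
Proof.
apply/funext => m; rewrite ps_sumE /ps_low; case: ifPn => [md|md].
  rewrite (bigD1 (BMultinom md)) //= psZE ps_monE eqxx mulr1 big1 ?addr0 // => l lm.
  rewrite psZE ps_monE; case: eqP; rewrite ?mulr0 // => lE.
  by case/eqP: lm; apply: val_inj.
rewrite big1 // => l _; rewrite psZE ps_monE; case: eqP; rewrite ?mulr0 // => lm.
by move: md; rewrite -lm bmdeg.
Qed.

End PowserCoefficients.

(** * The number of monomials of each degree *)

Section OrderRank.
Variables (n : nat) (k : fieldType).
Local Notation Q := (powser n.+1 k).

Lemma subspace_order d : subspace (@ps_order n.+1 k d).
Proof. by split=> // a u v ud vd; apply/ps_orderD => //; apply: ps_orderZ. Qed.

(** The monomials of degree [d] form the basis. They are enumerated by tuples over ['I_d.+1] with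
    sum [d], since no exponent exceeds the degree. *)
Lemma rank_order d : has_rank (@ps_order n.+1 k d) (@ps_order n.+1 k d.+1) 'C(d + n, n).
Proof.
rewrite addnC -card_ord_partitions.
set T := [set t : n.+1.-tuple 'I_d.+1 | _ ]%SET.
pose mon (t : n.+1.-tuple 'I_d.+1) : 'X_{1..n.+1} := [multinom (tnth t i : nat) | i < n.+1].
have monI : injective mon.
  move=> t u tu; apply: eq_from_tnth => i; apply: val_inj.
  by have := congr1 (fun m : 'X_{1..n.+1} => m i) tu; rewrite !mnmE.
have mdeg_mon t : mdeg (mon t) = (\sum_(i <- t) i)%N.
  by rewrite mdegE big_tuple; apply: eq_bigr => i _; rewrite mnmE.
have mdegT (j : 'I_#|T|) : mdeg (mon (enum_val j)) = d.
  by have := enum_valP j; rewrite inE mdeg_mon => /eqP.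
have monE (m : 'X_{1..n.+1}) : mdeg m = d -> exists j : 'I_#|T|, mon (enum_val j) = m.
  move=> md; have le i : (m i < d.+1)%N.
    by rewrite ltnS -md mdegE (bigD1 i) //= leq_addr.
  pose t := [tuple Ordinal (le i) | i < n.+1].
  have tm : mon t = m by apply/mnmP => i; rewrite mnmE tnth_mktuple.
  have tT : t \in T by rewrite inE -mdeg_mon tm md.
  by exists (enum_rank_in tT t); rewrite enum_rankK_in.
have coefE (c : 'rV[k]_#|T|) j :
    (\sum_i c 0 i *: ps_mon k (mon (enum_val i))) (mon (enum_val j)) = c 0 j.
  rewrite ps_sumE (bigD1 j) //= psZE ps_monE eqxx mulr1 big1 ?addr0 // => i ij.
  rewrite psZE ps_monE; case: eqP => [|_]; last by rewrite mulr0.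
  by move/monI/enum_val_inj => e; rewrite e eqxx in ij.
exists (fun j => ps_mon k (mon (enum_val j))).
apply: basis_mod_intro; first exact: subspace_order.
- by move=> j; rewrite -{1}(mdegT j); apply: ps_order_mon.
- move=> c h; apply/rowP => j; rewrite mxE -coefE; apply: h.
  by rewrite mdegT.
- move=> f fd; exists (\row_j f (mon (enum_val j))) => m.
  rewrite ltnS leq_eqVlt psBE => /predU1P[/monE[j <-]|md].
    by rewrite coefE mxE subrr.
  rewrite (fd _ md) ps_sumE big1 ?subr0 // => i _.
  rewrite psZE ps_monE; case: eqP => [e|_]; last by rewrite mulr0.
  by move: md; rewrite -e mdegT ltnn.
Qed.

End OrderRank.

(** * Truncated power series as a finite-dimensional space *)

Section Truncation.
Variables (n : nat) (k : fieldType) (d : nat).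
Local Notation Q := (powser n k).
Local Notation E := {ffun 'X_{1..n < d} -> k^o}.

Definition ps_emb_fun (e : E) : Q := fun m => if insub m is Some b then e b else 0.

Lemma ps_emb_linear : linear ps_emb_fun.
Proof.
move=> a u v; apply/funext => m; rewrite psDE psZE /ps_emb_fun.
by case: insub => [b|]; rewrite ?ffunE ?mulr0 ?addr0.
Qed.

HB.instance Definition _ := GRing.isLinear.Build k E Q _ ps_emb_fun ps_emb_linear.

Definition ps_emb : {linear E -> Q} := ps_emb_fun.

Definition ps_cut (f : Q) : E := [ffun m : 'X_{1..n < d} => f m].

Lemma ps_cut_linear : linear ps_cut.
Proof. by move=> a u v; apply/ffunP => m; rewrite !ffunE. Qed.

HB.instance Definition _ := GRing.isLinear.Build k Q E _ ps_cut ps_cut_linear.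

Lemma ps_cutK f : ps_emb (ps_cut f) = ps_low d f.
Proof.
apply/funext => m; rewrite /= /ps_emb_fun /ps_low.
by case: insubP => [b -> <-|/negbTE ->]; rewrite ?ffunE.
Qed.

Lemma ps_embK e : ps_cut (ps_emb e) = e.
Proof. by apply/ffunP => m; rewrite ffunE /= /ps_emb_fun valK. Qed.

(** When [J] contains all series of order [d], this is [J] modulo those series, so that inclusions
    and lengths can be decided by dimensions. *)
Definition vcut (J : set Q) : {vspace E} := vspace_of (ps_emb @^-1` J).

Lemma vcutP (J : set Q) e : subspace J -> e \in vcut J <-> J (ps_emb e).
Proof. by move=> sJ; apply: vspace_ofP; apply: subspace_preim. Qed.

Section Cofinite.
Variable J : set Q.
Hypotheses (sJ : subspace J) (dJ : @ps_order n k d `<=` J).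

Lemma ps_cut_mod f : J (f - ps_emb (ps_cut f)).
Proof. by apply: dJ; rewrite ps_cutK; apply: ps_lowK. Qed.

Lemma vcut_mem f : ps_cut f \in vcut J <-> J f.
Proof.
split=> [/(vcutP _ sJ) h|Jf]; last first.
  apply/(vcutP _ sJ); rewrite -[ps_emb _](subKr f).
  by apply: subspaceB => //; apply: ps_cut_mod.
by rewrite -[f](subrK (ps_emb (ps_cut f))); apply: subspaceD => //; apply: ps_cut_mod.
Qed.

Lemma rank_vcut (U : set Q) l : subspace U -> J `<=` U ->
  has_rank U J l -> \dim (vcut U) = (l + \dim (vcut J))%N.
Proof.
move=> sU JU; apply: (proj1 (rank_dim _ sU sJ JU _)) => u _.
by exists (ps_cut u); apply: ps_cut_mod.
Qed.

Lemma vcut_sub (U : set Q) : subspace U -> @ps_order n k d `<=` U ->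
  (vcut U <= vcut J)%VS -> U `<=` J.
Proof.
move=> sU dU /subvP UJ f Uf; apply/vcut_mem/UJ/(vcutP _ sU).
rewrite -[ps_emb _](subKr f); apply: subspaceB => //.
by apply: dU; rewrite ps_cutK; apply: ps_lowK.
Qed.

End Cofinite.

Lemma vcut_add (U J : set Q) : subspace U -> @ps_order n k d `<=` U ->
  subspace J -> @ps_order n k d `<=` J ->
  vcut (add_set U J) = (vcut U + vcut J)%VS.
Proof.
move=> sU dU sJ dJ; apply/vspaceP => e; have sUJ := subspace_add sU sJ.
apply/idP/idP => [/(vcutP _ sUJ)[a [b [Ua Jb eE]]]|].
  rewrite -[e]ps_embK eE linearD memv_add //; exact/vcut_mem.
case/memv_addP => u /(vcutP _ sU) Uu [v /(vcutP _ sJ) Jv ->].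
by apply/(vcutP _ sUJ); exists (ps_emb u), (ps_emb v); rewrite linearD.
Qed.

Lemma vcutI (U W : set Q) : subspace U -> subspace W ->
  vcut (U `&` W) = (vcut U :&: vcut W)%VS.
Proof.
move=> sU sW; apply/vspaceP => e; rewrite memv_cap; apply/idP/andP.
  by move=> /(vcutP _ (subspaceI sU sW))[? ?]; split; apply/vcutP.
by move=> [/(vcutP _ sU) ? /(vcutP _ sW) ?]; apply/(vcutP _ (subspaceI sU sW)).
Qed.

Lemma vcutS (U W : set Q) : subspace U -> subspace W -> U `<=` W ->
  (vcut U <= vcut W)%VS.
Proof.
by move=> sU sW UW; apply/subvP => e /(vcutP _ sU)/UW ?; apply/(vcutP _ sW).
Qed.

End Truncation.

(** * Homogeneous components of power series *)

Section HomogeneousComponents.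
Variables (n : nat) (k : comNzRingType).
Local Notation Q := (powser n k).

Definition ps_comp (d : nat) (f : Q) : Q := fun m => if mdeg m == d then f m else 0.

Lemma ps_compD d f g : ps_comp d (f + g) = ps_comp d f + ps_comp d g.
Proof.
by apply/funext => m; rewrite psDE /ps_comp; case: ifP; rewrite ?addr0.
Qed.

Lemma ps_comp_sum d l (F : 'I_l -> Q) : ps_comp d (\sum_j F j) = \sum_j ps_comp d (F j).
Proof.
apply: (big_morph (ps_comp d) (ps_compD d)).
by apply/funext => m; rewrite /ps_comp if_same.
Qed.

Lemma ps_compM d e (r : Q) (p : {mpoly k[n]}) : p \is e.-homog ->
  ps_comp d (r * ps_of_mpoly p) =
  (if (e <= d)%N then ps_comp (d - e)%N r else 0) * ps_of_mpoly p.
Proof.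
move=> hp; apply/funext => m.
have pE (l : 'X_{1..n}) : mdeg l != e -> ps_of_mpoly p l = 0.
  exact: dhomog_nemf_coeff hp.
rewrite /ps_comp; case: ifPn => md.
  apply: eq_bigr => -[a b] /= /eqP mab.
  case: (eqVneq (mdeg b) e) => [be|/pE ->]; last by rewrite !mulr0.
  have dE : d = (mdeg a + e)%N by rewrite -be -mdegD -mab (eqP md).
  by rewrite dE leq_addl addnK eqxx.
apply/esym/big1 => -[a b] /= /eqP mab.
case: (eqVneq (mdeg b) e) => [be|/pE ->]; last by rewrite mulr0.
case: leqP => ed; last by rewrite mul0r.
case: eqP => [ad|]; last by rewrite mul0r.
by case/negP: md; rewrite [X in mdeg X]mab mdegD ad be subnK.
Qed.

Lemma ps_comp_order d f : ps_order d (ps_comp d f).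
Proof. by move=> m md; rewrite /ps_comp ltn_eqF. Qed.

Lemma ps_comp_mod d f : ps_order d f -> ps_order d.+1 (f - ps_comp d f).
Proof.
move=> fd m; rewrite ltnS leq_eqVlt psBE /ps_comp => /predU1P[->|md].
  by rewrite eqxx subrr.
by rewrite fd // if_same subr0.
Qed.

Lemma ps_comp_eq0 d f : ps_order d.+1 f -> ps_comp d f = 0.
Proof.
by move=> fd; apply/funext => m; rewrite /ps_comp; case: eqP => // md; rewrite fd ?md.
Qed.

End HomogeneousComponents.

(** The component of degree [d] of a combination of homogeneous generators is again a combination of
    them: each coefficient is replaced by one of its own components, or by 0. *)
Lemma homogeneous_comp (k : fieldType) (I : idealr (powser 3 k)) d f :
  homogeneous_ideal I -> f \in I -> ps_comp d f \in I.
Proof.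
case=> S [hS IE] fI.
have: [set` I] f by [].
rewrite IE => -[l [r [g [gS ->]]]].
rewrite ps_comp_sum; apply: rpred_sum => j _.
have gI : g j \in I.
  suff : [set` I] (g j) by [].
  rewrite IE; exists 1%N, (fun _ => 1), (fun _ => g j); split=> //.
  by rewrite big_ord1 mul1r.
have [p /hS[e he] gE] := gS j.
by rewrite -gE (ps_compM _ _ he) idealMr // gE.
Qed.

(** * Coprimality of the variables and exactness of the Koszul complex of [Q] *)

Section Variables.
Variables (n : nat) (k : comNzRingType).
Local Notation Q := (powser n k).
Local Notation x := (@ps_var n k).
Implicit Types (f g : Q) (i j : 'I_n).

Lemma ps_var_shift i f m : (x i * f) (m + U_(i))%MM = f m.
Proof. by rewrite ps_var_mulE mnmDE mnm1E eqxx addn1 addmK. Qed.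

Lemma ps_varI i f g : x i * f = x i * g -> f = g.
Proof. by move=> fg; apply/funext => m; rewrite -(ps_var_shift i) fg ps_var_shift. Qed.

(** A monomial of [f] free of the variable [j] would yield a monomial of [x j * g] free of it; hence
    [x j] divides [f]. *)
Lemma ps_var_coprime i j f g : i != j -> x i * f = x j * g ->
  exists2 h, f = x j * h & g = x i * h.
Proof.
move=> ij fg; pose h : Q := fun m => f (m + U_(j))%MM.
have fh : f = x j * h.
  apply/funext => m; rewrite ps_var_mulE; case: posnP => mj.
    by rewrite -(ps_var_shift i) fg ps_var_mulE mnmDE mnm1E (negbTE ij) mj.
  by rewrite /h submK // lem_mnm1.
by exists h => //; apply: (@ps_varI j); rewrite -fg fh mulrCA.
Qed.

End Variables.

Notation o0 := (ord0 : 'I_3).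
Notation o1 := (lift ord0 ord0 : 'I_3).
Notation o2 := (lift ord0 (lift ord0 ord0) : 'I_3).

Section ThreeVariables.
Variable k : comNzRingType.
Local Notation Q := (powser 3 k).
Local Notation x0 := (ps_var k o0).
Local Notation x1 := (ps_var k o1).
Local Notation x2 := (ps_var k o2).
Implicit Types (f g : Q).

Lemma big_ord3 (R : nmodType) (F : 'I_3 -> R) : \sum_i F i = F o0 + F o1 + F o2.
Proof. by rewrite !big_ord_recl big_ord0 addr0 addrA. Qed.

Lemma all_ord3 (P : 'I_3 -> Prop) : P o0 -> P o1 -> P o2 -> forall i, P i.
Proof.
move=> P0 P1 P2 [[|[|[|//]]] h].
- by rewrite (_ : Ordinal h = o0) //; apply: val_inj.
- by rewrite (_ : Ordinal h = o1) //; apply: val_inj.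
- by rewrite (_ : Ordinal h = o2) //; apply: val_inj.
Qed.

(* For f without constant term, f = x0 * ps_div0 f + x1 * ps_div1 f + x2 * ps_div2 f:
   the monomials of f are sorted by the first variable dividing them. *)
Definition ps_div0 f : Q := fun m => f (m + U_(o0))%MM.
Definition ps_div1 f : Q := fun m => if m o0 == 0%N then f (m + U_(o1))%MM else 0.
Definition ps_div2 f : Q := fun m =>
  if (m o0 == 0%N) && (m o1 == 0%N) then f (m + U_(o2))%MM else 0.

Lemma ps_div_var0 f :
  [/\ ps_div0 (x0 * f) = f, ps_div1 (x0 * f) = 0 & ps_div2 (x0 * f) = 0].
Proof.
split; apply/funext => m; first exact: ps_var_shift.
  by rewrite /ps_div1 ps_var_mulE mnmDE mnm1E /= addn0; case: (m o0).
by rewrite /ps_div2 ps_var_mulE mnmDE mnm1E /= addn0; case: (m o0) => //=; rewrite if_same.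
Qed.

Lemma mnm_shiftC (i j : 'I_3) (m : 'X_{1..3}) : (0 < m j)%N ->
  (m + U_(i) - U_(j) = m - U_(j) + U_(i))%MM.
Proof.
move=> mj; apply/mnmP => l; rewrite !(mnmDE, mnmBE, mnm1E).
case: (eqVneq j l) => [jl|_]; last by rewrite !subn0.
by rewrite -jl addnC -addnBA // addnC.
Qed.

(** Division by the variables is not [Q]-linear. Here and in [ps_div_var2], the triple of [x_i * f]
    differs from [f] placed in position [i] by multiples of the Koszul relations between two
    variables, which pair to zero with cycles. *)
Lemma ps_div_var1 f : [/\ ps_div0 (x1 * f) = x1 * ps_div0 f,
  ps_div1 (x1 * f) = f - x0 * ps_div0 f & ps_div2 (x1 * f) = 0].
Proof.
split; apply/funext => m.
- rewrite /ps_div0 !ps_var_mulE mnmDE mnm1E /= addn0.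
  by case: posnP => // m1; rewrite mnm_shiftC.
- rewrite psBE /ps_div1 ps_var_shift ps_var_mulE; case: posnP => m0; first by rewrite subr0.
  by rewrite /ps_div0 submK ?subrr // lem_mnm1.
- rewrite /ps_div2 !ps_var_mulE mnmDE mnm1E /= addn0.
  by case: (m o1) => [|?]; rewrite ?andbF ?if_same.
Qed.

Lemma ps_div_var2 f : [/\ ps_div0 (x2 * f) = x2 * ps_div0 f,
  ps_div1 (x2 * f) = x2 * ps_div1 f &
  ps_div2 (x2 * f) = f - x0 * ps_div0 f - x1 * ps_div1 f].
Proof.
split; apply/funext => m.
- rewrite /ps_div0 !ps_var_mulE mnmDE mnm1E /= addn0.
  by case: posnP => // m1; rewrite mnm_shiftC.
- rewrite /ps_div1 !ps_var_mulE mnmDE mnmBE !mnm1E /= addn0 subn0.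
  by case: posnP => // m1; rewrite ?mnm_shiftC ?if_same.
- rewrite !psBE /ps_div2 ps_var_shift !ps_var_mulE.
  case: posnP => m0 /=.
    rewrite subr0; case: posnP => m1 /=; first by rewrite subr0.
    by rewrite /ps_div1 mnmBE mnm1E m0 /= submK ?subrr // lem_mnm1.
  rewrite /ps_div0 submK ?lem_mnm1 // subrr sub0r; case: posnP => m1; rewrite ?oppr0 //.
  by rewrite /ps_div1 mnmBE mnm1E subn0 (gtn_eqF m0) oppr0.
Qed.

Lemma ps_divE f : f 0%MM = 0 -> f = x0 * ps_div0 f + x1 * ps_div1 f + x2 * ps_div2 f.
Proof.
move=> f0; apply/funext => m; rewrite !psDE !ps_var_mulE.
case: posnP => m0.
  case: posnP => m1.
    case: posnP => m2.
      rewrite !addr0 (_ : m = 0%MM) //; apply/mnmP => i; rewrite mnm0E.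
      by move: i; apply: all_ord3.
    by rewrite !add0r /ps_div2 !mnmBE !mnm1E m0 m1 /= submK // lem_mnm1.
  rewrite add0r /ps_div1 !mnmBE !mnm1E m0 /= submK ?lem_mnm1 //.
  case: posnP => m2; rewrite ?addr0 // /ps_div2 !mnmBE !mnm1E m0 /= subn0.
  by rewrite (gtn_eqF m1) addr0.
rewrite /ps_div0 submK ?lem_mnm1 // /ps_div1 /ps_div2 !mnmBE !mnm1E /= !subn0.
by rewrite (gtn_eqF m0) !if_same !addr0.
Qed.

Lemma ps_div_order d f : ps_order d.+1 f ->
  [/\ ps_order d (ps_div0 f), ps_order d (ps_div1 f) & ps_order d (ps_div2 f)].
Proof.
move=> fd; have h i m : (mdeg m < d)%N -> f (m + U_(i))%MM = 0.
  by move=> md; apply: fd; rewrite mdegD mdeg1 addn1.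
by split=> m md; rewrite /ps_div0 /ps_div1 /ps_div2 h // if_same.
Qed.

Lemma ps_divD f g : [/\ ps_div0 (f + g) = ps_div0 f + ps_div0 g,
  ps_div1 (f + g) = ps_div1 f + ps_div1 g & ps_div2 (f + g) = ps_div2 f + ps_div2 g].
Proof.
split; apply/funext => m; rewrite psDE /ps_div0 /ps_div1 /ps_div2 psDE //.
  by case: ifP; rewrite ?addr0.
by case: ifP; rewrite ?addr0.
Qed.

Lemma ps_divZ c f : [/\ ps_div0 (c *: f) = c *: ps_div0 f,
  ps_div1 (c *: f) = c *: ps_div1 f & ps_div2 (c *: f) = c *: ps_div2 f].
Proof.
split; apply/funext => m; rewrite psZE /ps_div0 /ps_div1 /ps_div2 psZE //.
  by case: ifP; rewrite ?mulr0.
by case: ifP; rewrite ?mulr0.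
Qed.

(** The relation puts [u0] in the ideal of [x1] and [x2]: [a] and [b] divide its monomials by [x1],
    or else by [x2]. What remains is a relation between [x1] and [x2] alone, settled by
    coprimality. *)
Lemma koszul_exact1 (u0 u1 u2 : Q) : x0 * u0 + x1 * u1 + x2 * u2 = 0 ->
  exists p0 p1 p2, [/\ u0 = x1 * p2 - x2 * p1, u1 = x2 * p0 - x0 * p2 &
    u2 = x0 * p1 - x1 * p0].
Proof.
move=> ux; pose a : Q := fun m => u0 (m + U_(o1))%MM.
pose b : Q := fun m => if m o1 == 0%N then u0 (m + U_(o2))%MM else 0.
have u0E : u0 = x1 * a + x2 * b.
  apply/funext => m; rewrite psDE !ps_var_mulE /a /b !mnmBE !mnm1E /= subn0.
  case: posnP => m1; case: posnP => m2.
  - have := congr1 (fun f : Q => f (m + U_(o0))%MM) ux; rewrite !psDE ps_var_shift.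
    by rewrite !ps_var_mulE !mnmDE !mnm1E m1 m2 /= !addr0.
  - by rewrite add0r submK // lem_mnm1.
  - by rewrite addr0 submK // lem_mnm1.
  - by rewrite addr0 submK // lem_mnm1.
have [h h1 h2] : exists2 h, x0 * a + u1 = x2 * h & - (x0 * b + u2) = x1 * h.
  apply: ps_var_coprime => //; apply/eqP; rewrite mulrN -addr_eq0 -ux u0E; apply/eqP.
  by ring.
exists h, (- b), a; split; first by rewrite u0E; ring.
  by rewrite -h1; ring.
by rewrite -h2; ring.
Qed.

Lemma koszul_exact2 (v0 v1 v2 : Q) :
  x1 * v2 - x2 * v1 = 0 -> x2 * v0 - x0 * v2 = 0 -> x0 * v1 - x1 * v0 = 0 ->
  exists p, [/\ v0 = x0 * p, v1 = x1 * p & v2 = x2 * p].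
Proof.
move=> _ /eqP; rewrite subr_eq0 => /eqP e1 /eqP; rewrite subr_eq0 => /eqP e2.
have [//|p v1E v0E] := ps_var_coprime _ e2.
exists p; split=> //; apply: (@ps_varI _ _ o0).
by rewrite -e1 v0E; ring.
Qed.

(** A variable raises degrees by exactly one, so cutting the relation below degree [d + 1] leaves an
    exact relation between the entries cut below degree [d]. *)
Lemma koszul_mod1 d (u0 u1 u2 : Q) : ps_order d.+1 (x0 * u0 + x1 * u1 + x2 * u2) ->
  exists p0 p1 p2, [/\ ps_order d (u0 - (x1 * p2 - x2 * p1)),
    ps_order d (u1 - (x2 * p0 - x0 * p2)) & ps_order d (u2 - (x0 * p1 - x1 * p0))].
Proof.
move=> /ps_low_order; rewrite !ps_lowD !ps_low_var => /koszul_exact1[p0 [p1 [p2 []]]].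
move=> e0 e1 e2; exists p0, p1, p2.
by rewrite -e0 -e1 -e2; split; apply: ps_lowK.
Qed.

Lemma koszul_mod2 d (v0 v1 v2 : Q) : ps_order d.+1 (x1 * v2 - x2 * v1) ->
  ps_order d.+1 (x2 * v0 - x0 * v2) -> ps_order d.+1 (x0 * v1 - x1 * v0) ->
  exists p, [/\ ps_order d (v0 - x0 * p), ps_order d (v1 - x1 * p) &
    ps_order d (v2 - x2 * p)].
Proof.
move=> /ps_low_order e0 /ps_low_order e1 /ps_low_order e2.
move: e0 e1 e2; rewrite !ps_lowB !ps_low_var => e0 e1 e2.
have [p [p0 p1 p2]] := koszul_exact2 e0 e1 e2; exists p.
by rewrite -p0 -p1 -p2; split; apply: ps_lowK.
Qed.

End ThreeVariables.

(** * Quotients of the power series ring *)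

Section IdealPowers.
Variable A : comNzRingType.
Implicit Types (S J : set A).

Lemma ideal_gen_add S a b : ideal_gen S a -> ideal_gen S b -> ideal_gen S (a + b).
Proof.
move=> [l [r [g [gS ->]]]] [l' [r' [g' [gS' ->]]]].
pose glue (T : Type) (u : 'I_l -> T) (v : 'I_l' -> T) j :=
  match fintype.split j with inl i => u i | inr i => v i end.
exists (l + l')%N, (glue _ r r'), (glue _ g g'); split.
  by move=> j; rewrite /glue; case: fintype.split.
rewrite big_split_ord /glue; congr (_ + _); apply: eq_bigr => j _.
  by rewrite (unsplitK (inl _ : 'I_l + 'I_l')).
by rewrite (unsplitK (inr _ : 'I_l + 'I_l')).
Qed.

Lemma ideal_gen_mem S a b : S a -> ideal_gen S (b * a).
Proof.
by move=> Sa; exists 1%N, (fun _ => b), (fun _ => a); rewrite big_ord1.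
Qed.

Lemma ideal_pow0 J a : ideal_pow J 0 a.
Proof.
rewrite -[a]mulr1; apply: ideal_gen_mem; exists (fun _ => 0); split=> [[]//|].
by rewrite big_ord0.
Qed.

Lemma ideal_powS J i a b : J a -> ideal_pow J i b -> ideal_pow J i.+1 (a * b).
Proof.
move=> Ja [l [r [g [gJ ->]]]].
exists l, r, (fun j => a * g j); split; last first.
  by rewrite mulr_sumr; apply: eq_bigr => j _; rewrite mulrCA.
move=> j; have [h [hJ ->]] := gJ j.
exists (fun c => if unlift ord0 c is Some c' then h c' else a); split.
  by move=> c; case: unliftP.
rewrite big_ord_recl unlift_none; congr (_ * _).
by apply: eq_bigr => c _; rewrite liftK.
Qed.

End IdealPowers.

Lemma has_rank_preim (k : fieldType) (V V' : lmodType k) (f : {linear V -> V'})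
    (U W : set V') l :
  (forall v', exists v, f v = v') -> subspace U -> subspace W -> has_rank U W l ->
  has_rank (f @^-1` U) (f @^-1` W) l.
Proof.
move=> surj sU sW [b bP]; have [Ub bex] := bP.
have /choice[beta betaP] j : exists v, f v = b j := surj (b j).
have fsum (c : 'rV[k]_l) : f (\sum_j c 0 j *: beta j) = \sum_j c 0 j *: b j.
  by rewrite linear_sum; apply: eq_bigr => j _; rewrite linearZ betaP.
exists beta; apply: basis_mod_intro; first exact: subspace_preim.
- by move=> j; rewrite /preimage /= betaP.
- by move=> c; rewrite /preimage /= fsum; apply: basis_mod_free bP.
- move=> u /bex[c [Wc _]]; exists c.
  by rewrite /preimage /= linearB fsum.
Qed.

Section QuotientMap.
Variables (k : fieldType) (I : idealr (powser 3 k)).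
Local Notation Q := (powser 3 k).
Local Notation R := {ideal_quot I}.

Definition qpi (f : Q) : R := \pi_R f.

Lemma qpi_linear : linear qpi.
Proof.
move=> a f g; rewrite /qpi rmorphD; congr (_ + _).
by rewrite -[RHS]/(\pi_R a%:A * \pi_R f) -rmorphM -scalerAl mul1r.
Qed.

HB.instance Definition _ := GRing.isLinear.Build k Q R _ qpi qpi_linear.

Lemma qpi_monoid : monoid_morphism qpi.
Proof. by split; rewrite /qpi ?rmorph1 // => f g; rewrite rmorphM. Qed.

HB.instance Definition _ := GRing.isMonoidMorphism.Build Q R qpi qpi_monoid.

Lemma qpi_surj u : exists f, qpi f = u.
Proof. by exists (repr u); rewrite /qpi reprK. Qed.

Lemma qpi_eq f g : qpi f = qpi g <-> f - g \in I.
Proof. by rewrite /qpi Quotient.idealrBE; split=> /eqP. Qed.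

Lemma qpi_eq0 f : qpi f = 0 <-> f \in I.
Proof. by rewrite -(rmorph0 qpi) qpi_eq subr0. Qed.

Lemma quot_varsE i : quot_vars I i = qpi (ps_var k i).
Proof. by []. Qed.

Local Notation m := (maxideal (quot_vars I)).

Lemma maxideal_var i : m (quot_vars I i).
Proof. by rewrite -[quot_vars I i]mul1r; apply: ideal_gen_mem; exists i. Qed.

Lemma maxideal_order u : m u -> exists2 f, ps_order 1 f & u = qpi f.
Proof.
move=> [l [r [g [gt ->]]]].
have /choice[r' r'P] j : exists f, qpi f = r j := qpi_surj (r j).
have /choice[g' g'P] j : exists i, quot_vars I i = g j.
  by have [i _ <-] := gt j; exists i.
exists (\sum_j r' j * ps_var k (g' j)).
  by apply: (subspace_sum (@subspace_order 2 k 1)) => j; apply/ps_orderMl/ps_order_var.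
by rewrite linear_sum; apply: eq_bigr => j _; rewrite rmorphM /= r'P -quot_varsE g'P.
Qed.

(** From right to left, a series of order [i + 1] is a sum of only three products of a variable with
    a series of order [i]; the finiteness matters, as powers of an ideal consist of finite sums. *)
Lemma ideal_pow_order i u :
  ideal_pow m i u <-> exists2 f, ps_order i f & u = qpi f.
Proof.
split=> [[l [r [g [gm ->]]]]|[f fi ->{u}]].
  have /choice[r' r'P] j : exists f, qpi f = r j := qpi_surj (r j).
  have /choice[g' g'P] j : exists f, ps_order i f /\ g j = qpi f.
    have [h [hm ->]] := gm j.
    have /choice[h' h'P] c : exists f, ps_order 1 f /\ h c = qpi f.
      by have [f ? ?] := maxideal_order (hm c); exists f.
    exists (\prod_c h' c); split; last first.
      by rewrite rmorph_prod; apply: eq_bigr => c _; apply: (h'P c).2.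
    have : forall c, ps_order 1 (h' c) by move=> c; apply: (h'P c).1.
    clear; elim: i h' => [//|i IHi] h' h1; rewrite big_ord_recl.
    by apply: (@ps_orderM _ _ 1 i) => //; apply: IHi => c.
  exists (\sum_j r' j * g' j).
    apply: (subspace_sum (@subspace_order 2 k i)) => j.
    by apply/ps_orderMl; apply: (g'P j).1.
  by rewrite linear_sum; apply: eq_bigr => j _; rewrite rmorphM /= r'P (g'P j).2.
elim: i f fi => [|i IHi] f fi; first exact: ideal_pow0.
have [d0 d1 d2] := ps_div_order fi.
rewrite (ps_divE (fi _ _)) ?mdeg0 // !linearD !rmorphM /= -!quot_varsE.
do 2?[apply: ideal_gen_add]; apply: ideal_powS; try exact: maxideal_var; exact: IHi.
Qed.

Definition ps_socle : set Q := [set f | forall i, ps_var k i * f \in I].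

Lemma socle_ps f : socle (quot_vars I) (qpi f) <-> ps_socle f.
Proof.
split=> [h i|h u /maxideal_order[g g1 ->]].
  by apply/qpi_eq0; rewrite rmorphM /= -quot_varsE; apply/h/maxideal_var.
rewrite -rmorphM; apply/qpi_eq0.
rewrite (ps_divE (g1 _ _)) ?mdeg0 // !mulrDl ![ps_var k _ * _]mulrC -!mulrA.
by rewrite !rpredD // idealMr.
Qed.

Lemma ideal_subspace : subspace [set` I].
Proof.
split=> /= [|a u v uI vI]; first exact: rpred0.
by rewrite rpredD // -[u]mul1r scalerAl idealMr.
Qed.

Lemma subspace_ideal_pow i : subspace (ideal_pow m i).
Proof.
split=> [|a u v /ideal_pow_order[f fi ->] /ideal_pow_order[g gi ->]].
  by apply/ideal_pow_order; exists 0; rewrite ?rmorph0.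
apply/ideal_pow_order; exists (a *: f + g); last by rewrite linearP.
exact: (subspaceP (@subspace_order 2 k i)).
Qed.

Lemma subspace_socle : subspace (socle (quot_vars I)).
Proof.
split=> [u _|a u v us vs w mw]; first by rewrite mulr0.
by rewrite mulrDr -scalerAr us // vs // scaler0 addr0.
Qed.

Lemma subspace_ps_socle : subspace ps_socle.
Proof.
split=> [i|a u v us vs i]; first by rewrite mulr0; apply: rpred0.
by rewrite mulrDr -scalerAr; apply: (subspaceP ideal_subspace); [apply: us | apply: vs].
Qed.

Lemma preim_ideal_pow i : qpi @^-1` (ideal_pow m i) = add_set (@ps_order 3 k i) [set` I].
Proof.
apply/seteqP; split=> [f /ideal_pow_order[g gi /qpi_eq fg]|_ [g [h [gi hI ->]]]].
  by exists g, (f - g); split=> //; rewrite addrC subrK.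
apply/ideal_pow_order; exists g => //; apply/qpi_eq.
by rewrite addrAC subrr add0r.
Qed.

Lemma preim_socle : qpi @^-1` (socle (quot_vars I)) = ps_socle.
Proof. by apply/seteqP; split=> f /socle_ps. Qed.

Lemma preim_set0 : qpi @^-1` [set 0] = [set` I].
Proof. by apply/seteqP; split=> f /qpi_eq0. Qed.

Lemma hilbert_ps i h : hilbert_value (quot_vars I) i h ->
  has_rank (add_set (@ps_order 3 k i) [set` I]) (add_set (@ps_order 3 k i.+1) [set` I]) h.
Proof.
rewrite -!preim_ideal_pow; apply: (has_rank_preim qpi_surj); exact: subspace_ideal_pow.
Qed.

Lemma type_ps l : has_type (quot_vars I) l -> has_rank ps_socle [set` I] l.
Proof.
rewrite -preim_socle -preim_set0; apply: (has_rank_preim qpi_surj).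
  exact: subspace_socle.
exact: subspace_set0.
Qed.

Lemma socle_degree_ps s : socle_degree (quot_vars I) s ->
  (exists2 f, ps_order s f & f \notin I) /\ @ps_order 3 k s.+1 `<=` [set` I].
Proof.
move=> [ms ms1]; split.
  apply: contrapT => h; apply: ms; apply/seteqP; split=> u.
    move=> /ideal_pow_order[f fs ->]; apply/qpi_eq0; apply: contrapT => /negP fI.
    by apply: h; exists f.
  by move=> ->; apply: subspace0; apply: subspace_ideal_pow.
move=> f fs; apply/qpi_eq0.
have : ideal_pow m s.+1 (qpi f) by apply/ideal_pow_order; exists f.
by rewrite ms1.
Qed.

End QuotientMap.

(** * Hilbert functions and duality *)

Section HilbertDimensions.
Variables (k : fieldType) (d : nat).
Local Notation Q := (powser 3 k).
Local Notation order := (@ps_order 3 k).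
Local Notation V := (@vcut 3 k d).
Local Notation hq := (fun i => 'C(i + 2, 2)).

Let sO i : subspace (order i) := @subspace_order 2 k i.

Definition hilbert_fun (J : set Q) (h : nat -> nat) : Prop :=
  forall i, has_rank (add_set (order i) J) (add_set (order i.+1) J) (h i).

Lemma orderS i j : (i <= j)%N -> order j `<=` order i.
Proof. by move=> ij f; apply: ps_orderW. Qed.

Lemma vcut_order0 : V (order 0) = fullv.
Proof.
by apply/eqP; rewrite eqEsubv subvf; apply/subvP => v _; apply/(vcutP _ (sO 0)).
Qed.

Lemma vcut_orderd : V (order d) = 0%VS.
Proof.
apply/eqP; rewrite -subv0; apply/subvP => v /(vcutP _ (sO d)) vd.
rewrite memv0 -[v]ps_embK; apply/eqP/ffunP => m; rewrite ffunE [RHS]ffunE.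
by apply: vd; apply: bmdeg.
Qed.

Lemma dim_vcut_order i : (i < d)%N ->
  \dim (V (order i)) = (hq i + \dim (V (order i.+1)))%N.
Proof.
move=> id; apply: (rank_vcut (sO _) (orderS id) (sO _) (orderS (leqnSn i))).
exact: rank_order.
Qed.

Lemma dim_trunc j : (j <= d)%N ->
  \dim {: {ffun 'X_{1..3 < d} -> k^o}} = (\sum_(i < j) hq i + \dim (V (order j)))%N.
Proof.
elim: j => [|j IHj] jd; first by rewrite big_ord0 -vcut_order0.
by rewrite (IHj (ltnW jd)) dim_vcut_order // big_ord_recr addnA.
Qed.

Section OneIdeal.
Variables (J : set Q) (h : nat -> nat).
Hypotheses (sJ : subspace J) (dJ : order d `<=` J) (hJ : hilbert_fun J h).

(** For [J] containing [order d], the length of [order i + J] over [order d]. The Hilbert function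
    gives its successive differences, so two ideals are compared by induction on [i] from the common
    value at 0. *)
Definition hdim i := \dim (V (order i) + V J)%VS.

Lemma hdim0 : hdim 0 = \dim {: {ffun 'X_{1..3 < d} -> k^o}}.
Proof. by rewrite /hdim vcut_order0 sumfv. Qed.

Lemma hdimd : hdim d = \dim (V J).
Proof. by rewrite /hdim vcut_orderd add0v. Qed.

Lemma hdimS i : (i < d)%N -> hdim i = (h i + hdim i.+1)%N.
Proof.
move=> id; rewrite /hdim.
rewrite -(vcut_add (sO i) (orderS (ltnW id)) sJ dJ).
rewrite -(vcut_add (sO i.+1) (orderS id) sJ dJ).
have s' j := subspace_add (sO j) sJ.
apply: (rank_vcut (s' _) _ (s' _)) => //.
  by move=> f /dJ; apply: add_setr.
by move=> f [a [b [ai bJ ->]]]; exists a, b; split=> //; apply: ps_orderW ai.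
Qed.

Lemma subset_order n : (n <= d)%N -> (forall i, (i < n)%N -> h i = hq i) ->
  J `<=` order n.
Proof.
move=> nd hE; apply: (vcut_sub (sO n) (orderS nd) sJ dJ).
have dimE j : (j <= n)%N -> hdim j = \dim (V (order j)).
  elim: j => [|j IHj] jn; first by rewrite hdim0 vcut_order0.
  have jd := leq_trans jn nd.
  by have := IHj (ltnW jn); rewrite hdimS // dim_vcut_order // hE // => /addnI.
have /eqP -> : (V (order n) == V (order n) + V J)%VS.
  by rewrite eqEdim addvSl -(dimE n) /=.
exact: addvSr.
Qed.

Lemma hdim_order n : J `<=` order n -> hdim n = \dim (V (order n)).
Proof. by move=> Jn; rewrite /hdim (addv_idPl (vcutS d sJ (sO n) Jn)). Qed.

End OneIdeal.

(* The lengths of Q/I1, Q/I2 and Q/(I1 `&` I2) determine that of Q/(I1 + I2). *)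
Lemma order_sub_add (I I1 I2 : set Q) (h h1 h2 : nat -> nat) n :
  subspace I1 -> subspace I2 -> I = I1 `&` I2 -> order d `<=` I ->
  hilbert_fun I h -> hilbert_fun I1 h1 -> hilbert_fun I2 h2 ->
  (n <= d)%N -> I2 `<=` order n ->
  (forall i, (i < n)%N -> h i = h2 i) ->
  (forall i, (n <= i < d)%N -> h i = h1 i + h2 i)%N ->
  order n `<=` add_set I1 I2.
Proof.
move=> sI1 sI2 IE dI hI hI1 hI2 nd I2n hlo hhi.
have sI : subspace I by rewrite IE; apply: subspaceI.
have dI1 : order d `<=` I1 by move=> f /dI; rewrite IE => -[].
have dI2 : order d `<=` I2 by move=> f /dI; rewrite IE => -[].
have lo j : (j <= n)%N -> hdim I j = hdim I2 j.
  elim: j => [|j IHj] jn; first by rewrite !hdim0.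
  have jd := leq_trans jn nd; have := IHj (ltnW jn).
  by rewrite (hdimS sI dI hI jd) (hdimS sI2 dI2 hI2 jd) hlo // => /addnI.
(* The additivity [hhi] summed over the degrees from [n] up to [j], written without subtraction. *)
have hi j : (n <= j)%N -> (j <= d)%N ->
    (hdim I n + (hdim I1 j + hdim I2 j) = hdim I j + (hdim I1 n + hdim I2 n))%N.
  elim: j => [|j IHj] nj jd; first by move: nj; rewrite leqn0 => /eqP ->.
  move: nj; rewrite leq_eqVlt ltnS => /predU1P[-> //|nj].
  have := IHj nj (ltnW jd).
  rewrite (hdimS sI dI hI jd) (hdimS sI1 dI1 hI1 jd) (hdimS sI2 dI2 hI2 jd).
  rewrite hhi ?nj //; lia.
have := hi d nd (leqnn d); rewrite lo // !hdimd => dimE.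
have sI12 := subspace_add sI1 sI2.
have dI12 : order d `<=` add_set I1 I2 by move=> f /dI1; apply: add_setl.
apply: (vcut_sub sI12 dI12 (sO n) (orderS nd)).
rewrite (vcut_add sI1 dI1 sI2 dI2).
have capE : V I = (V I1 :&: V I2)%VS by rewrite IE vcutI.
(* The sum [I1 + I2] lies in [order n + I1] because [I2] lies in [order n]. By the two counts and
   the dimension formula for sums the dimensions agree, so [order n] lies in [I1 + I2]. *)
have /eqP -> : (V I1 + V I2 == V (order n) + V I1)%VS.
  rewrite eqEdim; apply/andP; split.
    rewrite addvC; apply: addvS => //; exact: vcutS.
  have := dimv_sum_cap (V I1) (V I2); rewrite -capE.
  rewrite -/(hdim I1 n); lia.
exact: addvSl.
Qed.

End HilbertDimensions.

(** * Functionals defining Gorenstein ideals, and the duality they induce *)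

Section Gorenstein.
Variables (k : fieldType) (J : idealr (powser 3 k)) (d : nat).
Local Notation Q := (powser 3 k).
Local Notation order := (@ps_order 3 k).
Hypothesis dJ : order d `<=` [set` J].

(** Choose [g] of largest order with [f * g] outside [J]: that order is bounded by [d], and by
    maximality every variable sends [f * g] into [J]. *)
Lemma socle_essential f : f \notin J -> exists2 g, ps_socle J (f * g) & f * g \notin J.
Proof.
move=> fJ; pose has j := `[<exists2 g, order j g & f * g \notin J>].
have has0 : exists j, has j.
  by exists 0%N; apply/asboolP; exists 1; rewrite ?mulr1.
have bnd j : has j -> (j <= d)%N.
  move=> /asboolP[g gj]; rewrite leqNgt; apply: contra => dj.
  by apply: dJ; apply/ps_orderMl/(ps_orderW (ltnW dj)).
case: (ex_maxnP has0 bnd) => j /asboolP[g gj fg] jmax.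
exists g => // i; apply: contrapT => /negP xfg.
have /jmax : has j.+1; last by rewrite ltnn.
apply/asboolP; exists (ps_var k i * g); last by rewrite mulrCA.
by apply: (@ps_orderM _ _ 1 j) => //; apply: ps_order_var.
Qed.

Hypothesis type1 : has_rank (ps_socle J) [set` J] 1.

Lemma socle_generator : exists2 y, ps_socle J y & y \notin J.
Proof.
have [b bP] := type1; have [sb bex] := bP.
exists (b 0); first exact: sb.
apply/negP => bJ.
have := basis_mod_free (c := const_mx 1) (subspace_ps_socle J) (ideal_subspace J) bP.
rewrite big_ord1 mxE scale1r => /(_ bJ)/rowP/(_ 0)/eqP.
by rewrite !mxE oner_eq0.
Qed.

Lemma socle_proportional f w : ps_socle J f -> f \notin J -> ps_socle J w ->
  exists c : k, w - c *: f \in J.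
Proof. by move=> sf /negP; apply: rank1_proportional (ideal_subspace J) type1 sf. Qed.

(** Any functional that kills [J] but not a socle generator [y] will do: if [f] is outside [J], some
    multiple [f * g] is a socle element outside [J], and [y] is a scalar multiple of it modulo
    [J]. *)
Lemma dual_functional : exists phi : {linear Q -> k^o},
  forall f, f \in J <-> forall g, phi (f * g) = 0.
Proof.
have [y sy yJ] := socle_generator.
have sJ := ideal_subspace J.
pose W := @vcut 3 k d [set` J].
have WP f : ps_cut d f \in W <-> f \in J := vcut_mem sJ dJ f.
(* [projv W] fixes [W], so the complementary part vanishes on [J]; [phi] reads off a coordinate [m]
   of that part at which [y] survives. *)
pose z := ps_cut d y - projv W (ps_cut d y).
have : z != 0.
  apply: contra yJ; rewrite subr_eq0 => /eqP zW; apply/WP.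
  by rewrite zW memv_proj.
move=> z0; have [m zm] : exists m, z m != 0.
  apply: contrapT => zall; case/eqP: z0; apply/ffunP => m; rewrite [RHS]ffunE.
  by apply: contrapT => /eqP zm; apply: zall; exists m.
pose p (f : Q) : k^o := (ps_cut d f - projv W (ps_cut d f)) m.
have lp : linear p.
  move=> a f g; rewrite /p (linearP (@ps_cut 3 k d)) (linearP (projv W)).
  rewrite opprD addrACA -scalerBr [LHS]ffunE.
  by rewrite [X in X + _]ffunE.
pose phi : {linear Q -> k^o} := HB.pack p (GRing.isLinear.Build k Q k^o _ p lp).
have phiJ f : f \in J -> phi f = 0.
  by move=> /WP fW; rewrite /= /p projv_id // subrr ffunE.
exists phi => f; split=> [fJ g|h]; first by apply: phiJ; rewrite mulrC idealMr.
apply: contrapT => /negP/socle_essential[g sfg fgJ].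
have [c yc] := socle_proportional sfg fgJ sy.
have := phiJ _ yc; rewrite linearB linearZ_LR h scaler0 subr0 => y0.
by move: zm; rewrite -[z m]/(phi y) y0 eqxx.
Qed.

End Gorenstein.

Section Duality.
Variables (k : fieldType) (J : idealr (powser 3 k)) (n : nat).
Local Notation Q := (powser 3 k).
Local Notation order := (@ps_order 3 k).
Local Notation hq := (fun i => 'C(i + 2, 2)).
Variables (h : nat -> nat) (phi : {linear Q -> k^o}).
Hypotheses (dJ : order (n + n) `<=` [set` J]) (Jn : [set` J] `<=` order n).
Hypotheses (hJ : hilbert_fun [set` J] h).
Hypothesis hE : forall i, (i < n)%N -> h (n + n - i.+1)%N = hq i.
Hypothesis phiP : forall f, f \in J <-> forall g, phi (f * g) = 0.

Lemma phi_ideal f : f \in J -> phi f = 0.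
Proof. by move=> /phiP/(_ 1); rewrite mulr1. Qed.

(* The pairing of (order n)/J with Q/(order n) induced by phi is perfect:
   it is injective on the left, and both sides have the same dimension. *)
Lemma perfect_pairing (lam : {linear Q -> k^o}) :
  (forall f, order n f -> lam f = 0) ->
  exists2 p, order n p & forall u, phi (p * u) = lam u.
Proof.
move=> lam0; have sJ := ideal_subspace J.
have sO i : subspace (order i) := @subspace_order 2 k i.
pose d := (n + n)%N; have dJd : order d `<=` [set` J] := dJ.
pose V := @vcut 3 k d.
pose th (e : {ffun 'X_{1..3 < d} -> k^o}) : {ffun 'X_{1..3 < n} -> k^o} :=
  [ffun m : 'X_{1..3 < n} => phi (ps_emb _ _ d e * ps_mon k m)].
have lth : linear th.
  by move=> a u v; apply/ffunP => m; rewrite !ffunE linearP mulrDl -scalerAl linearP.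
pose Th := linfun (HB.pack_for {linear _ -> _} th (GRing.isLinear.Build k _ _ _ th lth)).
have ThE e : Th e = th e by rewrite lfunE.
(* Both sides vanish on series of order [n], the left one because a product of two such series lies
   in [J]. So it is enough to test monomials of degree less than [n]. *)
have ext p (lam' : {linear Q -> k^o}) : order n p -> (forall f, order n f -> lam' f = 0) ->
    (forall m : 'X_{1..3 < n}, phi (p * ps_mon k m) = lam' (ps_mon k m)) ->
    forall u, phi (p * u) = lam' u.
  move=> pn lam'0 pm u; rewrite -[u](subrK (ps_low n u)) mulrDr (linearD phi) (linearD lam').
  congr (_ + _).
    rewrite lam'0; last exact: ps_lowK.
    by apply: phi_ideal; apply: dJ; apply: ps_orderM => //; apply: ps_lowK.
  rewrite ps_low_sum mulr_sumr !linear_sum; apply: eq_bigr => m _.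
  by rewrite -scalerAr !linearZ /= pm.
have kerE : (V (order n) :&: lker Th = V [set` J])%VS.
  apply/vspaceP => e; rewrite memv_cap memv_ker ThE; apply/andP/idP.
    move=> [/(vcutP _ (sO n)) en /eqP e0]; apply/(vcutP _ sJ)/phiP => g.
    apply: (ext _ (\0 : {linear Q -> k^o})) => // m.
    by have /ffunP/(_ m) := e0; rewrite !ffunE.
  move=> /(vcutP _ sJ) eJ; split; first exact/(vcutP _ (sO n))/Jn.
  by apply/eqP/ffunP => m; rewrite !ffunE; apply: (phiP _).1.
(* [hE] is the symmetry of the Hilbert function: read downwards from degree [2 n - 1] it repeats
   that of [Q] read upwards. Thus [order n] modulo [J] has the length of [Q] modulo [order n]. *)
have dimE : \dim (V (order n)) =
    (\dim {: {ffun 'X_{1..3 < n} -> k^o}} + \dim (V [set` J]))%N.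
  have H j : (j <= n)%N ->
      hdim d [set` J] (d - j) = (\sum_(i < j) hq i + \dim (V [set` J]))%N.
    elim: j => [|j IHj] jn; first by rewrite subn0 hdimd big_ord0.
    rewrite (hdimS sJ dJd hJ); last by rewrite /d; lia.
    rewrite hE // big_ord_recr /= (_ : (d - j.+1).+1 = (d - j)%N); last by rewrite /d; lia.
    by rewrite (IHj (ltnW jn)) addnA [X in (X + _)%N]addnC.
  have := H n (leqnn n); rewrite /d addnK -/d (hdim_order _ sJ Jn) => ->.
  by rewrite (dim_trunc k (leqnn n)) vcut_orderd dimv0 addn0.
have ThT : (Th @: V (order n))%VS = fullv.
  apply/eqP; rewrite eqEdim subvf /=.
  have := limg_ker_dim Th (V (order n)); rewrite kerE dimE => /eqP.
  by rewrite addnC eqn_add2r => /eqP ->.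
have : [ffun m : 'X_{1..3 < n} => lam (ps_mon k m)] \in (Th @: V (order n))%VS.
  by rewrite ThT memvf.
case/memv_imgP => e /(vcutP _ (sO n)) en eE.
exists (ps_emb _ _ d e) => //; apply: ext => // m.
by have /ffunP/(_ m) := eE; rewrite ThE !ffunE.
Qed.

End Duality.

(** * Products of Koszul cycles *)

Section VectorCalculus.
Variable A : comNzRingType.
Implicit Types (u v w p : 'I_3 -> A).

Definition dot u v : A := \sum_i u i * v i.

Definition cross u v (i : 'I_3) : A :=
  if i == o0 then u o1 * v o2 - u o2 * v o1 else
  if i == o1 then u o2 * v o0 - u o0 * v o2 else u o0 * v o1 - u o1 * v o0.

Lemma dotE u v : dot u v = u o0 * v o0 + u o1 * v o1 + u o2 * v o2.
Proof. exact: big_ord3. Qed.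

Lemma dot_cross0 u p : dot u (cross u p) = 0.
Proof. by rewrite dotE /cross /=; ring. Qed.

Lemma cross_scale0 u a i : cross u (fun j => u j * a) i = 0.
Proof. by move: i; apply: all_ord3; rewrite /cross /=; ring. Qed.

Lemma cross_crossl u p v i : cross (cross u p) v i = p i * dot u v - u i * dot p v.
Proof. by rewrite !dotE; move: i; apply: all_ord3; rewrite /cross /=; ring. Qed.

Lemma cross_anti u v i : cross u v i = - cross v u i.
Proof. by move: i; apply: all_ord3; rewrite /cross /=; ring. Qed.

Lemma scale_dot u v w i : u i * dot v w = cross v (cross u w) i + w i * dot u v.
Proof. by rewrite !dotE; move: i; apply: all_ord3; rewrite /cross /=; ring. Qed.

Lemma dot_crossl u p v : dot (cross u p) v = - dot p (cross u v).
Proof. by rewrite !dotE /cross /=; ring. Qed.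

Lemma dotC u v : dot u v = dot v u.
Proof. by rewrite !dotE; ring. Qed.

Lemma dotBl u v w : dot (fun i => u i - v i) w = dot u w - dot v w.
Proof. by rewrite !dotE; ring. Qed.

Lemma dotBr u v w : dot w (fun i => u i - v i) = dot w u - dot w v.
Proof. by rewrite !dotE; ring. Qed.

Lemma crossBl u v w i : cross (fun i => u i - v i) w i = cross u w i - cross v w i.
Proof. by move: i; apply: all_ord3; rewrite /cross /=; ring. Qed.

Lemma crossBr u v w i : cross w (fun i => u i - v i) i = cross w u i - cross w v i.
Proof. by move: i; apply: all_ord3; rewrite /cross /=; ring. Qed.

Lemma cross_sub_scale u v w a b i : cross u v i =
  cross (fun j => u j - a * w j) v i - a * cross (fun j => v j - b * w j) w i.
Proof. by move: i; apply: all_ord3; rewrite /cross /=; ring. Qed.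

Lemma dot_scale u v a : dot u (fun j => v j * a) = dot u v * a.
Proof. by rewrite !dotE; ring. Qed.

End VectorCalculus.

Section VectorOrder.
Variable k : comNzRingType.
Local Notation Q := (powser 3 k).
Local Notation order := (@ps_order 3 k).
Local Notation x := (@ps_var 3 k).
Implicit Types (u v : 'I_3 -> Q).

Lemma koszul_order1 d u : order d.+1 (dot x u) ->
  exists p, forall i, order d (u i - cross x p i).
Proof.
rewrite dotE => /koszul_mod1[p0 [p1 [p2 [h0 h1 h2]]]].
exists (fun i => if i == o0 then p0 else if i == o1 then p1 else p2).
exact: all_ord3.
Qed.

Lemma koszul_order2 d v : (forall i, order d.+1 (cross x v i)) ->
  exists p, forall i, order d (v i - x i * p).
Proof.
move=> h; have [p [h0 h1 h2]] := koszul_mod2 (h o0) (h o1) (h o2).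
by exists p; apply: all_ord3.
Qed.

Lemma cross_order d e u v : (forall i, order d (u i)) -> (forall i, order e (v i)) ->
  forall i, order (d + e) (cross u v i).
Proof.
by move=> ud ve; apply: all_ord3; rewrite /cross /=; apply: ps_orderB; apply: ps_orderM.
Qed.

Lemma dot_order d e u v : (forall i, order d (u i)) -> (forall i, order e (v i)) ->
  order (d + e) (dot u v).
Proof.
by move=> ud ve; rewrite dotE; do 2?[apply: ps_orderD]; apply: ps_orderM.
Qed.

Definition ps_div (f : Q) (i : 'I_3) : Q :=
  if i == o0 then ps_div0 f else if i == o1 then ps_div1 f else ps_div2 f.

Lemma ps_div_dot f : f 0%MM = 0 -> dot x (ps_div f) = f.
Proof. by move=> f0; rewrite dotE /ps_div /= -ps_divE. Qed.

Lemma ps_div_orderS d f i : order d.+1 f -> order d (ps_div f i).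
Proof. by move=> /ps_div_order[h0 h1 h2]; move: i; apply: all_ord3. Qed.

End VectorOrder.

Section VectorIdeal.
Variables (k : fieldType) (I : idealr (powser 3 k)).
Local Notation Q := (powser 3 k).
Local Notation x := (@ps_var 3 k).
Implicit Types (u v w p : 'I_3 -> Q).

Lemma dot_ideal u v : (forall i, v i \in I) -> dot u v \in I.
Proof. by move=> vI; rewrite dotE !rpredD // idealMr. Qed.

Lemma cross_ideal u v i : (forall i, v i \in I) -> cross u v i \in I.
Proof. by move=> vI; move: i; apply: all_ord3; rewrite /cross /= rpredB // idealMr. Qed.

Lemma idealMl a b : a \in I -> a * b \in I.
Proof. by rewrite mulrC; apply: idealMr. Qed.

(* A product of two 1-cycles changes by a boundary when a boundary is
   subtracted from one of the factors. *)
Lemma cross_boundary u v p q : dot x u \in I -> dot x v \in I ->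
  exists a, forall i,
    cross u v i - cross (fun i => u i - cross x p i) (fun i => v i - cross x q i) i
      - x i * a \in I.
Proof.
move=> uI vI; pose u' := fun i => u i - cross x p i.
(* The triple product expansions of the two boundary terms split into multiples of [x i], collected
   in this witness, and multiples of [dot x u] and [dot x v], which lie in [I]. *)
exists (- dot p v + dot q u') => i.
have -> : cross u v i - cross u' (fun i => v i - cross x q i) i
    - x i * (- dot p v + dot q u') = p i * dot x v - q i * dot x u.
  have -> : dot x u = dot x u' by rewrite dotBr dot_cross0 subr0.
  rewrite (crossBr _ _ u') (cross_anti u' (cross x q)) cross_crossl.
  by rewrite (crossBl u) cross_crossl; ring.
by rewrite rpredB // idealMr.
Qed.

Lemma dot_boundary u v p q : dot x u \in I -> (forall i, cross x v i \in I) ->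
  dot u v - dot (fun i => u i - cross x p i) (fun i => v i - x i * q) \in I.
Proof.
move=> uI vI; pose u' := fun i => u i - cross x p i.
have -> : dot u v - dot u' (fun i => v i - x i * q) = - dot p (cross x v) + dot x u * q.
  have -> : dot x u = dot x u' by rewrite dotBr dot_cross0 subr0.
  by rewrite (dotBr _ _ u') dot_scale (dotC u' x) dotBl dot_crossl; ring.
by rewrite rpredD ?idealMl // rpredN dot_ideal.
Qed.

(** By the triple product formula [scale_dot], a variable times [dot u v] is a combination of
    entries of [cross x v] and of [dot x u]. In terms of the complex: products of cycles are cycles,
    and 3-cycles are socle elements. *)
Lemma dot_socle u v : dot x u \in I -> (forall i, cross x v i \in I) ->
  ps_socle I (dot u v).
Proof.
move=> uI vI i; rewrite scale_dot rpredD ?idealMr //.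
exact: cross_ideal.
Qed.

End VectorIdeal.

Section ProductOrders.
Variables (k : fieldType) (I : idealr (powser 3 k)).
Local Notation Q := (powser 3 k).
Local Notation order := (@ps_order 3 k).
Local Notation x := (@ps_var 3 k).
Implicit Types (u v w p : 'I_3 -> Q).

Lemma cycle1_order t u : [set` I] `<=` order t.+1 -> dot x u \in I ->
  exists p, forall i, order t (u i - cross x p i).
Proof. by move=> It uI; apply: koszul_order1; apply: It. Qed.

Lemma cycle2_order t v : [set` I] `<=` order t.+1 -> (forall i, cross x v i \in I) ->
  exists q, forall i, order t (v i - x i * q).
Proof. by move=> It vI; apply: koszul_order2 => i; apply: It; apply: vI. Qed.

(** Polynomials over a field form a domain, so only the zero linear form annihilates the leading
    form of [f]. *)
Lemma linear_form_regular d (c : 'I_3 -> k) (f : Q) :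
  order d.+2 (\sum_i c i *: (x i * f)) -> order d f -> ~ order d.+1 f ->
  forall i, c i = 0.
Proof.
move=> cf fd fd1 i; apply: contrapT => /eqP ci; apply: fd1.
(* Descending induction on the exponent of the variable [i]: at [m + U_(i)] every other variable
   contributes a coefficient of [f] at a monomial with a larger exponent of [i]. *)
suff H e (m : 'X_{1..3}) : (d - m i)%N = e -> mdeg m = d -> f m = 0.
  move=> m; rewrite ltnS leq_eqVlt => /predU1P[|/fd //]; exact: H.
elim/ltn_ind: e m => e IHe m me md.
have mid : (m i <= d)%N by rewrite -md mdegE (bigD1 i) //= leq_addr.
have := cf (m + U_(i))%MM; rewrite mdegD mdeg1 md addn1 => /(_ (leqnn _)).
rewrite ps_sumE (bigD1 i) //= psZE ps_var_shift big1 ?addr0.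
  by move=> /eqP; rewrite mulf_eq0 (negbTE ci) => /eqP.
move=> j ji; rewrite psZE ps_var_mulE; case: posnP => mj; first by rewrite mulr0.
set m' := (m + U_(i) - U_(j))%MM.
have m'i : m' i = (m i).+1 by rewrite /m' !(mnmDE, mnmBE, mnm1E) eqxx (negbTE ji) subn0 addn1.
have m'd : mdeg m' = d.
  have : mdeg (m' + U_(j))%MM = d.+1.
    by rewrite /m' submK ?mdegD ?mdeg1 ?md ?addn1 // lem_mnm1.
  by rewrite mdegD mdeg1 addn1 => -[].
have m'id : (m' i <= d)%N by rewrite -[X in (_ <= X)%N]m'd mdegE (bigD1 i) //= leq_addr.
by rewrite (IHe (d - m' i)%N) ?mulr0 //; lia.
Qed.

(** * Ideals with a single leading form in the lowest degree *)

Section OneGenerator.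
Variables (d : nat) (f : Q).
Hypotheses (Id : [set` I] `<=` order d) (fI : f \in I) (fd1 : ~ order d.+1 f).
Hypothesis If : forall g, g \in I -> exists c : k, order d.+1 (g - c *: f).

(** Modulo order [d + 1] the entries of [cross x v] are [c i *: f]. Since [dot x (cross x v)]
    vanishes, the linear form with coefficients [c] kills the leading form of [f]; so [c = 0], and
    [v] gains one order over what [Id] alone gives. *)
Lemma cycle2_order_principal v : (forall i, cross x v i \in I) ->
  exists q, forall i, order d (v i - x i * q).
Proof.
move=> vI; apply: koszul_order2.
have /choice[c cP] i : exists c : k, order d.+1 (cross x v i - c *: f) := If (vI i).
suff c0 i : c i = 0 by move=> i; have := cP i; rewrite c0 scale0r subr0.
move: i; apply: (@linear_form_regular d _ f) => //; last exact: Id.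
suff -> : \sum_i c i *: (x i * f) = - \sum_i x i * (cross x v i - c i *: f).
  apply/ps_orderN; apply: (subspace_sum (@subspace_order 2 k d.+2)) => i.
  by apply: (@ps_orderM _ _ 1 d.+1) => //; apply: ps_order_var.
under [in RHS]eq_bigr => i _ do rewrite mulrBr -scalerAr.
by rewrite sumrB -/(dot _ _) dot_cross0 sub0r opprK.
Qed.

Lemma cycle1_principal u : (0 < d)%N -> dot x u \in I ->
  exists p a, forall i, order d (u i - cross x p i - a * ps_div f i).
Proof.
move=> d0 uI; have [c cf] := If uI.
have f0 : f 0%MM = 0 by apply: (Id fI); rewrite mdeg0.
have [|p pP] := @koszul_order1 k d (fun i => u i - c%:A * ps_div f i).
  rewrite dotBr; congr (order _ (_ - _)): cf.
  rewrite -{1}(ps_div_dot f0) /dot scaler_sumr; apply: eq_bigr => i _.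
  by rewrite scalerAr mulr_algl.
by exists p, c%:A => i; rewrite addrAC.
Qed.

(** By [cycle1_principal] both cycles are, up to boundaries and order [d], multiples of the one
    vector [ps_div f], whose cross product with itself is zero. This gains one order over the
    general bound [d.-1 + d.-1]. *)
Lemma cross_principal_order u v : (0 < d)%N -> dot x u \in I -> dot x v \in I ->
  exists p q, forall i,
    order (d + d.-1) (cross (fun i => u i - cross x p i) (fun i => v i - cross x q i) i).
Proof.
move=> d0 uI vI.
have [p [a pP]] := cycle1_principal d0 uI; have [q [b qP]] := cycle1_principal d0 vI.
have Do i : order d.-1 (ps_div f i).
  by apply: ps_div_orderS; rewrite prednK //; apply: Id.
have v'o i : order d.-1 (v i - cross x q i).
  rewrite -[_ - _](subrK (b * ps_div f i)); apply: ps_orderD.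
    by apply: ps_orderW (qP i); apply: leq_pred.
  exact: ps_orderMl.
exists p, q => i; rewrite (cross_sub_scale _ _ (ps_div f) a b).
by apply: ps_orderB; last apply: ps_orderMl; apply: (@cross_order k d d.-1).
Qed.

End OneGenerator.

End ProductOrders.

(** * Products killed and detected by duality *)

Section DualityProducts.
Variables (k : fieldType) (I I1 I2 : idealr (powser 3 k)).
Local Notation Q := (powser 3 k).
Local Notation order := (@ps_order 3 k).
Local Notation x := (@ps_var 3 k).
Variables (phi : {linear Q -> k^o}) (t : nat).
Hypothesis IE : forall f, f \in I <-> f \in I1 /\ f \in I2.
Hypothesis phiP : forall f, f \in I2 <-> forall g, phi (f * g) = 0.
Hypothesis dual : forall lam : {linear Q -> k^o},
  (forall f, order t.+1 f -> lam f = 0) ->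
  exists2 p, p \in I1 & forall u, phi (p * u) = lam u.

(* The functionals phi (w i * _) are the restrictions x i * u |-> lam (x i * u)
   of a single functional lam, which is represented by some p. *)
Lemma high_cycle_boundary (w : 'I_3 -> Q) :
  (2 <= t)%N -> order t.*2.+2 `<=` [set` I2] ->
  (forall i, w i \in I1) -> (forall i, order t.*2 (w i)) ->
  (forall i, cross x w i \in I) -> exists p, forall i, w i - x i * p \in I.
Proof.
move=> t2 I2o wI1 wo wI.
pose l (u : Q) : k^o := \sum_i phi (w i * ps_div u i).
have ll : linear l.
  move=> a u v; rewrite /l scaler_sumr -big_split; apply: eq_bigr => i _ /=.
  have -> : ps_div (a *: u + v) i = a *: ps_div u i + ps_div v i.
    have [h0 h1 h2] := ps_divD (a *: u) v; have [g0 g1 g2] := ps_divZ a u.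
    by move: i; apply: all_ord3; rewrite /ps_div /= ?h0 ?h1 ?h2 ?g0 ?g1 ?g2.
  by rewrite mulrDr -scalerAr linearP.
pose lam : {linear Q -> k^o} := HB.pack l (GRing.isLinear.Build k Q k^o _ l ll).
have phi0 f : f \in I2 -> phi f = 0 by move=> /phiP/(_ 1); rewrite mulr1.
have [|p pI1 pP] := @dual lam.
  move=> f fo; apply: big1 => i _; apply/phi0/I2o.
  (* Here [2 <= t] enters: the order [3 t] must reach [2 t + 2] for the product to fall into
     [I2]. *)
  apply: (@ps_orderW _ _ (t.*2 + t)); first by rewrite -addn2 leq_add2l.
  by apply: ps_orderM => //; apply: ps_div_orderS.
have cI2 i f : phi (cross x w i * f) = 0.
  by have /IE[_ /phiP] := wI i; apply.
(* The Koszul relations by which the division of [x i * u] differs from [u] in position [i] pair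
   with [w] to multiples of entries of [cross x w]; these lie in [I2], so [phi] kills them. *)
have lamx i u : lam (x i * u) = phi (w i * u).
  rewrite -[LHS]/(l (x i * u)) /l big_ord3 /ps_div /=.
  move: i; apply: all_ord3.
  - have [-> -> ->] := ps_div_var0 u.
    by rewrite !mulr0 !linear0 !addr0.
  - have [-> -> ->] := ps_div_var1 u.
    rewrite mulr0 linear0 addr0 -linearD -[RHS]subr0 -(cI2 o2 (ps_div0 u)) -linearB.
    by congr (phi _); rewrite /cross /=; ring.
  - have [-> -> ->] := ps_div_var2 u.
    rewrite -!linearD -[RHS]addr0 -(cI2 o1 (ps_div0 u)) -linearD.
    rewrite -[RHS]subr0 -(cI2 o0 (ps_div1 u)) -linearB.
    by congr (phi _); rewrite /cross /=; ring.
exists p => i; apply/IE; split; first by rewrite rpredB // idealMr.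
apply/phiP => u; rewrite mulrBl linearB /= -lamx -pP.
by rewrite [x i * p]mulrC mulrA subrr.
Qed.

Lemma nonzero_product f : f \in I -> order t.+1 f -> ~ order t.+2 f ->
  exists u v, [/\ dot x u \in I, forall i, cross x v i \in I & dot u v \notin I].
Proof.
move=> fI fo fo'.
have [m md fm] : exists2 m, mdeg m = t.+1 & f m != 0.
  apply: contrapT => h; apply: fo' => m; rewrite ltnS leq_eqVlt => /predU1P[md|/fo//].
  by apply: contrapT => /eqP fm; apply: h; exists m.
pose l i (u : Q) : k^o := (x i * u) m.
have ll i : linear (l i) by move=> a u v; rewrite /l mulrDr -scalerAr.
have /choice[v vP] i : exists p, p \in I1 /\ forall u, phi (p * u) = (x i * u) m.
  pose lam : {linear Q -> k^o} := HB.pack (l i) (GRing.isLinear.Build k Q k^o _ _ (ll i)).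
  have [g go|p pI1 pP] := @dual lam; last by exists p.
  by apply: (@ps_orderM _ _ 1 t.+1 _ _ (ps_order_var _ i) go); rewrite md.
exists (ps_div f), v.
have f0 : f 0%MM = 0 by apply: fo; rewrite mdeg0.
(* After multiplication by [u], both terms have as value under [phi] the coefficient of
   [x i * x j * u] at [m]. *)
have vI2 i j : x i * v j - x j * v i \in I2.
  apply/phiP => u; rewrite mulrBl linearB /=.
  rewrite (_ : x i * v j * u = v j * (x i * u)); last by ring.
  rewrite (_ : x j * v i * u = v i * (x j * u)); last by ring.
  by rewrite !(vP _).2 mulrCA subrr.
split; first by rewrite ps_div_dot.
  move=> i; apply/IE; split; first by apply: cross_ideal => j; apply: (vP j).1.
  by move: i; apply: all_ord3; rewrite /cross /=; apply: vI2.
apply/negP => /IE[_ /phiP/(_ 1)]; rewrite mulr1 /dot linear_sum /=.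
under eq_bigr => i _ do rewrite mulrC (vP i).2.
have -> : \sum_i ((x i * ps_div f i) m : k^o) = dot x (ps_div f) m.
  by rewrite /dot ps_sumE.
by rewrite ps_div_dot // => /eqP; rewrite (negbTE fm).
Qed.

End DualityProducts.

(** * Socle degrees of the two factors of the intersection *)

Section SocleDegrees.
Variable k : fieldType.
Local Notation Q := (powser 3 k).
Local Notation order := (@ps_order 3 k).
Local Notation x := (@ps_var 3 k).
Implicit Types (I J : idealr Q).

Let sO i : subspace (order i) := @subspace_order 2 k i.

Lemma rank0_sub (V : lmodType k) (U W : set V) : has_rank U W 0 -> U `<=` W.
Proof. by move=> [b [_ bex]] u /bex[c [h _]]; rewrite big_ord0 subr0 in h. Qed.

Definition socle_layer I i : set Q := add_set (order i) [set` I] `&` ps_socle I.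

(** The size of the polynomial only bounds the socle degree [s'] from below. Equality with [s] holds
    because the last nonzero power of the maximal ideal lies in the socle, so the coefficient of
    degree [s'] cannot vanish. *)
Lemma socle_polynomial_ps I c s : (c <= s)%N ->
  socle_polynomial (quot_vars I) ('X^c + 'X^s) ->
  socle_degree (quot_vars I) s /\ forall i, (i <= s)%N ->
    has_rank (socle_layer I i) (socle_layer I i.+1) ((i == c) + (i == s))%N.
Proof.
move=> cs [s' [ds' sz rk]].
have coef i : ('X^c + 'X^s : {poly nat})`_i = ((i == c) + (i == s))%N.
  by rewrite coefD !coefXn /= !natn.
have ss' : (s <= s')%N.
  rewrite -ltnS; apply: leq_trans sz; rewrite ltnNge; apply/negP => /leq_sizeP/(_ s (leqnn s)).
  by rewrite coef eqxx addn1.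
have rk' i : (i <= s')%N ->
    has_rank (socle_layer I i) (socle_layer I i.+1) ((i == c) + (i == s))%N.
  move=> /rk; rewrite coef /socle_layer -!preim_ideal_pow -preim_socle.
  apply: (has_rank_preim (@qpi_surj _ I)); apply: subspaceI;
    by [apply: subspace_ideal_pow | apply: subspace_socle].
have [[f fs fI] s'I] := socle_degree_ps ds'.
suff /eqP sE : s' == s.
  by split=> [|i]; [rewrite -sE | rewrite -{1}sE; apply: rk'].
apply: contraNT fI => s's.
have := rk' s' (leqnn s'); rewrite (negbTE s's) (gtn_eqF (_ : c < s')%N).
  2: by rewrite (leq_ltn_trans cs) // ltn_neqAle eq_sym s's.
move=> /rank0_sub/(_ f) [|[a [b [a1 bI ->]]] _].
  split; first exact: (add_setl (ideal_subspace I)).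
  move=> i; apply: s'I.
  by apply: (@ps_orderM _ _ 1 s') => //; apply: ps_order_var.
by rewrite rpredD // (s'I a).
Qed.

Lemma proper_of_type I J d h : order d `<=` [set` I] -> {subset I <= J} ->
  hilbert_fun [set` I] h -> hilbert_fun [set` J] h ->
  {subset J <= I}.
Proof.
move=> dI IJ hI hJ; have dJ : order d `<=` [set` J] by move=> f /dI/IJ.
have [sI sJ] := (ideal_subspace I, ideal_subspace J).
have E j : (j <= d)%N -> hdim d [set` I] j = hdim d [set` J] j.
  elim: j => [|j IHj] jd; first by rewrite !hdim0.
  by have := IHj (ltnW jd); rewrite (hdimS sI dI hI jd) (hdimS sJ dJ hJ jd) => /addnI.
have := E d (leqnn d); rewrite !hdimd => dE.
have eV : (@vcut 3 k d [set` I] == @vcut 3 k d [set` J])%VS.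
  by rewrite eqEdim dE leqnn andbT; apply: vcutS.
by apply: (vcut_sub sI dI sJ dJ); rewrite (eqP eV).
Qed.

(* Without homogeneity both Q/I1 and Q/I2 could have socle degree s: perturb the
   dual generator of degree s by the one of degree s1. *)
Lemma homogeneous_socle_degree I I1 I2 s1 s sigma :
  homogeneous_ideal I -> homogeneous_ideal I1 -> homogeneous_ideal I2 ->
  (forall f, f \in I <-> f \in I1 /\ f \in I2) ->
  has_rank (ps_socle I1) [set` I1] 1 ->
  (exists2 w, order sigma w & w \notin I1) -> order sigma.+1 `<=` [set` I1] ->
  order s.+1 `<=` [set` I] -> (exists2 w, order s w & w \notin I2) ->
  (exists2 f, f \in I2 & f \notin I1) ->
  has_rank (add_set (order s) [set` I]) (add_set (order s.+1) [set` I]) 1 ->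
  (forall i, (i <= s)%N -> i != s1 -> i != s ->
     has_rank (socle_layer I i) (socle_layer I i.+1) 0) ->
  sigma = s1.
Proof.
move=> hI hI1 hI2 IE ty [w wo wI1] oI1 oI [w2 w2o w2I2] [f fI2 fI1] rs rk.
have sI := ideal_subspace I; have sI1 := ideal_subspace I1.
have sigs : (sigma <= s)%N.
  rewrite leqNgt; apply: contra wI1 => ss.
  have /IE[//] : w \in I by apply: oI; apply: ps_orderW wo.
have sock v : order sigma v -> ps_socle I1 v.
  by move=> vo i; apply: oI1; apply: (@ps_orderM _ _ 1 sigma) => //; apply: ps_order_var.
(* A multiple of [f] generates the socle of [Q/I1] and lies in [I2]. By homogeneity its component
   [b] of degree [sigma] still lies in [I2] and outside [I1], so it is a nonzero socle element of
   [Q/I]. *)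
have [g sg fg] := socle_essential oI1 fI1.
have [c wc] := socle_proportional ty sg fg (sock _ wo).
pose b := ps_comp sigma (f * g).
have bI2 : b \in I2 by apply: homogeneous_comp => //; rewrite mulrC idealMr.
have bo : order sigma b := @ps_comp_order _ _ _ _.
have bI1 : b \notin I1.
  apply: contra wI1 => bI1.
  have := homogeneous_comp sigma hI1 wc; rewrite -scaleNr ps_compD.
  have -> : ps_comp sigma (- c *: (f * g)) = - c *: b.
    by apply/funext => m; rewrite psZE /b /ps_comp psZE; case: ifP; rewrite ?mulr0.
  have cbI : - c *: b \in I1 by apply: (subspaceZ sI1).
  rewrite (rpredDr _ cbI) => compI; rewrite -[w](subrK (ps_comp sigma w)).
  by rewrite rpredD //; apply: oI1; apply: ps_comp_mod.
have bI : b \notin I by apply: contra bI1 => /IE[].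
(* If [sigma = s], the class of [b] would span the top line of [Q/I]; as [b] lies in [I2], so would
   [w2]. *)
have ssig : sigma != s.
  apply: contra w2I2 => /eqP sE; rewrite sE in bo.
  have sIs := subspace_add (sO s.+1) sI.
  have nb : ~ add_set (order s.+1) [set` I] b.
    by case=> p [q [po qI bE]]; case/negP: bI; rewrite bE rpredD // (oI p).
  have [c' [p [q [po qI wb]]]] := rank1_proportional sIs rs (add_setl sI bo) nb (add_setl sI w2o).
  rewrite -[w2](subrK (c' *: b)) wb rpredD //; last exact: (subspaceZ (ideal_subspace I2)).
  by rewrite rpredD //; [have /IE[] := oI _ po | have /IE[] := qI].
(* Otherwise [Q/I] has no socle layer in degree [sigma], so [b] agrees modulo [I] with a series of
   higher order, and taking components of degree [sigma] puts [b] in [I]. *)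
apply: contraNeq bI => sigs1.
have bs : socle_layer I sigma b.
  split; first exact: (add_setl sI).
  move=> i; apply/IE; split; last by rewrite idealMr.
  by apply: sock.
have [[p [q [po qI bE]]] _] := rank0_sub (rk _ sigs sigs1 ssig) bs.
have bb : ps_comp sigma b = b.
  by apply/funext => m; rewrite /b /ps_comp; case: eqP.
rewrite -bb bE ps_compD (ps_comp_eq0 po) add0r.
exact: homogeneous_comp.
Qed.

End SocleDegrees.

Lemma mul2_bin2 n : (2 * 'C(n + 2, 2) = (n + 2) * (n + 1))%N.
Proof. by rewrite -mul_bin_diag bin1 addn2 addn1. Qed.

Lemma hQ_nat i : hQ i%:Z = 'C(i + 2, 2). Proof. by []. Qed.

Lemma hQ_sub a i : hQ (a%:Z - i%:Z) = if (i <= a)%N then 'C(a - i + 2, 2) else 0%N.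
Proof.
case: leqP => ia; first by rewrite subzn.
have -> : (a%:Z - i%:Z = Negz (i - a).-1)%R.
  by rewrite NegzE prednK ?subn_gt0 // -subzn ?opprB // ltnW.
by [].
Qed.

(** * Leading forms in the lowest degree of an ideal *)

Section FirstDegree.
Variables (k : fieldType) (J : set (powser 3 k)) (d n : nat) (h : nat -> nat).
Local Notation order := (@ps_order 3 k).
Hypotheses (sJ : subspace J) (dJ : order d `<=` J) (hJ : hilbert_fun J h).
Hypotheses (nd : (n < d)%N) (Jn : J `<=` order n).

Let sO i : subspace (order i) := @subspace_order 2 k i.

Lemma hdim_first : ('C(n + 2, 2) + \dim (@vcut 3 k d (order n.+1)) = h n + hdim d J n.+1)%N.
Proof.
by rewrite -(hdimS sJ dJ hJ nd) (hdim_order d sJ Jn) (dim_vcut_order k nd) //.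
Qed.

Lemma exists_initial : (h n < 'C(n + 2, 2))%N -> exists2 f, J f & ~ order n.+1 f.
Proof.
move=> hn; apply: contrapT => nex.
have Jn1 : J `<=` order n.+1.
  by move=> f Jf; apply: contrapT => fo; apply: nex; exists f.
by have := hdim_first; rewrite (hdim_order d sJ Jn1) => /addIn hE; rewrite hE ltnn in hn.
Qed.

(** The count leaves exactly one dimension for [J] modulo order [n + 1], and the class of [f]
    already fills it. *)
Lemma initial_principal f : 'C(n + 2, 2) = (h n).+1 -> J f -> ~ order n.+1 f ->
  forall g, J g -> exists c : k, order n.+1 (g - c *: f).
Proof.
move=> hn Jf fo g Jg.
pose W := @vcut 3 k d (order n.+1).
have WP e : ps_cut d e \in W <-> order n.+1 e := vcut_mem (sO _) (orderS nd) e.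
have fW : ps_cut d f \notin W by apply/negP => /WP.
have fJ : (<[ps_cut d f]> <= @vcut 3 k d J)%VS by rewrite -memvE; apply/vcut_mem.
have /eqP E : (W + <[ps_cut d f]> == W + @vcut 3 k d J)%VS.
  rewrite eqEdim addvS //= -/(hdim d J n.+1).
  have -> : hdim d J n.+1 = (\dim W).+1.
    by have := hdim_first; rewrite -/W hn addSn -addnS => /addnI.
  rewrite dimv_disjoint_sum; last first.
    apply/eqP; rewrite -subv0; apply/subvP => v; rewrite memv_cap memv0 => /andP[vW].
    case/vlineP => c vc; move: vW; rewrite vc; case: (eqVneq c 0) => [->|c0].
      by rewrite scale0r.
    by move=> /(memvZ c^-1); rewrite scalerK // (negbTE fW).
  rewrite dim_vline; case: eqP => [f0|_]; last by rewrite addn1.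
  by move: fW; rewrite f0 mem0v.
have : ps_cut d g \in (W + <[ps_cut d f]>)%VS.
  by rewrite E; apply: (subvP (addvSr _ _)); apply/vcut_mem.
case/memv_addP => w wW [_ /vlineP[c ->] gE].
exists c; apply/WP; rewrite linearB linearZ_LR /= gE addrK.
exact: wW.
Qed.

End FirstDegree.

(** * Compressed rings: initial degrees and Koszul products *)

Section Compressed.
Variables (k : fieldType) (I I1 I2 : idealr (powser 3 k)) (s1 t : nat).
Local Notation Q := (powser 3 k).
Local Notation order := (@ps_order 3 k).
Local Notation x := (@ps_var 3 k).
Local Notation s := (t.*2.+1).
Hypotheses (compI : compressed_type2 I s1 s) (compI1 : compressed_gorenstein I1).
Hypotheses (compI2 : compressed_gorenstein I2) (s2 : socle_degree (quot_vars I2) s).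
Hypothesis IE : forall f, f \in I <-> f \in I1 /\ f \in I2.
Hypothesis t2 : (2 <= t)%N.

Let h i := minn (hQ i%:Z) (hQ (s1%:Z - i%:Z) + hQ (s%:Z - i%:Z))%N.
Let h2 i := minn (hQ i%:Z) (hQ (s%:Z - i%:Z)).

Let sI := ideal_subspace I.
Let sI1 := ideal_subspace I1.
Let sI2 := ideal_subspace I2.

Lemma compressed_hilbert : hilbert_fun [set` I] h.
Proof. by have [_ _ _ _ hI] := compI => i; apply: hilbert_ps. Qed.

Lemma compressed_socle : socle_degree (quot_vars I) s /\ forall i, (i <= s)%N ->
    has_rank (socle_layer I i) (socle_layer I i.+1) ((i == s1) + (i == s))%N.
Proof. by have [_ _ le sp _] := compI; apply: socle_polynomial_ps. Qed.

Lemma compressed_top : order s.+1 `<=` [set` I].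
Proof. by have [/socle_degree_ps[]] := compressed_socle. Qed.

Lemma compressed_top2 : order s.+1 `<=` [set` I2].
Proof. by move=> f /compressed_top/IE[]. Qed.

Lemma socle_degree_uniq (J : idealr Q) a b : socle_degree (quot_vars J) a ->
  socle_degree (quot_vars J) b -> a = b.
Proof.
move=> /socle_degree_ps[[f fa fJ] oa] /socle_degree_ps[[g gb gJ] ob].
apply/eqP; rewrite eqn_leq; apply/andP; split; rewrite leqNgt.
  by apply: contra fJ => ba; apply: ob; apply: ps_orderW fa.
by apply: contra gJ => ba; apply: oa; apply: ps_orderW gb.
Qed.

Lemma gorenstein_hilbert2 : hilbert_fun [set` I2] h2.
Proof.
have [_ _ [sg /socle_degree_uniq/(_ s2) -> hI2]] := compI2 => i.
exact: hilbert_ps.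
Qed.

(** For [i <= t] one has [i <= s - i], so the term [hQ (s - i)] alone reaches [hQ i]. *)
Lemma low_hilbert i : (i <= t)%N -> h i = 'C(i + 2, 2) /\ h2 i = 'C(i + 2, 2).
Proof.
move=> it; have le : ('C(i + 2, 2) <= 'C(s - i + 2, 2))%N.
  by apply: leq_bin2l; lia.
by rewrite /h /h2 hQ_nat !hQ_sub (_ : (i <= s)%N = true); [split; lia | lia].
Qed.

Lemma compressed_order : [set` I] `<=` order t.+1.
Proof.
apply: (subset_order sI compressed_top compressed_hilbert); first lia.
by move=> i it; case: (low_hilbert it).
Qed.

Lemma gorenstein_order : [set` I2] `<=` order t.+1.
Proof.
apply: (subset_order sI2 compressed_top2 gorenstein_hilbert2); first lia.
by move=> i it; case: (low_hilbert it).
Qed.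

Lemma gorenstein_type2 : has_rank (ps_socle I2) [set` I2] 1.
Proof. by have [_ [_ ty] _] := compI2; apply: type_ps. Qed.

(** Otherwise [I] and [I2] coincide, and one quotient would have both type 2 and type 1. *)
Lemma compressed_proper : ~ {subset I2 <= I}.
Proof.
move=> I2I; have EI : forall f, f \in I <-> f \in I2.
  by move=> f; split=> [/IE[]|/I2I].
have [_ [_ /type_ps ty2] _ _ _] := compI.
suff : 2%N = 1%N by [].
apply: (rank_uniq (subspace_ps_socle I) sI _ ty2).
  by move=> f fI i; rewrite idealMr.
have -> : ps_socle I = ps_socle I2.
  by apply/seteqP; split=> f fs i; apply/EI; apply: fs.
suff -> : [set` I] = [set` I2] by exact: gorenstein_type2.
by apply/seteqP; split=> f /EI.
Qed.

(** If [s1 <= t], the term [hQ (s1 - i)] vanishes in the degrees above [t], the only ones where it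
    could matter. Then [Q/I] and [Q/I2] have equal length although [I] is properly contained in
    [I2]. *)
Lemma socle_degree_lower : (t < s1)%N.
Proof.
rewrite ltnNge; apply/negP => s1t; apply: compressed_proper.
apply: (proper_of_type compressed_top _ compressed_hilbert).
  by move=> f /IE[].
suff -> : h = h2 by exact: gorenstein_hilbert2.
apply/funext => i; have [it|ti] := leqP i t; first by have [-> ->] := low_hilbert it.
by rewrite /h /h2 (hQ_sub s1) leqNgt (leq_ltn_trans s1t ti).
Qed.

Let a := (s1 - t.+1)%N.

(** Degree [t + 1] is the first in which [hQ] need not be the minimum; apart from the common
    summand, [t + 2] competes with ['C(a + 2, 2)]. *)
Lemma hilbert_initial : h t.+1 = minn ('C(t + 2, 2) + t + 2) ('C(a + 2, 2) + 'C(t + 2, 2)).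
Proof.
rewrite /h hQ_nat !hQ_sub socle_degree_lower (_ : (t.+1 <= s)%N = true); last lia.
rewrite (_ : (s - t.+1 = t)%N); last lia.
by rewrite (_ : (t.+1 + 2 = (t + 2).+1)%N) // binS bin1 addnA.
Qed.

Lemma compressed_order_golod : (t + 2 <= 'C(a + 2, 2))%N -> [set` I] `<=` order t.+2.
Proof.
move=> ta; apply: (subset_order sI compressed_top compressed_hilbert); first lia.
move=> i; rewrite ltnS leq_eqVlt => /predU1P[->|it]; last by case: (low_hilbert it).
rewrite hilbert_initial (_ : (t.+1 + 2 = (t + 2).+1)%N) // binS bin1; lia.
Qed.

Section NonGolod.
Hypotheses (hI : homogeneous_ideal I) (hI1 : homogeneous_ideal I1).
Hypotheses (hI2 : homogeneous_ideal I2) (at2 : ('C(a + 2, 2) < t + 2)%N).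

(* If s1 = s - 1 then 'C(t + 1, 2) < t + 2, so that s = 5; degree reasons alone
   do not suffice in that case. *)
Lemma socle_degrees_lt : (s1 < t.*2)%N \/ s1 = t.*2 /\ t = 2%N.
Proof.
have aE := mul2_bin2 a; have ts1 := socle_degree_lower; have [_ _ s1s _ _] := compI.
have a2 := at2; case: (ltnP s1 t.*2) => [|le]; [by left | right].
have ta : (t - 1 <= a)%N by rewrite /a; lia.
have tle : (t <= 2)%N.
  rewrite leqNgt; apply/negP => t3; have : ((t + 1) * t <= (a + 2) * (a + 1))%N.
    by apply: leq_mul; lia.
  nia.
have te : t = 2%N by lia.
split=> //; have {}s1s : (s1 <= 5)%N by move: s1s; rewrite te.
have [|s15] := ltnP s1 5; first by move: le; rewrite te; lia.
have : a = 2%N by rewrite /a te; lia.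
by move=> a2E; move: a2; rewrite a2E te.
Qed.

Lemma top_rank : has_rank (add_set (order s) [set` I]) (add_set (order s.+1) [set` I]) 1.
Proof.
have s1s : (s1 < s)%N by have [?|[? ?]] := socle_degrees_lt; lia.
have := compressed_hilbert s; rewrite /h hQ_nat !hQ_sub leqnn subnn leqNgt s1s /=.
by rewrite add0n (minn_idPr _) // binn bin_gt0 addn2.
Qed.

Lemma top_line f w : order s f -> f \notin I -> order s w ->
  exists c : k, w - c *: f \in I.
Proof.
move=> fo fI wo; have sIs := subspace_add (@subspace_order 2 k s.+1) sI.
have top v : add_set (order s.+1) [set` I] v -> v \in I.
  by case=> p [q [po qI ->]]; rewrite rpredD // (compressed_top po).
have [|c /top ?] := rank1_proportional sIs top_rank (add_setl sI fo) _ (add_setl sI wo).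
  by move=> /top; apply/negP.
by exists c.
Qed.

Lemma socle_jump i f : (i <= s)%N -> i != s1 -> i != s -> order i f -> ps_socle I f ->
  exists2 g, order i.+1 g & f - g \in I.
Proof.
move=> le is1 is_ fo fs; have [_ /(_ _ le)] := compressed_socle.
rewrite (negbTE is1) (negbTE is_) => /rank0_sub/(_ f)[|[g [e [go eI ->]]] _].
  by split=> //; apply: (add_setl sI).
by exists g; rewrite // addrAC subrr add0r.
Qed.

Lemma gorenstein_top1 : socle_degree (quot_vars I1) s1.
Proof.
have [_ [_ /type_ps ty1] [sg dsg _]] := compI1.
suff <- : sg = s1 by [].
have [ex1 o1] := socle_degree_ps dsg; have [ex2 _] := socle_degree_ps s2.
apply: (homogeneous_socle_degree hI hI1 hI2 IE ty1 ex1 o1 compressed_top ex2 _ top_rank).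
  apply: contrapT => nex; apply: compressed_proper => f fI2; apply/IE; split=> //.
  by apply: contrapT => /negP fI1; apply: nex; exists f.
move=> i le /negbTE is1 /negbTE is_; have [_ /(_ _ le)] := compressed_socle.
by rewrite is1 is_.
Qed.

Let h1 i := minn (hQ i%:Z) (hQ (s1%:Z - i%:Z)).

Lemma gorenstein_hilbert1 : hilbert_fun [set` I1] h1.
Proof.
have [_ _ [sg /socle_degree_uniq/(_ gorenstein_top1) -> h1P]] := compI1 => i.
exact: hilbert_ps.
Qed.

Lemma order_sub_sum : order t.+1 `<=` add_set [set` I1] [set` I2].
Proof.
apply: (order_sub_add sI1 sI2 _ compressed_top compressed_hilbert
  gorenstein_hilbert1 gorenstein_hilbert2) => //.
- by apply/seteqP; split=> f /IE.
- lia.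
- exact: gorenstein_order.
- by move=> i it; have [-> ->] := low_hilbert it.
(* From degree [t + 1] on, [at2] keeps [hQ (s1 - i) + hQ (s - i)] below [hQ i], so all three minima
   are attained at the other argument and the functions add up. *)
move=> i /andP[ti id]; rewrite /h /h1 /h2 hQ_nat !hQ_sub.
have b0 : (i <= s)%N by lia.
have b1 : ('C(t.+1 + 2, 2) <= 'C(i + 2, 2))%N by apply: leq_bin2l; lia.
have b2 : ('C(s - i + 2, 2) <= 'C(t + 2, 2))%N by apply: leq_bin2l; lia.
have b3 : ('C(s1 - i + 2, 2) <= 'C(a + 2, 2))%N by apply: leq_bin2l; rewrite /a; lia.
move: b1; rewrite b0 (_ : (t.+1 + 2 = (t + 2).+1)%N) // binS bin1 => b1.
by case: ifP => _; lia.
Qed.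

Lemma koszul_products :
  [/\ forall u v, dot x u \in I -> dot x v \in I ->
        exists p, forall i, cross u v i - x i * p \in I,
      forall u v, dot x u \in I -> (forall i, cross x v i \in I) ->
        exists2 z, order s z & dot u v - z \in I
    & exists u v, [/\ dot x u \in I, forall i, cross x v i \in I & dot u v \notin I]].
Proof.
have [phi phiP] := dual_functional compressed_top2 gorenstein_type2.
have It := compressed_order.
have dual (lam : {linear Q -> k^o}) : (forall f, order t.+1 f -> lam f = 0) ->
    exists2 p, p \in I1 & forall u, phi (p * u) = lam u.
  move=> lam0.
  have top2 : order (t.+1 + t.+1) `<=` [set` I2].
    by move=> f fo; apply: compressed_top2; apply: ps_orderW fo; lia.
  (* The value of [h2] at [2 t + 1 - i] is [hQ i]: the symmetry that [perfect_pairing] requires for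
     [n = t + 1]. *)
  have sym i : (i < t.+1)%N -> h2 (t.+1 + t.+1 - i.+1)%N = 'C(i + 2, 2).
    move=> it; rewrite /h2 hQ_nat hQ_sub.
    have le : ('C(i + 2, 2) <= 'C(t.+1 + t.+1 - i.+1 + 2, 2))%N by apply: leq_bin2l; lia.
    rewrite (_ : (_ <= s)%N = true); last lia.
    by rewrite (_ : (s - _ = i)%N); lia.
  have [p po pP] := perfect_pairing top2 gorenstein_order gorenstein_hilbert2 sym phiP lam0.
  have [q [r [qI1 rI2 pE]]] := order_sub_sum po.
  exists q => // u; rewrite -pP pE mulrDl linearD /=.
  by rewrite (proj1 (phiP r) rI2) addr0.
have hinit : (h t.+1 < 'C(t.+1 + 2, 2))%N.
  rewrite hilbert_initial (_ : (t.+1 + 2 = (t + 2).+1)%N) // binS bin1; lia.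
have nd : (t.+1 < s.+1)%N by lia.
have [f fI fo] := exists_initial sI compressed_top compressed_hilbert nd It hinit.
have top1 : order s1.+1 `<=` [set` I1] by have [_] := socle_degree_ps gorenstein_top1.
have principal : s1 = t.*2 /\ t = 2%N ->
    forall g, g \in I -> exists c : k, order t.+2 (g - c *: f).
  move=> [s1E tE]; apply: (initial_principal sI compressed_top compressed_hilbert nd It) => //.
  (* Here [a = 1], and the Hilbert function has value 9 in degree 3, one less than ['C(5, 2)]. *)
  by rewrite hilbert_initial /a s1E tE.
split; last exact: (nonzero_product IE phiP dual fI (It _ fI) fo).
- move=> u v uI vI.
  (* [high_cycle_boundary] asks for entries of order [2 t] lying in [I1], for which order [s1 + 1]
     is enough. Order [2 t] covers both unless [s1 = 2 t], where the single leading form provides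
     order [2 t + 1]. *)
  have [p [q hpq]] : exists p q, forall i,
      let c := cross (fun i => u i - cross x p i) (fun i => v i - cross x q i) i in
      order t.*2 c /\ order s1.+1 c.
    case: socle_degrees_lt => [lt|e].
      have [p pP] := cycle1_order It uI; have [q qP] := cycle1_order It vI.
      exists p, q => i /=; have co := cross_order pP qP i.
      by split; apply: ps_orderW co; lia.
    have [p [q pqP]] := cross_principal_order It fI (principal e) (ltn0Sn t) uI vI.
    by have [? ?] := e; exists p, q => i /=; split; apply: ps_orderW (pqP i) => /=; lia.
  have [b bP] := cross_boundary p q uI vI.
  set w := cross _ _ in hpq; have wE i : cross u v i - w i - x i * b \in I := bP i.
  have [|i|i|i|p' p'P] := high_cycle_boundary IE phiP dual t2 (w := w).
  - by move=> g go; apply: compressed_top2.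
  - by apply: top1; case: (hpq i).
  - by case: (hpq i).
  - rewrite cross_anti rpredN /w cross_crossl !(dotC _ x) !dotBr !dot_cross0 !subr0.
    by rewrite rpredB // idealMr.
  exists (b + p') => i.
  have -> : cross u v i - x i * (b + p') = (cross u v i - w i - x i * b) + (w i - x i * p').
    by ring.
  exact: rpredD.
- move=> u v uI vI.
  (* Order [2 t] is one short of [s]. If [s1 < 2 t], the socle has no layer in degree [2 t], so the
     product, a socle element, moves up to order [s]. In the exceptional case [v] itself gains an
     order. *)
  have [p [q pqo]] : exists p q, order s (dot (fun i => u i - cross x p i) (fun i => v i - x i * q)) \/
     (s1 < t.*2)%N /\ order t.*2 (dot (fun i => u i - cross x p i) (fun i => v i - x i * q)).
    have [p pP] := cycle1_order It uI; exists p.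
    case: socle_degrees_lt => [lt|e].
      have [q qP] := cycle2_order It vI; exists q; right; split=> //.
      by rewrite -addnn; apply: dot_order.
    have [q qP] := cycle2_order_principal It fI fo (principal e) vI; exists q; left.
    by apply: (@ps_orderW _ _ (t + t.+1)); [lia | apply: dot_order].
  have db := dot_boundary p q uI vI.
  case: pqo => [?|[lt zo]]; first by exists (dot (fun i => u i - cross x p i) (fun i => v i - x i * q)).
  set z := dot _ (fun i => v i - _) in db zo.
  have zs : ps_socle I z.
    rewrite -[z](subKr (dot u v)); apply: (subspaceB (subspace_ps_socle I)).
      exact: dot_socle.
    by move=> i; rewrite idealMr.
  have [|||||g go zg] := @socle_jump t.*2 z => //; try lia.
  exists g => //; rewrite -[dot u v](subrK z) -addrA; exact: rpredD.
Qed.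

End NonGolod.

End Compressed.

(** * The Koszul complex in three variables *)

Section KoszulCoordinates.
Variables (k : fieldType) (A : comAlgType k) (t : 'I_3 -> A).
Local Notation K := {ffun {set 'I_3} -> A}.

(** Coding subsets of ['I_3] by three booleans reduces the sums and signs of the Koszul complex to
    finitely many cases. *)
Definition set_bits (a b c : bool) : {set 'I_3} :=
  [set i : 'I_3 | if i == o0 then a else if i == o1 then b else c]%SET.

Lemma set_bitsE a b c : [/\ (o0 \in set_bits a b c) = a, (o1 \in set_bits a b c) = b &
  (o2 \in set_bits a b c) = c].
Proof. by rewrite !inE. Qed.

Lemma in_bits i a b c :
  (i \in set_bits a b c) = if i == o0 then a else if i == o1 then b else c.
Proof. by rewrite inE. Qed.

Lemma set_bits_eta (S : {set 'I_3}) : S = set_bits (o0 \in S) (o1 \in S) (o2 \in S).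
Proof. by apply/finset.setP; apply: all_ord3; rewrite in_bits. Qed.

Lemma sum_set3 (F : {set 'I_3} -> A) :
  \sum_T F T = \sum_(a : bool) \sum_(b : bool) \sum_(c : bool) F (set_bits a b c).
Proof.
rewrite (reindex (fun p : bool * bool * bool => set_bits p.1.1 p.1.2 p.2)) /=.
  by rewrite pair_bigA pair_bigA.
exists (fun S : {set 'I_3} => (o0 \in S, o1 \in S, o2 \in S)) => [[[a b] c] _|S _] /=.
  by have [-> -> ->] := set_bitsE a b c.
by rewrite -set_bits_eta.
Qed.

Lemma card_pairs3 (P : pred ('I_3 * 'I_3)) :
  #|P| = (P (o0, o0) + P (o0, o1) + P (o0, o2) + (P (o1, o0) + P (o1, o1) + P (o1, o2))
    + (P (o2, o0) + P (o2, o1) + P (o2, o2)))%N.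
Proof.
rewrite -sum1_card big_mkcond /=.
rewrite (eq_bigr (fun p => if (p.1, p.2) \in P then 1 else 0)%N) => [|[] //].
rewrite -(pair_bigA _ (fun i j => if (i, j) \in P then 1 else 0)%N) /=.
rewrite !big_ord3; do ![congr addn]; rewrite [_ \in P]/(P _); by case: (P _).
Qed.

Lemma koszul_mulE (u v : K) a b c : koszul_mul u v (set_bits a b c) =
  \sum_(a' : bool) \sum_(b' : bool) \sum_(c' : bool)
    if [&& a' ==> a, b' ==> b & c' ==> c] then
      (-1) ^+ ((b' && a && ~~ a') + ((c' && a && ~~ a') + (c' && b && ~~ b')))%N *
      u (set_bits a' b' c') * v (set_bits (a && ~~ a') (b && ~~ b') (c && ~~ c'))
    else 0.
Proof.
rewrite ffunE big_mkcond sum_set3; apply: eq_bigr => a' _; apply: eq_bigr => b' _.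
apply: eq_bigr => c' _.
have -> : (set_bits a' b' c' \subset set_bits a b c) = [&& a' ==> a, b' ==> b & c' ==> c].
  apply/fintype.subsetP/and3P => [h|[ha hb hc]].
    by split; apply/implyP; [have := h o0 | have := h o1 | have := h o2]; rewrite !in_bits /=; apply.
  by apply: all_ord3; rewrite !in_bits /=; apply/implyP.
have -> : set_bits a b c :\: set_bits a' b' c' =
    set_bits (a && ~~ a') (b && ~~ b') (c && ~~ c').
  by apply/finset.setP; apply: all_ord3; rewrite inE !in_bits /= andbC.
case: ifP => // _; congr (_ ^+ _ * _ * _).
rewrite card_pairs3 /= !in_bits /=.
by case: a; case: a'; case: b; case: b'; case: c; case: c'.
Qed.

Lemma card_ord3 (P : pred 'I_3) : #|P| = (P o0 + P o1 + P o2)%N.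
Proof.
rewrite -sum1_card big_mkcond /= big_ord3.
by do ![congr addn]; rewrite [_ \in P]/(P _); case: (P _).
Qed.

Lemma koszul_dE (u : K) a b c : koszul_d t u (set_bits a b c) =
  (if a then 0 else t o0 * u (set_bits true b c)) +
  (if b then 0 else (-1) ^+ a * t o1 * u (set_bits a true c)) +
  (if c then 0 else (-1) ^+ (a + b)%N * t o2 * u (set_bits a b true)).
Proof.
rewrite ffunE big_mkcond big_ord3 !in_bits /= !card_ord3 /= !in_bits /= !andbF !andbT.
have -> : o0 |: set_bits a b c = set_bits true b c.
  by apply/finset.setP; apply: all_ord3; rewrite !inE.
have -> : o1 |: set_bits a b c = set_bits a true c.
  by apply/finset.setP; apply: all_ord3; rewrite !inE.
have -> : o2 |: set_bits a b c = set_bits a b true.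
  by apply/finset.setP; apply: all_ord3; rewrite !inE.
by case: a; case: b; case: c; rewrite /= ?expr0 ?mul1r.
Qed.

Definition koszul_of_bits (f : bool -> bool -> bool -> A) : K :=
  [ffun S : {set 'I_3} => f (o0 \in S) (o1 \in S) (o2 \in S)].

Lemma koszul_of_bitsE f a b c : koszul_of_bits f (set_bits a b c) = f a b c.
Proof. by rewrite ffunE; have [-> -> ->] := set_bitsE a b c. Qed.

Lemma koszul_bits_eq (u v : K) :
  (forall a b c, u (set_bits a b c) = v (set_bits a b c)) -> u = v.
Proof. by move=> uv; apply/ffunP => S; rewrite (set_bits_eta S). Qed.

Definition koszul1 (v : 'I_3 -> A) : K := koszul_of_bits (fun a b c =>
  match a, b, c with
  | true, false, false => v o0 | false, true, false => v o1
  | false, false, true => v o2 | _, _, _ => 0 end).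

(* The sign makes the product of two elements of degree one the cross product,
   and the product of degrees one and two the dot product. *)
Definition koszul2 (v : 'I_3 -> A) : K := koszul_of_bits (fun a b c =>
  match a, b, c with
  | false, true, true => v o0 | true, false, true => - v o1
  | true, true, false => v o2 | _, _, _ => 0 end).

Definition koszul3 (x : A) : K := koszul_of_bits (fun a b c =>
  match a, b, c with true, true, true => x | _, _, _ => 0 end).

Lemma card_bits a b c : #|set_bits a b c| = (a + b + c)%N.
Proof.
by rewrite -sum1_card big_mkcond big_ord3 !in_bits /=; case: a; case: b; case: c.
Qed.

Lemma koszul_degE p (u : K) :
  koszul_deg p u <-> forall a b c : bool, (a + b + c)%N != p -> u (set_bits a b c) = 0.
Proof.
split=> [h a b c abc|h S]; first by apply: h; rewrite card_bits.
by rewrite (set_bits_eta S) card_bits; apply: h.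
Qed.

Ltac bits := move=> [] [] [].

Lemma koszul_deg1 u : koszul_deg 1 u <-> exists v, u = koszul1 v.
Proof.
split=> [/koszul_degE h|[v ->]]; last first.
  by apply/koszul_degE; bits => // _; rewrite koszul_of_bitsE.
exists (fun i => u (set_bits (i == o0) (i == o1) (i == o2))).
by apply: koszul_bits_eq; bits; rewrite koszul_of_bitsE /= // h.
Qed.

Lemma koszul_deg2 u : koszul_deg 2 u <-> exists v, u = koszul2 v.
Proof.
split=> [/koszul_degE h|[v ->]]; last first.
  by apply/koszul_degE; bits => // _; rewrite koszul_of_bitsE.
exists (fun i => (-1) ^+ (i == o1) * u (set_bits (i != o0) (i != o1) (i != o2))).
by apply: koszul_bits_eq; bits; rewrite koszul_of_bitsE /= ?expr0 ?expr1 ?mul1r ?mulN1r ?opprK // h.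
Qed.

Lemma koszul_deg3 u : koszul_deg 3 u <-> exists x, u = koszul3 x.
Proof.
split=> [/koszul_degE h|[v ->]]; last first.
  by apply/koszul_degE; bits => // _; rewrite koszul_of_bitsE.
exists (u (set_bits true true true)).
by apply: koszul_bits_eq; bits; rewrite koszul_of_bitsE /= // h.
Qed.

Lemma koszul_deg4 p (u : K) : (3 < p)%N -> koszul_deg p u -> u = 0.
Proof.
move=> p4 /koszul_degE h; apply: koszul_bits_eq => a b c; rewrite h ?ffunE //.
by rewrite ltn_eqF //; apply: leq_ltn_trans p4; case: a; case: b; case: c.
Qed.

Lemma koszul_d1 v : koszul_d t (koszul1 v) = 0 <-> dot t v = 0.
Proof.
have E a b c : koszul_d t (koszul1 v) (set_bits a b c) =
    if [|| a, b | c] then 0 else dot t v.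
  rewrite koszul_dE !koszul_of_bitsE dotE; case: a; case: b; case: c;
  by rewrite /= ?expr0 ?mul1r ?mulr0 ?addr0.
split=> [/ffunP/(_ (set_bits false false false))|tv]; first by rewrite E ffunE.
by apply: koszul_bits_eq => a b c; rewrite E tv if_same ffunE.
Qed.

Lemma koszul_d2 v : koszul_d t (koszul2 v) = koszul1 (fun i => - cross t v i).
Proof.
apply: koszul_bits_eq; bits; rewrite koszul_dE !koszul_of_bitsE /cross /=;
by rewrite ?expr0 ?expr1 ?addn0 ?add0n ?expr0 ?expr1; ring.
Qed.

Lemma koszul_d3 x : koszul_d t (koszul3 x) = koszul2 (fun i => t i * x).
Proof.
apply: koszul_bits_eq; bits; rewrite koszul_dE !koszul_of_bitsE /=;
by rewrite ?addn0 ?add0n ?addn1 ?expr0 ?expr1 ?sqrrN ?expr1n; ring.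
Qed.

Lemma koszul_mul11 u v : koszul_mul (koszul1 u) (koszul1 v) = koszul2 (cross u v).
Proof.
apply: koszul_bits_eq; bits; rewrite koszul_mulE !big_bool !koszul_of_bitsE /= /cross /=;
by rewrite ?addn0 ?add0n ?addn1 ?expr0 ?expr1; ring.
Qed.

Lemma koszul_mul12 u v : koszul_mul (koszul1 u) (koszul2 v) = koszul3 (dot u v).
Proof.
apply: koszul_bits_eq; bits; rewrite koszul_mulE !big_bool !koszul_of_bitsE /= ?dotE /=;
by rewrite ?addn0 ?add0n ?addn1 ?expr0 ?expr1 ?sqrrN ?expr1n; ring.
Qed.

Lemma koszul_mul21 u v : koszul_mul (koszul2 v) (koszul1 u) = koszul3 (dot u v).
Proof.
apply: koszul_bits_eq; bits; rewrite koszul_mulE !big_bool !koszul_of_bitsE /= ?dotE /=;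
by rewrite ?addn0 ?add0n ?addn1 ?expr0 ?expr1 ?sqrrN ?expr1n; ring.
Qed.

Lemma koszul_mul_top p q (u v : K) : (3 < p + q)%N -> koszul_deg p u -> koszul_deg q v ->
  koszul_mul u v = 0.
Proof.
move=> pq up vq; apply/ffunP => S; rewrite !ffunE; apply: big1 => T TS.
case: (eqVneq #|T| p) => [Tp|/up ->]; last by rewrite mulr0 mul0r.
case: (eqVneq #|S :\: T| q) => [Dq|/vq ->]; last by rewrite mulr0.
have := cardsID T S; rewrite (finset.setIidPr TS) Tp Dq => pqS.
by have := max_card (mem S); rewrite card_ord -pqS leqNgt pq.
Qed.

Lemma cycle1P u : koszul_cycle t 1 u <-> exists2 v, u = koszul1 v & dot t v = 0.
Proof.
split=> [[/koszul_deg1[v ->] /koszul_d1 h]|[v -> h]]; first by exists v.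
by split; [apply/koszul_deg1; exists v | apply/koszul_d1].
Qed.

Lemma koszul1_inj u v : koszul1 u = koszul1 v -> u =1 v.
Proof.
move=> /ffunP uv; apply: all_ord3.
- by have := uv (set_bits true false false); rewrite !koszul_of_bitsE.
- by have := uv (set_bits false true false); rewrite !koszul_of_bitsE.
- by have := uv (set_bits false false true); rewrite !koszul_of_bitsE.
Qed.

Lemma koszul2_inj u v : koszul2 u = koszul2 v -> u =1 v.
Proof.
move=> /ffunP uv; apply: all_ord3.
- by have := uv (set_bits false true true); rewrite !koszul_of_bitsE.
- by have := uv (set_bits true false true); rewrite !koszul_of_bitsE => /oppr_inj.
- by have := uv (set_bits true true false); rewrite !koszul_of_bitsE.
Qed.

Lemma koszul3_inj : injective koszul3.
Proof.
by move=> x y /ffunP/(_ (set_bits true true true)); rewrite !koszul_of_bitsE.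
Qed.

Lemma koszul10 : koszul1 (fun=> 0) = 0.
Proof. by apply: koszul_bits_eq; bits; rewrite koszul_of_bitsE ffunE. Qed.

Lemma koszul20 : koszul2 (fun=> 0) = 0.
Proof. by apply: koszul_bits_eq; bits; rewrite koszul_of_bitsE ffunE //= oppr0. Qed.

Lemma koszul30 : koszul3 0 = 0.
Proof. by apply: koszul_bits_eq; bits; rewrite koszul_of_bitsE ffunE. Qed.

Lemma koszul1_ext u v : u =1 v -> koszul1 u = koszul1 v.
Proof. by move=> /funext ->. Qed.

Lemma koszul2_ext u v : u =1 v -> koszul2 u = koszul2 v.
Proof. by move=> /funext ->. Qed.

Lemma cycle2P u : koszul_cycle t 2 u <-> exists2 v, u = koszul2 v & cross t v =1 fun=> 0.
Proof.
split=> [[/koszul_deg2[v ->]]|[v -> h]].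
  rewrite koszul_d2 -koszul10 => /koszul1_inj h; exists v => // i.
  by apply/eqP; rewrite -oppr_eq0; apply/eqP; apply: h.
split; first by apply/koszul_deg2; exists v.
by rewrite koszul_d2 -koszul10; apply: koszul1_ext => i; rewrite h oppr0.
Qed.

Lemma cycle3P u : koszul_cycle t 3 u <-> exists2 x, u = koszul3 x & forall i, t i * x = 0.
Proof.
split=> [[/koszul_deg3[x ->]]|[x -> h]].
  by rewrite koszul_d3 -koszul20 => /koszul2_inj h; exists x.
split; first by apply/koszul_deg3; exists x.
by rewrite koszul_d3 -koszul20; apply: koszul2_ext.
Qed.

Lemma boundary1P u : koszul_boundary t 1 u <-> exists v, u = koszul1 (cross t v).
Proof.
split=> [[w /koszul_deg2[v ->] ->]|[v ->]].
  exists (fun i => - v i); rewrite koszul_d2; apply: koszul1_ext.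
  by apply: all_ord3; rewrite /cross /=; ring.
exists (koszul2 (fun i => - v i)); first by apply/koszul_deg2; exists (fun i => - v i).
by rewrite koszul_d2; apply: koszul1_ext; apply: all_ord3; rewrite /cross /=; ring.
Qed.

Lemma boundary2P u : koszul_boundary t 2 u <-> exists x, u = koszul2 (fun i => t i * x).
Proof.
split=> [[w /koszul_deg3[x ->] ->]|[x ->]]; first by exists x; rewrite koszul_d3.
by exists (koszul3 x); rewrite ?koszul_d3 //; apply/koszul_deg3; exists x.
Qed.

Lemma boundary3P u : koszul_boundary t 3 u <-> u = 0.
Proof.
have d0 : koszul_d t 0 = 0.
  apply/ffunP => S; rewrite !ffunE; apply: big1 => i _.
  by rewrite ffunE mulr0.
split=> [[w /(@koszul_deg4 4 _ isT) -> ->]//|->].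
by exists 0 => // S _; rewrite ffunE.
Qed.

End KoszulCoordinates.

(** * Ranks of Koszul homology *)

Section KoszulRanks.
Variables (k : fieldType) (A : comAlgType k) (t : 'I_3 -> A).
Local Notation K := {ffun {set 'I_3} -> A}.
Local Notation V := (A * A * A)%type.

(** Triples form a module whose rank [rank_prod] computes from that of [A]; on them the three
    differentials are the linear maps [dmap], [cmap] (up to sign) and [smap]. *)
Definition vec (p : V) (i : 'I_3) : A :=
  if i == o0 then p.1.1 else if i == o1 then p.1.2 else p.2.

Definition unvec (v : 'I_3 -> A) : V := (v o0, v o1, v o2).

Lemma unvecK v : vec (unvec v) = v.
Proof. by apply/funext; apply: all_ord3. Qed.

Lemma vecP a (p q : V) i : vec (a *: p + q) i = a *: vec p i + vec q i.
Proof. by case: p q => [[? ?] ?] [[? ?] ?]; move: i; apply: all_ord3. Qed.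

Lemma vec0 i : vec 0 i = 0.
Proof. by move: i; apply: all_ord3. Qed.

Lemma vec_inj : injective vec.
Proof. by case=> [[a b] c] [[a' b'] c'] /(congr1 unvec). Qed.

Lemma vec_unvec_linear (F : ('I_3 -> A) -> 'I_3 -> A) :
  (forall a p q i, F (vec (a *: p + q)) i = a *: F (vec p) i + F (vec q) i) ->
  linear (fun p => unvec (F (vec p))).
Proof.
by move=> FP a p q; apply: vec_inj; apply/funext => i; rewrite vecP !unvecK FP.
Qed.

Lemma dot_linearr (u : 'I_3 -> A) : linear (fun p => dot u (vec p)).
Proof.
move=> a p q; rewrite !dotE !vecP !mulrDr -!scalerAr !scalerDr.
by rewrite [RHS]addrACA; congr (_ + _); rewrite addrACA.
Qed.

Lemma cross_linearr (u : 'I_3 -> A) : linear (fun p => unvec (cross u (vec p))).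
Proof.
apply: vec_unvec_linear => a p q; apply: all_ord3;
by rewrite /cross !vecP !mulrDr -!scalerAr !opprD ![_ + _ + (- _ - _)]addrACA -!scalerBr.
Qed.

Lemma scale_linear : linear (fun x => unvec (fun i => t i * x)).
Proof.
move=> a x y; apply: vec_inj; apply/funext => i.
by rewrite vecP !unvecK mulrDr scalerAr.
Qed.

Lemma koszul1_linear : linear (fun p => koszul1 (vec p)).
Proof.
move=> a p q; apply: koszul_bits_eq => b c d.
rewrite [RHS]ffunE [X in _ = X + _]ffunE !koszul_of_bitsE !vecP.
by case: b; case: c; case: d; rewrite ?scaler0 ?addr0.
Qed.

Lemma koszul2_linear : linear (fun p => koszul2 (vec p)).
Proof.
move=> a p q; apply: koszul_bits_eq => b c d.
rewrite [RHS]ffunE [X in _ = X + _]ffunE !koszul_of_bitsE !vecP.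
by case: b; case: c; case: d; rewrite ?scaler0 ?addr0 // scalerN opprD.
Qed.

Lemma koszul3_linear : linear (@koszul3 k A).
Proof.
move=> a x y; apply: koszul_bits_eq => b c d.
rewrite [RHS]ffunE [X in _ = X + _]ffunE !koszul_of_bitsE.
by case: b; case: c; case: d; rewrite ?scaler0 ?addr0.
Qed.

Definition dmap : {linear V -> A} :=
  HB.pack_for {linear V -> A} (fun p : V => dot t (vec p))
    (GRing.isLinear.Build k V A _ _ (dot_linearr t)).
Definition cmap : {linear V -> V} :=
  HB.pack_for {linear V -> V} (fun p : V => unvec (cross t (vec p)))
    (GRing.isLinear.Build k V V _ _ (cross_linearr t)).
Definition smap : {linear A -> V} :=
  HB.pack_for {linear A -> V} (fun x : A => unvec (fun i => t i * x))
    (GRing.isLinear.Build k A V _ _ scale_linear).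
Definition kmap1 : {linear V -> K} :=
  HB.pack_for {linear V -> K} (fun p : V => koszul1 (vec p))
    (GRing.isLinear.Build k V K _ _ koszul1_linear).
Definition kmap2 : {linear V -> K} :=
  HB.pack_for {linear V -> K} (fun p : V => koszul2 (vec p))
    (GRing.isLinear.Build k V K _ _ koszul2_linear).
Definition kmap3 : {linear A -> K} :=
  HB.pack_for {linear A -> K} (@koszul3 k A)
    (GRing.isLinear.Build k A K _ _ koszul3_linear).

Definition Z1 : set V := dmap @^-1` [set 0].
Definition Z2 : set V := cmap @^-1` [set 0].
Definition B1 : set V := range cmap.
Definition B2 : set V := range smap.

Lemma basis_mod_image (X Y : lmodType k) (f : {linear X -> Y}) (U W : set X)
    (U' W' : set Y) l (b : 'I_l -> X) :
  subspace U -> subspace W -> subspace W' ->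
  (forall x, U x -> U' (f x)) -> (forall y, U' y -> exists2 x, U x & y = f x) ->
  (forall x, W' (f x) <-> W x) -> basis_mod U W b -> basis_mod U' W' (f \o b).
Proof.
move=> sU sW sW' Uf fU Wf bP; have [Ub bex] := bP.
have fs (c : 'rV[k]_l) : \sum_j c 0 j *: (f \o b) j = f (\sum_j c 0 j *: b j).
  by rewrite linear_sum; apply: eq_bigr => j _; rewrite linearZ.
apply: basis_mod_intro => // [j|c|y /fU[x /bex[c [Wx _]] ->]]; first exact: Uf.
  by rewrite fs => /Wf; apply: basis_mod_free bP.
by exists c; rewrite fs -linearB; apply/Wf.
Qed.

Lemma Z1E v : Z1 (unvec v) <-> dot t v = 0.
Proof. by rewrite /Z1 /preimage /= unvecK. Qed.

Lemma Z2E v : Z2 (unvec v) <-> cross t v =1 fun=> 0.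
Proof.
rewrite /Z2 /preimage /= unvecK; split=> [h i|h].
  by have := congr1 (fun p => vec p i) h; rewrite unvecK vec0.
by apply: vec_inj; apply/funext => i; rewrite unvecK vec0 h.
Qed.

Lemma unvec_vec p : unvec (vec p) = p. Proof. by case: p => [[]]. Qed.

Lemma B1_sub : B1 `<=` Z1.
Proof. by move=> _ [p _ <-]; apply/Z1E/dot_cross0. Qed.

Lemma B2_sub : B2 `<=` Z2.
Proof. by move=> _ [x _ <-]; apply/Z2E => i; apply: cross_scale0. Qed.

Lemma koszul_rank1 l (b : 'I_l -> V) : basis_mod Z1 B1 b -> koszul_basis t 1 (kmap1 \o b).
Proof.
apply: basis_mod_image.
- exact/subspace_preim/subspace_set0.
- exact/subspace_image/subspace_setT.
- split; first by apply/boundary1P; exists (fun=> 0);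
    rewrite -[LHS](@koszul10 k A); apply: koszul1_ext => i; rewrite -[LHS](cross_scale0 t 0 i);
    congr (cross _ _ _); apply/funext => j; rewrite mulr0.
  move=> a u v /boundary1P[p ->] /boundary1P[q ->]; apply/boundary1P.
  exists (vec (a *: unvec p + unvec q)).
  have := cross_linearr t a (unvec p) (unvec q) => /(congr1 kmap1); rewrite linearP /= !unvecK => <-.
  by [].
- move=> p; rewrite -{1}[p]unvec_vec => /Z1E h; apply/cycle1P; by exists (vec p).
- move=> u /cycle1P[v -> h]; exists (unvec v); first exact/Z1E.
  by rewrite /= unvecK.
- move=> p; split=> [/boundary1P[v /koszul1_inj/funext pv]|[q _ <-]].
    by exists (unvec v) => //=; rewrite unvecK -pv unvec_vec.
  by apply/boundary1P; exists (vec q); rewrite /= unvecK.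
Qed.

Lemma koszul_rank2 l (b : 'I_l -> V) : basis_mod Z2 B2 b -> koszul_basis t 2 (kmap2 \o b).
Proof.
apply: basis_mod_image.
- exact/subspace_preim/subspace_set0.
- exact/subspace_image/subspace_setT.
- split; first by apply/boundary2P; exists 0;
    rewrite -[LHS](@koszul20 k A); apply: koszul2_ext => i; rewrite mulr0.
  move=> a u v /boundary2P[x ->] /boundary2P[y ->]; apply/boundary2P.
  exists (a *: x + y).
  have := scale_linear a x y => /(congr1 kmap2); rewrite linearP /= !unvecK => <-.
  by [].
- move=> p; rewrite -{1}[p]unvec_vec => /Z2E h; apply/cycle2P; by exists (vec p).
- move=> u /cycle2P[v -> h]; exists (unvec v); first exact/Z2E.
  by rewrite /= unvecK.
- move=> p; split=> [/boundary2P[x /koszul2_inj/funext px]|[x _ <-]].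
    by exists x => //=; rewrite -px unvec_vec.
  by apply/boundary2P; exists x; rewrite /= unvecK.
Qed.

Definition ksocle : set A := [set x | forall i, t i * x = 0].

Lemma subspace_ksocle : subspace ksocle.
Proof.
split=> [i|a u v us vs i]; first by rewrite mulr0.
by rewrite mulrDr -scalerAr us vs scaler0 addr0.
Qed.

Lemma koszul_rank3 l (b : 'I_l -> A) :
  basis_mod ksocle [set 0] b -> koszul_basis t 3 (kmap3 \o b).
Proof.
apply: basis_mod_image.
- exact: subspace_ksocle.
- exact: subspace_set0.
- split=> [|a u v /boundary3P -> /boundary3P ->]; apply/boundary3P => //.
  by rewrite scaler0 addr0.
- by move=> x xs; apply/cycle3P; exists x.
- by move=> u /cycle3P[x -> h]; exists x.
- move=> x; split=> [/boundary3P h|->]; last by rewrite linear0; apply/boundary3P.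
  by apply: (@koszul3_inj k A); rewrite koszul30.
Qed.

(* The Euler characteristic of the Koszul complex on a finite-dimensional algebra is 0. *)
Lemma koszul_homology_ranks D : has_rank [set: A] [set 0] D ->
  has_rank [set: A] (range dmap) 1 -> has_rank ksocle [set 0] 2 ->
  exists m, has_rank Z1 B1 m /\ has_rank Z2 B2 m.+1.
Proof.
move=> RD R1 R2.
have sA := subspace_setT A; have sV := subspace_setT V.
have s0A := subspace_set0 A; have s0V := subspace_set0 V.
have VD : has_rank [set: V] [set 0] (D + D + D)%N by do 2?[apply: rank_prod].
have sZ1 : subspace Z1 by apply: subspace_preim.
have sZ2 : subspace Z2 by apply: subspace_preim.
have sB1 : subspace B1 by apply: subspace_image.
have sB2 : subspace B2 by apply: subspace_image.
have sM : subspace (range dmap) by apply: subspace_image.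
have Z (X : lmodType k) (U : set X) : subspace U -> [set 0] `<=` U.
  by move=> sU _ ->; apply: subspace0.
have uniq0 (X : lmodType k) (U : set X) a b : subspace U ->
    has_rank U [set 0] a -> has_rank U [set 0] b -> a = b.
  by move=> sU; apply: rank_uniq => //; [apply: subspace_set0 | apply: Z].
have [_ [z1 [Z1r _ _]]] := rank_sub sV sZ1 (@subsetT _ _) VD.
have [_ [z2 [Z2r _ _]]] := rank_sub sV sZ2 (@subsetT _ _) VD.
have [lm [mr [Mr Rlm DE]]] := rank_sub sA sM (@subsetT _ _) RD.
have lm1 : lm = 1%N := rank_uniq sA sM (@subsetT _ _) Rlm R1.
have [|r1 r1E /uniq0/(_ Mr) r1m] := rank_image (f := dmap) sV VD (b := z1).
  by rewrite setTI.
have [|r2 r2E B1r] := rank_image (f := cmap) sV VD (b := z2).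
  by rewrite setTI.
have [|r3 r3E B2r] := rank_image (f := smap) sA RD (b := 2).
  rewrite setTI; suff <- : ksocle = smap @^-1` [set 0] by [].
  apply/seteqP; split=> x h.
    by apply: vec_inj; apply/funext => i; rewrite vec0 /= unvecK h.
  by move=> i; have := congr1 (fun p => vec p i) h; rewrite vec0 /= unvecK.
have [h1 [b1 [B1r' H1 z1E]]] := rank_sub sZ1 sB1 B1_sub Z1r.
have [h2 [b2 [B2r' H2 z2E]]] := rank_sub sZ2 sB2 B2_sub Z2r.
have b1E := uniq0 _ _ _ _ sB1 B1r' B1r; have b2E := uniq0 _ _ _ _ sB2 B2r' B2r.
exists h1; split=> //; have <- // : h2 = h1.+1.
(* Homology has rank 1 in degree zero and 2 in degree three; eliminating the other ranks of cycles
   and boundaries leaves [h1 = z2 - D + 1] and [h2 = z2 - D + 2]. *)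
have := r1m sM; lia.
Qed.

End KoszulRanks.

(** * Class G from products lying in a line *)

Section ClassG.
Variables (k : fieldType) (A : comAlgType k) (t : 'I_3 -> A).
Local Notation V := (A * A * A)%type.

Lemma dot_sum m n (P : 'I_m -> k) (N : 'I_n -> k) (p : 'I_m -> V) (q : 'I_n -> V) :
  dot (vec (\sum_i P i *: p i)) (vec (\sum_j N j *: q j)) =
  \sum_i \sum_j (P i * N j) *: dot (vec (p i)) (vec (q j)).
Proof.
have dots (w : 'I_3 -> A) l (c : 'I_l -> k) (b : 'I_l -> V) :
    dot w (vec (\sum_i c i *: b i)) = \sum_i c i *: dot w (vec (b i)).
  rewrite -[LHS]/(dmap w _) linear_sum; apply: eq_bigr => i _.
  by rewrite linearZ.
rewrite dotC dots; apply: eq_bigr => i _; rewrite dotC dots scaler_sumr.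
by apply: eq_bigr => j _; rewrite scalerA.
Qed.

Lemma class_G_of_products D (g : A) :
  has_rank [set: A] [set 0] D ->
  has_rank [set: A] [set a | exists v, a = dot t v] 1 ->
  has_rank (ksocle t) [set 0] 2 ->
  ksocle t g -> g <> 0 ->
  (forall u v, dot t u = 0 -> dot t v = 0 -> exists p, forall i, cross u v i = t i * p) ->
  (forall u v, dot t u = 0 -> cross t v =1 (fun=> 0) -> exists c : k, dot u v = c *: g) ->
  (exists u v, [/\ dot t u = 0, cross t v =1 (fun=> 0) & dot u v <> 0]) ->
  exists2 r, (1 <= r)%N & class_G t r.
Proof.
move=> RD R1 R2 sg g0 mul11 mul12 [u [v [uZ vZ uv0]]].
have mE : [set a | exists v, a = dot t v] = range (dmap t).
  apply/seteqP; split=> [_ [w ->]|_ [p _ <-]]; last by exists (vec p).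
  by exists (unvec w); rewrite //= unvecK.
rewrite mE in R1.
have [m [[e0 e0P] [f0 f0P]]] := koszul_homology_ranks RD R1 R2.
have sZ1 : subspace (Z1 t) by exact/subspace_preim/subspace_set0.
have sZ2 : subspace (Z2 t) by exact/subspace_preim/subspace_set0.
have sB1 : subspace (B1 t) by exact/subspace_image/subspace_setT.
have sB2 : subspace (B2 t) by exact/subspace_image/subspace_setT.
have Z1v p : Z1 t p -> dot t (vec p) = 0 by [].
have Z2v p : Z2 t p -> cross t (vec p) =1 (fun=> 0) by rewrite -{1}[p]unvec_vec => /Z2E.
have [Ze0 e0ex] := e0P; have [Zf0 f0ex] := f0P.
have /choice[M0 M0P] (ij : 'I_m * 'I_m.+1) :
    exists c : k, dot (vec (e0 ij.1)) (vec (f0 ij.2)) = c *: g.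
  by apply: mul12; [apply: Z1v | apply: Z2v].
pose M : 'M[k]_(m, m.+1) := \matrix_(i, j) M0 (i, j).
have MP i j : dot (vec (e0 i)) (vec (f0 j)) = M i j *: g by rewrite mxE -(M0P (i, j)).
(* The outer factors of the rank normal form of [M] are absorbed into the bases of degrees one and
   two; the pairing becomes diagonal and [r] is the rank of [M]. *)
pose P := invmx (col_ebase M); pose N := (invmx (row_ebase M))^T.
have uP : P \in unitmx by rewrite unitmx_inv col_ebase_unit.
have uN : N \in unitmx by rewrite unitmx_tr unitmx_inv row_ebase_unit.
have PMN : P *m M *m N^T = pid_mx (\rank M).
  rewrite /N trmxK -[X in _ *m X *m _]mulmx_ebase !mulmxA /P.
  by rewrite mulVmx ?col_ebase_unit // mul1mx mulmxK ?row_ebase_unit.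
pose e i := \sum_j P i j *: e0 j; pose f i := \sum_j N i j *: f0 j.
have eP : basis_mod (Z1 t) (B1 t) e by apply: basis_mod_change.
have fP : basis_mod (Z2 t) (B2 t) f by apply: basis_mod_change.
have [gb gbP gb0] := basis_mod_first (subspace_ksocle t) sg g0 R2.
have efE i j : dot (vec (e i)) (vec (f j)) = (P *m M *m N^T) i j *: g.
  rewrite dot_sum mxE scaler_suml exchange_big; apply: eq_bigr => l _.
  rewrite [(P *m M) _ _]mxE mulr_suml scaler_suml; apply: eq_bigr => a _.
  by rewrite MP scalerA [N^T _ _]mxE mulrAC.
exists (\rank M).
  (* If [M] were zero, [u] and [v] would be boundaries plus basis combinations with zero product. A
     boundary times a cycle is a boundary, hence zero in degree three, and [dot u v] would
     vanish. *)
  rewrite lt0n mxrank_eq0; apply/eqP => M0'; apply: uv0.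
  have [c [[a _ ac] _]] := e0ex (unvec u) ((Z1E _ _).2 uZ).
  have [d [[b _ bd] _]] := f0ex (unvec v) ((Z2E _ _).2 vZ).
  pose e1 := \sum_j c 0 j *: e0 j; pose f1 := \sum_j d 0 j *: f0 j.
  have uE i : u i = cross t (vec a) i + vec e1 i.
    have : unvec u = 1 *: cmap t a + e1 by rewrite scale1r ac subrK.
    by move=> /(congr1 (fun p => vec p i)); rewrite vecP scale1r /= !unvecK.
  have vE i : v i = t i * b + vec f1 i.
    have : unvec v = 1 *: smap t b + f1 by rewrite scale1r bd subrK.
    by move=> /(congr1 (fun p => vec p i)); rewrite vecP scale1r /= !unvecK.
  have ef0 : dot (vec e1) (vec f1) = 0.
    rewrite dot_sum big1 // => i _; rewrite big1 // => j _.
    by rewrite MP M0' mxE scale0r scaler0.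
  have e1Z : dot t (vec e1) = 0.
    by apply: Z1v; apply: subspace_comb => // j.
  have -> : dot u v = dot (cross t (vec a)) v + (dot (vec e1) t * b + dot (vec e1) (vec f1)).
    by rewrite !dotE !uE !vE; ring.
  rewrite ef0 (dotC (vec e1)) e1Z mul0r !addr0 dot_crossl (funext vZ).
  by rewrite /dot big1 ?oppr0 // => i _; rewrite mulr0.
exists m, (kmap1 A \o e), (kmap2 A \o f), (kmap3 A \o gb); split.
- exact: koszul_rank1.
- exact: koszul_rank2.
- exact: koszul_rank3.
- exact: rank_leq_row.
have [eZ _] := eP.
split=> [i j|i j] /=.
  rewrite koszul_mul11; have [p pE] := mul11 _ _ (Z1v _ (eZ i)) (Z1v _ (eZ j)).
  by apply/boundary2P; exists p; apply: koszul2_ext.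
apply/boundary3P; rewrite koszul_mul12 efE PMN mxE gb0.
by case: ifP => _; rewrite ?scale1r ?subrr // scale0r koszul30 subr0.
Qed.

End ClassG.

(** * Lifting Koszul cycles from the quotient to [Q] *)

Section QuotientKoszul.
Variables (k : fieldType) (I : idealr (powser 3 k)).
Local Notation Q := (powser 3 k).
Local Notation R := {ideal_quot I}.
Local Notation order := (@ps_order 3 k).
Local Notation x := (@ps_var 3 k).
Local Notation t := (quot_vars I).

Lemma vector_lift (u : 'I_3 -> R) : exists U : 'I_3 -> Q, u = (fun i => qpi I (U i)).
Proof.
have /choice[U UP] i : exists f, qpi I f = u i := qpi_surj (u i).
by exists U; apply/funext => i; rewrite UP.
Qed.

Lemma qpi_dot (U W : 'I_3 -> Q) :
  dot (fun i => qpi I (U i)) (fun i => qpi I (W i)) = qpi I (dot U W).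
Proof. by rewrite !dotE !rmorphD !rmorphM. Qed.

Lemma qpi_cross (U W : 'I_3 -> Q) i :
  cross (fun i => qpi I (U i)) (fun i => qpi I (W i)) i = qpi I (cross U W i).
Proof. by move: i; apply: all_ord3; rewrite /cross /= rmorphB !rmorphM. Qed.

Lemma lift_cycle1 (U : 'I_3 -> Q) : dot t (fun i => qpi I (U i)) = 0 <-> dot x U \in I.
Proof. by rewrite -qpi_eq0 -qpi_dot. Qed.

Lemma lift_cycle2 (U : 'I_3 -> Q) :
  cross t (fun i => qpi I (U i)) =1 (fun=> 0) <-> forall i, cross x U i \in I.
Proof.
by split=> h i; [apply/qpi_eq0; rewrite -qpi_cross; apply: h
  | rewrite (qpi_cross x); apply/qpi_eq0].
Qed.

Lemma golod_of_order n : [set` I] `<=` order n.+1 -> order (n + n) `<=` [set` I] ->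
  class_H00 t.
Proof.
move=> In nI.
have H12 u v : dot t u = 0 -> cross t v =1 (fun=> 0) -> dot u v = 0.
  have [U ->] := vector_lift u; have [W ->] := vector_lift v.
  move=> /lift_cycle1 uI /lift_cycle2 vI; rewrite qpi_dot; apply/qpi_eq0.
  have [p pP] := cycle1_order In uI; have [q qP] := cycle2_order In vI.
  rewrite -[dot U W](subrK (dot (fun i => U i - cross x p i) (fun i => W i - x i * q))).
  by rewrite rpredD ?dot_boundary //; apply: nI; apply: dot_order.
have H11 u v : dot t u = 0 -> dot t v = 0 -> exists p, forall i, cross u v i = t i * p.
  have [U ->] := vector_lift u; have [W ->] := vector_lift v.
  move=> /lift_cycle1 uI /lift_cycle1 vI.
  have [p pP] := cycle1_order In uI; have [q qP] := cycle1_order In vI.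
  have [a aP] := cross_boundary p q uI vI; exists (qpi I a) => i.
  rewrite qpi_cross quot_varsE -rmorphM; apply/qpi_eq.
  have := aP i; rewrite addrAC => h; have := nI _ (cross_order pP qP i) => h'.
  by have := rpredD h h'; rewrite subrK.
have b3 u v : dot t u = 0 -> cross t v =1 (fun=> 0) ->
    koszul_boundary t 3 (koszul3 (dot u v)).
  by move=> uZ vZ; apply/boundary3P; rewrite H12 // koszul30.
move=> p q u v p0 q0 up vq.
have [pq|pq] := ltnP 3 (p + q).
  rewrite (koszul_mul_top pq up.1 vq.1); exists 0; first by move=> S _; rewrite ffunE.
  apply/ffunP => S; rewrite !ffunE big1 // => i _.
  by rewrite ffunE mulr0.
case: p q p0 q0 pq up vq => [|[|[|p]]] [|[|[|q]]] // _ _ pq; try lia.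
- move=> /cycle1P[a -> aZ] /cycle1P[b -> bZ]; rewrite koszul_mul11.
  by apply/boundary2P; have [c cE] := H11 _ _ aZ bZ; exists c; apply: koszul2_ext.
- by move=> /cycle1P[a -> aZ] /cycle2P[b -> bZ]; rewrite koszul_mul12; apply: b3.
- by move=> /cycle2P[b -> bZ] /cycle1P[a -> aZ]; rewrite koszul_mul21; apply: b3.
Qed.

Lemma quotient_rank d : order d `<=` [set` I] -> exists D, has_rank [set: R] [set 0] D.
Proof.
move=> dI.
pose rho : {linear {ffun 'X_{1..3 < d} -> k^o} -> R} := qpi I \o ps_emb 3 k d.
exists (\dim (vspace_of (rho @^-1` setT)) - \dim (vspace_of (rho @^-1` [set 0%R])))%N.
have sT := subspace_setT R; have s0 := subspace_set0 R.
apply/(@rank_dim _ _ _ rho _ _ _ sT s0 (@subsetT _ _)).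
  move=> u _; have [f <-] := qpi_surj u; exists (ps_cut d f).
  change (qpi I f - qpi I (ps_emb 3 k d (ps_cut d f)) = 0).
  by rewrite -linearB; apply/qpi_eq0/dI; rewrite ps_cutK; apply: ps_lowK.
rewrite subnK //; apply/dimvS/subvP => e.
by move=> _; apply/(vspace_ofP _ (subspace_preim rho sT)).
Qed.

End QuotientKoszul.

(** * Compressed rings of type two *)

Section NumericalBounds.
Variable F : realType.

(** For [x <= 0] the square root is 0 by convention, and both sides are false. *)
Lemma lt_sqrt (x y : F) : 0 <= y -> (y < Num.sqrt x) = (y ^+ 2 < x).
Proof.
move=> y0; have [x0|x0] := lerP x 0.
  by rewrite ler0_sqrtr // !ltNge y0 (le_trans x0) // sqr_ge0.
by rewrite -{1}(ger0_norm y0) -sqrtr_sqr ltr_sqrt.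
Qed.

(** With [s = 2 t + 1] and [s1 = t + 1 + a], clearing the denominator leaves
    [2 a + 3 < sqrt (8 t + 17)], and [(2 a + 3)^2] equals [8 * 'C(a + 2, 2) + 1]. *)
Lemma Nbound_lt (a t : nat) :
  ((t.+1 + a)%:R < Nbound F t.*2.+1) = ('C(a + 2, 2) < t + 2)%N.
Proof.
have -> : ('C(a + 2, 2) < t + 2)%N = ((a.*2 + 3) ^ 2 < 8 * t + 17)%N.
  have := mul2_bin2 a; rewrite -muln2 => aE; apply/idP/idP; nia.
rewrite -(ltr_nat F) natrX -lt_sqrt ?ler0n //.
have E : (4 * t.*2.+1%:R + 13 : F) = (8 * t + 17)%:R.
  by rewrite -!natrM -natrD; congr (_%:R); lia.
rewrite /Nbound E ltr_pdivlMr // -[RHS](ltrD2r (t.*2.+1%:R - 2)).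
congr (_ < _); last by rewrite addrC.
rewrite -[in RHS]addn1 -!muln2 !natrD !natrM; lra.
Qed.

(** For [r = sqrt (8 t + 17)] the bounds amount to [3 < r] and [r < 2 t + 3]; squaring turns the
    second into [2 < t^2 + t], true for [t >= 2]. *)
Lemma Nbound_range (t : nat) : (2 <= t)%N ->
  (t.*2.+1%:R + 1) / 2 < Nbound F t.*2.+1 < t.*2.+1%:R.
Proof.
move=> t2; rewrite /Nbound.
have -> : t.*2.+1%:R = 2 * t%:R + 1 :> F by rewrite -addn1 -muln2 natrD natrM mulrC.
have T2 : (2 : F) <= t%:R by rewrite ler_nat.
set r := Num.sqrt _.
have r0 : 0 <= r by apply: sqrtr_ge0.
have r2 : r ^+ 2 = 4 * (2 * t%:R + 1) + 13 by rewrite sqr_sqrtr //; lra.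
have T4 : (2 : F) * 2 <= t%:R * t%:R by apply: ler_pM.
have r3 : 3 < r by rewrite lt_sqrt // expr2; lra.
have rT : r < 2 * t%:R + 3.
  rewrite ltNge; apply/negP => h; have : (2 * t%:R + 3) ^+ 2 <= r ^+ 2.
    by rewrite ler_pXn2r ?nnegrE //; lra.
  rewrite r2 expr2; lra.
by apply/andP; split; [rewrite ltr_pM2r ?invr_gt0 // | rewrite ltr_pdivrMr //]; lra.
Qed.

End NumericalBounds.

Section CompressedType2.
Variables (k : fieldType) (I I1 I2 : idealr (powser 3 k)) (s1 t : nat).
Local Notation Q := (powser 3 k).
Local Notation order := (@ps_order 3 k).
Local Notation x := (@ps_var 3 k).
Local Notation s := (t.*2.+1).
Hypotheses (compI : compressed_type2 I s1 s) (compI1 : compressed_gorenstein I1).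
Hypotheses (compI2 : compressed_gorenstein I2) (s2 : socle_degree (quot_vars I2) s).
Hypothesis IE : forall f, f \in I <-> f \in I1 /\ f \in I2.
Hypothesis t2 : (2 <= t)%N.

Lemma compressed_golod : (t + 2 <= 'C(s1 - t.+1 + 2, 2))%N -> class_H00 (quot_vars I).
Proof.
move=> ta; apply: (@golod_of_order _ I t.+1).
  exact: (compressed_order_golod compI compI2 s2 IE t2 ta).
by move=> f fo; apply: (compressed_top compI); apply: ps_orderW fo; lia.
Qed.

Lemma compressed_class_G :
  homogeneous_ideal I -> homogeneous_ideal I1 -> homogeneous_ideal I2 ->
  ('C(s1 - t.+1 + 2, 2) < t + 2)%N ->
  exists2 r, (1 <= r)%N & class_G (quot_vars I) r.
Proof.
move=> hI hI1 hI2 ta.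
have top := compressed_top compI.
have [mul11 mul12 [U [V [uI vI uv]]]] :=
  koszul_products compI compI1 compI2 s2 IE t2 hI hI1 hI2 ta.
have [dI _] := compressed_socle compI; have [[g go gI] _] := socle_degree_ps dI.
have [D RD] := quotient_rank top.
have [_ [_ ty] _ _ hI0] := compI.
apply: (@class_G_of_products _ _ _ D (qpi I g)) => //.
(* That the maximal ideal has corank 1 is the value of the Hilbert function in degree 0. *)
- have -> : [set a | exists v, a = dot (quot_vars I) v] =
      ideal_pow (maxideal (quot_vars I)) 1.
    apply/seteqP; split=> [_ [v ->]|_ /ideal_pow_order[f f1 ->]].
      have [W ->] := vector_lift v; apply/ideal_pow_order.
      exists (dot x W); last by rewrite -qpi_dot.
      by apply: (@dot_order _ 1 0) => // i; apply: ps_order_var.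
    exists (fun i => qpi I (ps_div f i)).
    by rewrite -[quot_vars I]/(fun i => qpi I (x i)) qpi_dot ps_div_dot // f1 ?mdeg0.
  have -> : [set: {ideal_quot I}] = ideal_pow (maxideal (quot_vars I)) 0.
    by apply/seteqP; split=> // u _; apply: ideal_pow0.
  have := hI0 0%N; rewrite !hQ_sub /= !subn0 (minn_idPl _) //.
  by rewrite binn addn_gt0 bin_gt0 addn2.
- suff <- : socle (quot_vars I) = ksocle (quot_vars I) by [].
  apply/seteqP; split=> u; have [f <-] := qpi_surj u.
    by move=> h i; apply/h/maxideal_var.
  move=> h; apply/socle_ps => i; apply/qpi_eq0.
  by rewrite rmorphM; apply: h.
- move=> i; rewrite quot_varsE -rmorphM; apply/qpi_eq0/top.
  by apply: (@ps_orderM _ _ 1 s) => //; apply: ps_order_var.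
- by move=> /qpi_eq0 gI'; rewrite gI' in gI.
- move=> u v; have [U' ->] := vector_lift u; have [W ->] := vector_lift v.
  move=> /lift_cycle1 aI /lift_cycle1 bI; have [p pP] := mul11 _ _ aI bI.
  by exists (qpi I p) => i; rewrite qpi_cross quot_varsE -rmorphM; apply/qpi_eq.
- move=> u v; have [U' ->] := vector_lift u; have [W ->] := vector_lift v.
  move=> /lift_cycle1 aI /lift_cycle2 bI; have [z zo zP] := mul12 _ _ aI bI.
  have [c zc] := top_line compI compI2 s2 IE t2 ta go gI zo.
  exists c; rewrite qpi_dot -linearZ; apply/qpi_eq.
  by rewrite -[dot U' W](subrK z) -addrA rpredD.
- exists (fun i => qpi I (U i)), (fun i => qpi I (V i)).
  split; [exact/lift_cycle1 | exact/lift_cycle2 | rewrite qpi_dot].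
  by move=> /qpi_eq0 uvI; rewrite uvI in uv.
Qed.

End CompressedType2.

Theorem corollary7p4 (F : realType) (k : fieldType)
    (I I1 I2 : idealr (powser 3 k)) (s1 s : nat)
    (homI : homogeneous_ideal I) (compI : compressed_type2 I s1 s)
    (homI1 : homogeneous_ideal I1) (compI1 : compressed_gorenstein I1)
    (homI2 : homogeneous_ideal I2) (compI2 : compressed_gorenstein I2)
    (I_cap : [set` I] = [set` I1] `&` [set` I2])
    (s_odd : odd s) (s_ge5 : (5 <= s)%N) :
  [/\ (s%:R + 1) / 2 <= s1%:R :> F /\ (s1 <= s)%N,
      (s%:R + 1) / 2 < Nbound F s < s%:R,
      s1%:R < Nbound F s ->
        exists2 r : nat, (1 <= r)%N & class_G (quot_vars I) r
    & Nbound F s <= s1%:R -> class_H00 (quot_vars I)].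
Proof.
have [t sE t2] : exists2 t, s = t.*2.+1 & (2 <= t)%N.
  by exists s./2; have := odd_double_half s; rewrite s_odd; lia.
subst s; have IE f : f \in I <-> f \in I1 /\ f \in I2.
  by change ([set` I] f <-> ([set` I1] `&` [set` I2]) f); rewrite I_cap.
clear s_odd s_ge5 I_cap.
(* The hypotheses are symmetric in [I1] and [I2]. A series of order [s] outside [I] is outside one
   of them, and the quotient by that ideal, being also a quotient of [Q/I], has socle degree exactly
   [s]. *)
wlog s2 : I1 I2 homI1 homI2 compI1 compI2 IE / socle_degree (quot_vars I2) t.*2.+1.
  move=> H; have [dI _] := compressed_socle compI.
  have [[f fo fI] top] := socle_degree_ps dI.
  have deg (J : idealr (powser 3 k)) : compressed_gorenstein J ->
      (forall g, g \in I -> g \in J) -> f \notin J ->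
      socle_degree (quot_vars J) t.*2.+1.
    move=> [_ _ [sg dsg _]] IJ fJ; suff <- : sg = t.*2.+1 by [].
    have [[g gs gJ] oJ] := socle_degree_ps dsg.
    apply/eqP; rewrite eqn_leq; apply/andP; split; rewrite leqNgt.
      by apply: contra gJ => lt; apply/IJ/top; apply: ps_orderW gs.
    by apply: contra fJ => lt; apply: oJ; apply: ps_orderW fo.
  have [f2|f2] := boolP (f \in I2); last first.
    by apply: (H I1 I2) => //; apply: deg => // g /IE[].
  apply: (H I2 I1) => // [g|]; first by rewrite IE; split=> -[].
  apply: deg => // [g /IE[]//|].
  by apply: contra fI => f1; apply/IE.
have ts1 := socle_degree_lower compI compI2 s2 IE t2.
have s1E : s1 = (t.+1 + (s1 - t.+1))%N by rewrite subnKC.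
split; last 2 first.
- rewrite {1}s1E Nbound_lt => ta.
  exact: (compressed_class_G compI compI1 compI2 s2 IE t2 homI homI1 homI2 ta).
- rewrite leNgt {1}s1E Nbound_lt -leqNgt => ta.
  exact: (compressed_golod compI compI2 s2 IE t2 ta).
- split; last by have [_ _ ? _ _] := compI.
  rewrite ler_pdivrMr // natr1 -natrM ler_nat; lia.
- exact: Nbound_range.
Qed.
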